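(* Let $z\in\mathcal I(W_n)$. If $M\in\mathsf{NCSP}(z)$ then $0_B(z,M)$ and $1_B(z,M)$ are minimal and maximal elements of $(\mathcal A(z)^{-1},<_A)$, respectively. Moreover, all minimal (respectively, maximal) elements of $(\mathcal A(z)^{-1},<_A)$ have the form $0_B(z,M)$ (respectively, $1_B(z,M)$) for some $M\in\mathsf{NCSP}(z)$.
   Context: $[n]=\{1,\dots,n\}$, $[\pm n]=\{\pm1,\dots,\pm n\}$, $n\ge1$. $W_n$ is the group of bijections $w:[\pm n]\to[\pm n]$ with $w(-i)=-w(i)$, a Coxeter group with simple generators $t_0=(-1,1)$, $t_i=(-i,-i-1)(i,i+1)$ ($i\in[n-1]$) and length function $\ell$. The Demazure product $\circ$ is the unique associative product on $W_n$ with $s\circ s=s$ for simple $s$ and $u\circ v=uv$ whenever $\ell(uv)=\ell(u)+\ell(v)$. $\mathcal I(W_n)=\{w:w=w^{-1}\}$. For $z\in\mathcal I(W_n)$, $\mathcal A(z)$ is the set of minimal-length $w\in W_n$ with $w^{-1}\circ w=z$, and $\mathcal A(z)^{-1}=\{w^{-1}:w\in\mathcal A(z)\}$. A word is a finite sequence of integers; $w\in W_n$ is identified with its one-line word $w_1\cdots w_n$. On $n$-letter words, $v\vartriangleleft_A w$ holds if $v,w$ agree outside three consecutive positions, where $v$ has $c\,a\,b$ and $w$ has $b\,c\,a$ for some $a<b<c$; $<_A$ is the transitive closure of $\vartriangleleft_A$. Let $\mathrm{Neg}(z)=\{i\in[n]:z(i)=-i\}$, $\mathrm{Fix}(z)=\{i\in[n]:z(i)=i\}$,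 $\mathrm{Pair}(z)=\{(a,b)\in[\pm n]\times[n]:|a|<z(a)=b\}$. $\mathsf{NCSP}(z)$ is the set of perfect matchings $M$ of $\mathrm{Neg}(z)\sqcup-\mathrm{Neg}(z)$ into 2-element blocks that are symmetric ($\{i,j\}\in M\Rightarrow\{-i,-j\}\in M$) and noncrossing (no blocks $\{i,k\},\{j,l\}$ with $i<j<k<l$). For $M\in\mathsf{NCSP}(z)$ define $\mathrm{Neg}(z,M)=\{i\in\mathrm{Neg}(z):\{i,-i\}\in M\}$, $\mathrm{Pair}(z,M)=\mathrm{Pair}(z)\sqcup\{(-b,a):\{a,b\}\in M,\ 0<a<b\}$, $\mathrm{Cyc}_B(z,M)=\mathrm{Pair}(z,M)\sqcup\{(-a,-a):a\in\mathrm{Neg}(z,M)\}\sqcup\{(a,a):a\in\mathrm{Fix}(z)\}$. Write $\mathrm{Cyc}_B(z,M)=\{(a_1,b_1),\dots,(a_l,b_l)\}=\{(c_1,d_1),\dots,(c_l,d_l)\}$ with $a_1<\cdots<a_l$ and $d_1<\cdots<d_l$. Then $0_B(z,M)=[[b_1a_1b_2a_2\cdots b_la_l]]$ and $1_B(z,M)=[[d_1c_1d_2c_2\cdots d_lc_l]]$, where $[[u]]$ denotes the word obtained from $u$ by omitting each repeated letter after its first appearance (reading left to right). These words are one-line representations of elements of $W_n$. *)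

(* Defs.v *)
From Stdlib Require Import Relation_Operators.
From mathcomp Require Import all_boot all_order all_algebra all_fingroup.

Set Implicit Arguments.
Unset Strict Implicit.
Unset Printing Implicit Defensive.

Import Order.TTheory GRing.Theory Num.Theory.

(* [±n]: the pair (false, i) stands for i + 1 and (true, i) for -(i + 1). *)
Definition pm (n : nat) : finType := (bool * 'I_n)%type.

Section SignedPermutations.

Variable n : nat.

Definition pos (i : 'I_n) : pm n := (false, i).
Definition neg (x : pm n) : pm n := (~~ x.1, x.2).
Definition toZ (x : pm n) : int :=
  if x.1 then (- Posz x.2.+1)%R else Posz x.2.+1.

Lemma negK : involutive neg.
Proof. by case=> b i; rewrite /neg negbK. Qed.

Definition signed_perms : {set {perm pm n}} :=
  [set w : {perm pm n} | [forall x, w (neg x) == neg (w x)]].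

Lemma signed_permsP (w : {perm pm n}) :
  reflect (forall x, w (neg x) = neg (w x)) (w \in signed_perms).
Proof. by rewrite inE; apply: 'forall_eqP. Qed.

Lemma signed_perms_group_set : group_set signed_perms.
Proof.
apply/group_setP; split=> [|u v /signed_permsP Hu /signed_permsP Hv].
  by apply/signed_permsP=> x; rewrite !perm1.
by apply/signed_permsP=> x; rewrite !permM Hu Hv.
Qed.
Canonical signed_perms_group := Group signed_perms_group_set.

Definition W := subg_of signed_perms_group.

Definition act (w : W) : pm n -> pm n := sgval w.

(* The product of permutations in mathcomp composes from left to right; here
   uv is the usual composition, (uv)(x) = u(v(x)). *)
Definition mulW (u v : W) : W := (v * u)%g.

(* t_0 = (-1,1) and t_i = (-i,-i-1)(i,i+1) for 0 < i < n. *)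
Definition sign_change (i : 'I_n) : {perm pm n} := tperm (neg (pos i)) (pos i).
Definition swap (i j : 'I_n) : {perm pm n} :=
  (tperm (neg (pos i)) (neg (pos j)) * tperm (pos i) (pos j))%g.
Definition simple : {set {perm pm n}} :=
  [set sign_change i | i : 'I_n & i == 0 :> nat]
    :|: [set swap p.1 p.2 | p : 'I_n * 'I_n & p.2 == p.1.+1 :> nat].

Lemma sign_changeE i b k :
  sign_change i (b, k) = if k == i then (~~ b, k) else (b, k).
Proof.
rewrite /sign_change permE /= /neg /pos /= !xpair_eqE.
by case: b => /=; case: (k =P i) => //= ->.
Qed.

Lemma swapE i j b k : swap i j (b, k) = (b, tperm i j k).
Proof.
have injb c : injective (fun l : 'I_n => (c, l) : pm n) by move=> l l' [].
have tpE c l : tperm ((c, i) : pm n) (c, j) (c, l) = (c, tperm i j l).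
  by rewrite (inj_tperm i j l (injb c)).
rewrite /swap permM /neg /pos /=; case: b; first by rewrite tpE tpermD.
by rewrite [X in tperm _ _ X]tpermD // tpE.
Qed.

Lemma sign_change_signed i : sign_change i \in signed_perms.
Proof.
by apply/signed_permsP=> -[b k]; rewrite /neg /= !sign_changeE; case: ifP.
Qed.

Lemma swap_signed i j : swap i j \in signed_perms.
Proof. by apply/signed_permsP=> -[b k]; rewrite /neg /= !swapE. Qed.

Lemma swapC i j : swap i j = swap j i.
Proof. by apply/permP=> -[b k]; rewrite !swapE tpermC. Qed.

Lemma perm3M (u v w : {perm pm n}) x : (u * v * w)%g x = w (v (u x)).
Proof. by rewrite !permM. Qed.

Lemma swap_gen i j : swap i j \in <<simple>>%g.
Proof.
wlog leij : i j / i <= j => [H|].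
  by case/orP: (leq_total i j) => /H //; rewrite swapC.
have [d Hd] : exists d, j = i + d :> nat by exists (j - i); rewrite subnKC.
elim: d j {leij} Hd => [|d IHd] j Hd.
  have -> : swap i j = 1%g; last exact: group1.
  have -> : j = i by apply: val_inj; rewrite /= Hd addn0.
  by apply/permP=> -[b k]; rewrite swapE perm1 tperm1 perm1.
have ltk : i + d < n by rewrite -addnS in Hd *; have := ltn_ord j; rewrite Hd addnS => /ltnW.
pose k := Ordinal ltk.
have Gik : swap i k \in <<simple>>%g by exact: IHd.
have Gkj : swap k j \in <<simple>>%g.
  apply: mem_gen; rewrite inE; apply/orP; right.
  by apply/imsetP; exists (k, j); rewrite ?inE //= Hd addnS.
have kj : k != j by rewrite -val_eqE /= Hd addnS neq_ltn ltnSn.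
have ij : i != j by rewrite -val_eqE /= Hd neq_ltn -[X in X < _]addn0 ltn_add2l.
case: (eqVneq k i) => [<- //|ki].
have -> : swap i j = (swap k j * swap i k * swap k j)%g; last first.
  exact: groupM (groupM Gkj Gik) Gkj.
apply/permP=> -[b l]; rewrite perm3M !swapE; congr (_, _).
have -> : tperm k j (tperm i k (tperm k j l)) = (tperm i k ^ tperm k j)%g l.
  by rewrite conjgE tpermV !permM.
by rewrite tpermJ tpermL (@tpermD _ k j i) // eq_sym.
Qed.

Lemma sign_change_gen i : sign_change i \in <<simple>>%g.
Proof.
have lt0 : 0 < n by apply: leq_ltn_trans (ltn_ord i).
pose o := Ordinal lt0.
have Go : sign_change o \in <<simple>>%g.
  by apply: mem_gen; rewrite inE; apply/orP; left; apply/imsetP; exists o; rewrite ?inE.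
have -> : sign_change i = (swap o i * sign_change o * swap o i)%g; last first.
  exact: groupM (groupM (swap_gen _ _) Go) (swap_gen _ _).
apply/permP=> -[b k]; rewrite perm3M swapE !sign_changeE.
rewrite (can2_eq (tpermK o i) (tpermK o i)) tpermL.
by case: ifP; rewrite swapE tpermK.
Qed.

Lemma simple_gen (w : {perm pm n}) : w \in signed_perms -> w \in <<simple>>%g.
Proof.
have [m] := ubnP #|[set i | w (pos i) != pos i]|.
elim: m w => // m IHm w; rewrite ltnS => lem Hw.
have /signed_permsP wN := Hw.
have [fixw|] := boolP [forall i, w (pos i) == pos i].
  have -> : w = 1%g; last exact: group1.
  move/forallP: fixw => fixw; apply/permP=> -[[] i]; rewrite perm1; last exact/eqP.
  have -> : (true, i) = neg (pos i) by [].
  by rewrite wN (eqP (fixw i)).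
rewrite negb_forall => /existsP[i nfi].
case Ei: (w (pos i)) => [b j].
pose g := (swap j i * (if b then sign_change i else 1))%g.
have gE c l : g (c, l) = (if b then sign_change i else 1%g) (c, tperm j i l).
  by rewrite /g permM swapE.
have Gg : g \in <<simple>>%g.
  by rewrite groupM ?swap_gen //; case: (b); rewrite ?sign_change_gen ?group1.
have Wg : g \in signed_perms.
  rewrite (@groupM _ signed_perms_group) ?swap_signed //.
  by case: (b); rewrite ?sign_change_signed ?(@group1 _ signed_perms_group).
rewrite -(groupMr _ Gg); apply: IHm; last by rewrite (@groupM _ signed_perms_group).
apply: leq_trans lem; apply: proper_card; apply/properP; split; last first.
  exists i; rewrite !inE ?nfi // permM Ei gE tpermL.
  by case: (b); rewrite ?perm1 ?sign_changeE ?eqxx.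
apply/subsetP=> k; rewrite !inE; apply: contra => /eqP fk.
have ki : k != i by apply: contraNneq nfi => <-; rewrite fk.
have kj : k != j.
  apply/eqP=> kj; move: fk; rewrite kj => fj.
  case: b Ei {g gE Gg Wg} => Ei.
    have : w (neg (pos i)) = w (pos j) by rewrite wN Ei fj.
    by move/perm_inj.
  have /perm_inj[ij] : w (pos i) = w (pos j) by rewrite Ei fj.
  by rewrite kj ij eqxx in ki.
rewrite permM fk gE tpermD 1?eq_sym //.
by case: (b); rewrite ?perm1 ?sign_changeE ?(negbTE ki).
Qed.

Lemma cox_length_ex (w : W) : exists k, sgval w \in (simple ^+ k)%g.
Proof.
have /gen_prodgP[k [c Hc ->]] := simple_gen (subgP w).
exists k; elim: k c Hc => [|k IHk] c Hc; first by rewrite big_ord0 expg0 set11.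
by rewrite big_ord_recr expgSr mem_mulg ?IHk.
Qed.

(* [simple ^+ k] is the set of products of k simple generators. *)
Definition cox_length (w : W) : nat := ex_minn (cox_length_ex w).

(* At most one operation satisfies these properties, and the Demazure product
   does; it enters below as a parameter op subject to them. *)
Record is_demazure (op : W -> W -> W) : Prop := IsDemazure {
  demazure_assoc : associative op;
  demazure_simple : forall s : W, sgval s \in simple -> op s s = s;
  demazure_mul : forall u v : W,
    cox_length (mulW u v) = cox_length u + cox_length v -> op u v = mulW u v }.

Definition involutions : {set W} := [set w : W | w == w^-1%g].

Definition atoms (op : W -> W -> W) (z : W) : {set W} :=
  [set w : W | (op w^-1%g w == z)
     && [forall v : W, (op v^-1%g v == z) ==> (cox_length w <= cox_length v)]].

Definition inv_atoms (op : W -> W -> W) (z : W) : {set W} :=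
  [set w^-1%g | w in atoms op z].

Definition oneline (w : W) : seq int := [seq toZ (act w (pos i)) | i <- enum 'I_n].

End SignedPermutations.

Inductive step_A : seq int -> seq int -> Prop :=
  StepA (p q : seq int) (a b c : int) of (a < b)%R & (b < c)%R :
    step_A (p ++ [:: c; a; b] ++ q) (p ++ [:: b; c; a] ++ q).

Definition lt_A : seq int -> seq int -> Prop := clos_trans (seq int) step_A.

Definition is_minimal (n : nat) (A : {set W n}) (u : seq int) : Prop :=
  (exists2 w, w \in A & oneline w = u)
  /\ (forall v, v \in A -> ~ lt_A (oneline v) u).

Definition is_maximal (n : nat) (A : {set W n}) (u : seq int) : Prop :=
  (exists2 w, w \in A & oneline w = u)
  /\ (forall v, v \in A -> ~ lt_A u (oneline v)).

Section Matchings.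

Variables (n : nat) (z : W n).

Definition Neg : {set pm n} :=
  [set i | (0 < toZ i)%R && (act z i == neg i)].

Definition Fix : {set pm n} :=
  [set i | (0 < toZ i)%R && (act z i == i)].

Definition Pair : {set pm n * pm n} :=
  [set p | [&& (0 < toZ p.2)%R, (`|toZ p.1| < toZ (act z p.1))%R
             & act z p.1 == p.2]].

Definition NCSP (M : {set {set pm n}}) : Prop :=
  [/\ partition M (Neg :|: [set neg i | i in Neg]),
      forall B, B \in M -> #|B| = 2,
      forall i j, [set i; j] \in M -> [set neg i; neg j] \in M
    & ~ exists i j k l : pm n,
        [/\ (toZ i < toZ j < toZ k)%R, (toZ k < toZ l)%R,
            [set i; k] \in M & [set j; l] \in M]].

Variable M : {set {set pm n}}.

Definition NegM : {set pm n} := [set i in Neg | [set i; neg i] \in M].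

Definition PairM : {set pm n * pm n} :=
  Pair :|: [set (neg p.2, p.1) | p : pm n * pm n &
              ([set p.1; p.2] \in M) && (0 < toZ p.1 < toZ p.2)%R].

Definition CycB : {set pm n * pm n} :=
  PairM :|: [set (neg a, neg a) | a in NegM] :|: [set (a, a) | a in Fix].

(* [undup] keeps the last occurrence of each letter, hence the reversals. *)
Definition first_occurrences (u : seq int) : seq int := rev (undup (rev u)).

Definition word_ba (s : seq (pm n * pm n)) : seq int :=
  first_occurrences (flatten [seq [:: toZ p.2; toZ p.1] | p <- s]).

Definition zeroB : seq int :=
  word_ba (sort (fun p q => toZ p.1 <= toZ q.1)%R (enum CycB)).

Definition oneB : seq int :=
  word_ba (sort (fun p q => toZ p.2 <= toZ q.2)%R (enum CycB)).

End Matchings.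

(* Main.v *)
(* If [u = w^-1] with [w] an atom of [z], then [z] is the Demazure product of [u]
   and [u^-1], which can be computed by removing left descents of [u] one at a time.
   The braid relations show that the set of such [u] is stable under exchanging
   [c a b] and [b c a], and that their words have no consecutive [c b a].  So the
   minimal (maximal) ones are those without consecutive [b c a] ([c a b]), and such
   a word is a concatenation of blocks [b a] and [a], one for each descent and each
   remaining letter, with increasing minima (maxima).  The main point is that a word
   made of blocks satisfying a common weakening of these two conditions is an
   inverse atom of [z] iff its blocks are the pairs of [Cyc_B(z, M)] for some [M] in
   [NCSP(z)]: acting by a left descent changes the word, its blocks and [z] only
   locally, so this follows by induction on the length.  Minimality of the length is
   controlled by the rank function of the involution weak order. *)
From Stdlib Require Import Relation_Operators.
From mathcomp Require Import all_boot all_order all_algebra all_fingroup.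
From mathcomp Require Import zify.
Require Import Defs.

Set Implicit Arguments.
Unset Strict Implicit.
Unset Printing Implicit Defensive.

Import Order.TTheory GRing.Theory Num.Theory.

Local Open Scope ring_scope.

(** * Signed permutations as odd functions on the integers *)

(** Left multiplication of [u] by [t_i] changes letters and keeps positions, and at a left ascent of
    [u] it turns the Demazure square z into t_i o z o t_i; hence the induction runs over left
    descents. Consecutive patterns concern positions, so they come from right multiplication. What
    is proved by induction has to be an equivalence, for every relation [C] of the right form, valid
    or not: one direction identifies the blocks of a given atom, the other certifies a word built
    from a matching, and a block such as [-i, -(i+1)] makes both sides false. The weakened order
    condition lets a single induction serve 0_B and 1_B. For lengths, a left ascent of [u] raises
    the rank of the square by one or leaves it unchanged, so the rank is at most the length; since
    every involution is the square of some [u] attaining equality, inverse atoms are exactly the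
    cases of equality. Letters, positions and involutions are all handled as odd functions on the
    integers, which leaves the many local cases to linear arithmetic. *)

Section Extension.

Variable n : nat.
Implicit Types (p q : pm n) (u v w : W n) (x y : int) (k : nat).

Lemma toZ_inj : injective (@toZ n).
Proof.
case=> [b i] [c j]; rewrite /toZ /= => E.
have [-> Eij] : b = c /\ nat_of_ord i = j by case: b c E => [] []; lia.
by congr pair; apply: val_inj.
Qed.

Lemma toZ_neg p : toZ (neg p) = - toZ p.
Proof. by case: p => [[] i]; rewrite /toZ /= ?opprK. Qed.

Lemma toZ_range p : 0 < `|toZ p| <= n.
Proof. by case: p => [[] i]; rewrite /toZ /=; have := ltn_ord i; lia. Qed.

Lemma toZ_surj x : 0 < `|x| <= n -> exists p, x = toZ p.
Proof.
case: x => [[|k]|k] // Hk.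
  have kn : (k < n)%N by lia.
  by exists (false, Ordinal kn).
have kn : (k < n)%N by lia.
by exists (true, Ordinal kn); rewrite /toZ /=; lia.
Qed.

Definition of_int x : option (pm n) :=
  match x with
  | Posz k.+1 => omap (pair false) (insub k)
  | Negz k => omap (pair true) (insub k)
  | _ => None
  end.

Lemma of_int_toZ p : of_int (toZ p) = Some p.
Proof.
case: p => [[] i].
  by have -> : toZ (true, i) = Negz i by []; rewrite /= valK.
by rewrite /toZ /= valK.
Qed.

Lemma of_int_out x : ~~ (0 < `|x| <= n) -> of_int x = None.
Proof. by case: x => [[|k]|k] //= Hk; rewrite insubN //; lia. Qed.

(* Extending a signed permutation by the identity outside [±n], in particular
   by 0 at 0, makes both kinds of simple generators obey one descent rule:
   [t_i] is a right descent of [w] iff [ext w i > ext w (i + 1)]. *)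
Definition ext w x : int := if of_int x is Some p then toZ (act w p) else x.

Lemma ext_toZ w p : ext w (toZ p) = toZ (act w p).
Proof. by rewrite /ext of_int_toZ. Qed.

Lemma ext_out w x : ~~ (0 < `|x| <= n) -> ext w x = x.
Proof. by move=> Hx; rewrite /ext of_int_out. Qed.

Lemma ext0 w : ext w 0 = 0.
Proof. by rewrite ext_out. Qed.

Lemma actN w p : act w (neg p) = neg (act w p).
Proof. by move/signed_permsP: (subgP w) => H; exact: H. Qed.

Lemma extN w x : ext w (- x) = - ext w x.
Proof.
case: (boolP (0 < `|x| <= n)) => Hx; last by rewrite !ext_out // normrN.
by have [p ->] := toZ_surj Hx; rewrite -toZ_neg !ext_toZ actN toZ_neg.
Qed.

Lemma ext_mulW u v x : ext (mulW u v) x = ext u (ext v x).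
Proof.
case: (boolP (0 < `|x| <= n)) => Hx; last by rewrite !ext_out.
by have [p ->] := toZ_surj Hx; rewrite !ext_toZ /act /mulW /= permM.
Qed.

Lemma ext1 x : ext 1%g x = x.
Proof.
case: (boolP (0 < `|x| <= n)) => Hx; last by rewrite !ext_out.
by have [p ->] := toZ_surj Hx; rewrite !ext_toZ /act /= perm1.
Qed.

Lemma mulWV u : mulW u u^-1%g = 1%g.
Proof. by rewrite /mulW mulVg. Qed.

Lemma mulVW u : mulW u^-1%g u = 1%g.
Proof. by rewrite /mulW mulgV. Qed.

Lemma mulWA : associative (@mulW n).
Proof. by move=> u v w; rewrite /mulW mulgA. Qed.

Lemma mulW1 u : mulW u 1%g = u.
Proof. by rewrite /mulW mul1g. Qed.

Lemma mul1W u : mulW 1%g u = u.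
Proof. by rewrite /mulW mulg1. Qed.

Lemma invW_mul u v : (mulW u v)^-1%g = mulW v^-1%g u^-1%g.
Proof. by rewrite /mulW invMg. Qed.

Lemma extK u : cancel (ext u) (ext u^-1%g).
Proof. by move=> x; rewrite -ext_mulW mulVW ext1. Qed.

Lemma extVK u : cancel (ext u^-1%g) (ext u).
Proof. by move=> x; rewrite -ext_mulW mulWV ext1. Qed.

Lemma ext_inj u : injective (ext u).
Proof. exact: can_inj (extK u). Qed.

Lemma ext_range u x : (0 < `|ext u x| <= n) = (0 < `|x| <= n).
Proof.
have H w y : 0 < `|y| <= n -> 0 < `|ext w y| <= n.
  by move=> Hy; have [p ->] := toZ_surj Hy; rewrite ext_toZ toZ_range.
by apply/idP/idP => [Hx|]; [rewrite -(extK u x); exact: H | exact: H].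
Qed.

Lemma eq_ext u v : ext u =1 ext v -> u = v.
Proof.
move=> E; apply: val_inj; apply/permP=> p; apply: toZ_inj.
by rewrite -!ext_toZ E.
Qed.

Lemma ext_le u x : `|x| <= n -> `|ext u x| <= n.
Proof.
case: (x =P 0) => [->|/eqP x0 Hx]; first by rewrite ext0.
have := ext_range u x; lia.
Qed.

Lemma ext_eq0 u x : (ext u x == 0) = (x == 0).
Proof. by rewrite -{1}(ext0 u) (inj_eq (@ext_inj u)). Qed.

Lemma invol_ext u : u^-1%g = u -> forall x, ext u (ext u x) = x.
Proof. by move=> E x; rewrite -{1}E extK. Qed.

End Extension.

(* [sx i] is the action on integers of the generator [t_i], i.e. [ext (sg i)]. *)
Definition sx (i : nat) (x : int) : int :=
  if i == 0%N then (if `|x| == 1 then - x else x)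
  else if x == i then i.+1%:Z else if x == i.+1 then i%:Z
  else if x == - i%:Z then - i.+1%:Z else if x == - i.+1%:Z then - i%:Z else x.

Lemma sx0_spec (x : int) :
  (x = 1 /\ sx 0 x = -1) \/ (x = -1 /\ sx 0 x = 1)
  \/ (x <> 1 /\ x <> -1 /\ sx 0 x = x).
Proof.
rewrite /sx eqxx; case: ifP => H; last by right; right; lia.
by case: (x =P 1) => [->|]; [left | right; left; lia].
Qed.

Lemma sx_spec i (x : int) : (0 < i)%N ->
  (x = i /\ sx i x = i.+1) \/ (x = i.+1 /\ sx i x = i)
  \/ (x = - i%:Z /\ sx i x = - i.+1%:Z) \/ (x = - i.+1%:Z /\ sx i x = - i%:Z)
  \/ (`|x| <> i /\ `|x| <> i.+1 /\ sx i x = x).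
Proof.
move=> i0; rewrite /sx ifF; last by lia.
case: eqP => [|H1]; first by left.
case: eqP => [|H2]; first by right; left.
case: eqP => [|H3]; first by right; right; left.
case: eqP => [|H4]; first by right; right; right; left.
by right; right; right; right; lia.
Qed.

Lemma sxK i : involutive (sx i).
Proof.
move=> x; case: (posnP i) => [->|i0].
  by have := sx0_spec x; have := sx0_spec (sx 0 x); lia.
by have := sx_spec x i0; have := sx_spec (sx i x) i0; lia.
Qed.

Lemma sxN i x : sx i (- x) = - sx i x.
Proof.
case: (posnP i) => [->|i0].
  by have := sx0_spec x; have := sx0_spec (- x); lia.
by have := sx_spec x i0; have := sx_spec (- x) i0; lia.
Qed.

Section Generators.

Variable n : nat.
Implicit Types (i j : 'I_n) (u v w : W n).

(** The letters i and i+1 are the ordinals i-1 and i, so a single index [i : 'I_n] runs over all n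
    generators. *)
Definition sg_perm i : {perm pm n} :=
  if i == 0 :> nat then sign_change i
  else swap (Ordinal (leq_ltn_trans (leq_pred i) (ltn_ord i))) i.

Lemma sg_perm_signed i : sg_perm i \in signed_perms n.
Proof. by rewrite /sg_perm; case: ifP; rewrite ?sign_change_signed ?swap_signed. Qed.

Definition sg i : W n := Subg (sg_perm_signed i).

Lemma sg_simple i : sgval (sg i) \in simple n.
Proof.
rewrite inE /= /sg_perm; apply/orP; case: ifP => Hi; [left | right].
  by apply/imsetP; exists i; rewrite ?inE.
apply/imsetP; exists (Ordinal (leq_ltn_trans (leq_pred i) (ltn_ord i)), i) => //.
by rewrite inE /= prednK // lt0n Hi.
Qed.

Lemma simpleP s : s \in simple n -> exists i, s = sg_perm i.
Proof.
rewrite inE => /orP[] /imsetP[].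
  by move=> i; rewrite inE => Hi ->; exists i; rewrite /sg_perm Hi.
case=> [i j]; rewrite inE /= => Hj ->; exists j.
rewrite /sg_perm ifF; last by rewrite (eqP Hj).
by congr (swap _ _); apply: val_inj; rewrite /= (eqP Hj).
Qed.

Lemma ext_sg i : ext (sg i) =1 sx i.
Proof.
move=> x; have lti := ltn_ord i.
case: (boolP (0 < `|x| <= n)) => Hx; last first.
  rewrite ext_out //; case: (posnP i) => [i0|i0]; last by have := sx_spec x i0; lia.
  by rewrite i0; have := sx0_spec x; lia.
have [[b k] ->] := toZ_surj Hx; rewrite ext_toZ /act /= /sg_perm.
case: (posnP i) => [i0|i0].
  rewrite i0 sign_changeE -val_eqE /= i0 /toZ /=.
  have := sx0_spec (if b then - k.+1%:Z else k.+1).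
  by case: eqP => E; case: b {Hx} => /=; lia.
rewrite swapE; case: tpermP => [->|->|] /=.
- have := sx_spec (if b then - i.-1.+1%:Z else i.-1.+1) i0.
  by rewrite /toZ /=; case: b {Hx}; lia.
- have := sx_spec (if b then - i.+1%:Z else i.+1) i0.
  by rewrite /toZ /=; case: b {Hx}; lia.
move=> /eqP; rewrite -val_eqE /= => ki1 /eqP; rewrite -val_eqE /= => ki.
have := sx_spec (toZ (b, k)) i0.
by rewrite /toZ /=; case: b {Hx}; lia.
Qed.

Lemma sgV i : (sg i)^-1%g = sg i.
Proof.
by apply: eq_ext => x; apply: (@ext_inj _ (sg i)); rewrite extVK !ext_sg sxK.
Qed.

Lemma sgsg i : mulW (sg i) (sg i) = 1%g.
Proof. by rewrite -{1}sgV mulVW. Qed.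

Lemma ext_sgl i u x : ext (mulW (sg i) u) x = sx i (ext u x).
Proof. by rewrite ext_mulW ext_sg. Qed.

Lemma ext_sgr i u x : ext (mulW u (sg i)) x = ext u (sx i x).
Proof. by rewrite ext_mulW ext_sg. Qed.

End Generators.

(** * The length function *)

Section Length.

Variable n : nat.
Implicit Types (i j : 'I_n) (u v w : W n) (g : {perm pm n}) (p q r : pm n).

Definition inversions g : {set pm n * pm n} :=
  [set p | (toZ p.1 < toZ p.2) && (toZ (g p.2) < toZ (g p.1))].

Definition negatives g : {set pm n} := [set p | (0 < toZ p) && (toZ (g p) < 0)].

(** Applying the transposition to both entries of a pair is a bijection from the inversions of [g]
    onto those of the product other than [(p, q)]. Adjacency is measured by [toZ], which omits 0, so
    -1 and 1 are adjacent as well. *)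
Lemma card_inversions_tperm g p q :
    toZ p < toZ q -> (forall r, ~~ (toZ p < toZ r < toZ q)) ->
    toZ (g p) < toZ (g q) ->
  #|inversions (tperm p q * g)%g| = #|inversions g|.+1.
Proof.
move=> split_adjacent adj gpq.
pose h (x : pm n * pm n) := (tperm p q x.1, tperm p q x.2).
have hK : involutive h by case=> x y; rewrite /h /= !tpermK.
have ht x y : toZ x < toZ y -> (x, y) != (p, q) ->
    toZ (tperm p q x) < toZ (tperm p q y).
  have E (a b : pm n) : (a == b) = (toZ a == toZ b) by rewrite (inj_eq (@toZ_inj n)).
  rewrite xpair_eqE; have := adj x; have := adj y.
  by case: (tpermP p q x) => [->|->|/eqP + /eqP +];
    case: (tpermP p q y) => [->|->|/eqP + /eqP +]; rewrite !E; lia.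
have -> : inversions (tperm p q * g)%g = (p, q) |: h @: inversions g.
  apply/setP=> -[x y]; rewrite (can_imset_pre _ hK) !inE /= !permM.
  case: (eqVneq (x, y) (p, q)) => [[-> ->]|xypq].
    by rewrite tpermL tpermR split_adjacent.
  case: (boolP (toZ x < toZ y)) => [xy|xy] /=; first by rewrite ht.
  apply/esym/negP => /andP[txy gxy].
  case: (eqVneq (tperm p q x, tperm p q y) (p, q)) => [[Ex Ey]|/(ht _ _ txy)].
    by move: gxy; rewrite Ex Ey; lia.
  by rewrite !tpermK (negPf xy).
rewrite cardsU1 (can_imset_pre _ hK) !inE /= tpermL tpermR -(can_imset_pre _ hK).
by rewrite card_imset ?ltNge ?(ltW split_adjacent) //; apply: can_inj hK.
Qed.

(** Twice the Coxeter length. At an ascent [t_0] creates one inversion of [±n] and one negative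
    value, while [t_i] with i > 0 creates two inversions; the second summand makes both increments
    equal to two. *)
Definition dlen w := (#|inversions (sgval w)| + #|negatives (sgval w)|)%N.

Lemma dlen1 : dlen 1%g = 0%N.
Proof.
rewrite /dlen; suff [-> ->] : inversions (sgval (1%g : W n)) = set0
    /\ negatives (sgval (1%g : W n)) = set0 by rewrite !cards0.
by split; apply/setP=> p; rewrite !inE ?perm1 /=; lia.
Qed.

Lemma ext_pos w i : toZ (sgval w (pos i)) = ext w i.+1.
Proof. by rewrite -[(i.+1)%:Z]/(toZ (pos i)) ext_toZ. Qed.

Lemma ext_neg w i : toZ (sgval w (neg (pos i))) = - ext w i.+1.
Proof. by rewrite -ext_pos -toZ_neg -actN. Qed.

Lemma dlen_asc w i : ext w i < ext w i.+1 -> dlen (mulW w (sg i)) = (dlen w).+2.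
Proof.
rewrite /dlen /= /sg_perm; case: (posnP i) => [i0|i0] wi.
  rewrite i0 ext0 in wi; rewrite card_inversions_tperm; first last.
  - by rewrite ext_neg ext_pos i0; lia.
  - by move=> r; have := toZ_range r; rewrite /toZ /= i0; lia.
  - by rewrite /toZ /= i0.
  suff -> : negatives (sign_change i * sgval w)%g = pos i |: negatives (sgval w).
    by rewrite cardsU1 !inE ext_pos i0 (lt_gtF wi) andbF /=; lia.
  apply/setP=> -[b k]; rewrite !inE permM sign_changeE xpair_eqE.
  case: (eqVneq k i) => [->|_] /=; last by rewrite andbF.
  case: b => /=; rewrite ?andbF //=.
  by rewrite -[(true, i)]/(neg (pos i)) ext_neg i0; lia.
set j := Ordinal _.
have Ej : j.+1 = i by rewrite /= prednK.
have adj (r : pm n) : toZ r != 0 by have := toZ_range r; lia.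
rewrite /swap -mulgA tpermC card_inversions_tperm; first last.
- rewrite !permM ![tperm (pos j) (pos i) _]tpermD // !ext_neg Ej; lia.
- by move=> r; rewrite !toZ_neg /toZ /=; case: r => [[] k] /=; lia.
- by rewrite !toZ_neg /toZ /=; lia.
rewrite card_inversions_tperm; first last.
- by rewrite !ext_pos Ej.
- by move=> r; rewrite /toZ /=; case: r => [[] k] /=; lia.
- by rewrite /toZ /=; lia.
rewrite !mulgA tpermC -[(tperm _ _ * tperm _ _)%g]/(swap j i) !addSn.
(* The swap preserves signs, so the new set of negatives is the preimage of the old one. *)
congr (_ + _).+2; rewrite -(card_preimset (negatives (sgval w)) (@perm_inj _ (swap j i))).
congr #|pred_of_set _|; apply/setP=> -[b k]; rewrite !inE permM swapE.
by congr (_ && _); rewrite /toZ /=; case: b; lia.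
Qed.

Lemma mulW_sgK w i : mulW (mulW w (sg i)) (sg i) = w.
Proof. by rewrite -mulWA sgsg mulW1. Qed.

Lemma sg_mulWK w i : mulW (sg i) (mulW (sg i) w) = w.
Proof. by rewrite mulWA sgsg mul1W. Qed.

Lemma sx_i i : sx i i = (if i == 0%N :> nat then 0 else i.+1%:Z).
Proof. by case: posnP => [->|i0] //; have := sx_spec i i0; lia. Qed.

Lemma sx_iS i : sx i i.+1 = (if i == 0%N :> nat then -1 else i%:Z).
Proof. by case: posnP => [->|i0] //; have := sx_spec i.+1 i0; lia. Qed.

(* For [i = 0] both sides compare [0] with [± ext w 1]. *)
Lemma sgr_asc w i :
  (ext (mulW w (sg i)) i < ext (mulW w (sg i)) i.+1) = (ext w i.+1 < ext w i).
Proof.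
rewrite !ext_sgr sx_i sx_iS; case: posnP => [->|//].
have -> : ext w (-1) = - ext w 1%N by exact: extN.
by rewrite !ext0; lia.
Qed.

Lemma ext_ltgt w i : (ext w i.+1 < ext w i) = ~~ (ext w i < ext w i.+1).
Proof.
have : ext w i != ext w i.+1 by rewrite (inj_eq (@ext_inj _ w)); lia.
lia.
Qed.

Lemma dlen_desc w i : ext w i.+1 < ext w i -> dlen w = (dlen (mulW w (sg i))).+2.
Proof.
by rewrite -sgr_asc => H; rewrite -[in LHS](mulW_sgK w i) dlen_asc.
Qed.

(** Increase from the value 0 at 0 forces w k >= k, and increase up to a value at most n at n forces
    w k <= k. *)
Lemma increasing_id w : (forall i, ext w i < ext w i.+1) -> w = 1%g.
Proof.
move=> H; have incr (k : nat) : (k < n)%N -> ext w k < ext w k.+1.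
  by move=> kn; exact: (H (Ordinal kn)).
have lo (k : nat) : (k <= n)%N -> k%:Z <= ext w k.
  elim: k => [|k IH] kn; first by rewrite ext0.
  by have := IH (ltnW kn); have := incr _ kn; lia.
have hi (d k : nat) : (k + d = n)%N -> ext w k <= k.
  elim: d k => [|d IH] k kd.
    by have := @ext_le _ w k; lia.
  by have := IH k.+1; have := incr k; lia.
have E (k : nat) : (k <= n)%N -> ext w k = k.
  by move=> kn; have := lo k kn; have := hi (n - k)%N k (subnKC kn); lia.
apply: eq_ext => x; rewrite ext1.
case: (boolP (`|x| <= n)) => Hx; last by rewrite ext_out //; lia.
case: x Hx => k Hk; first by rewrite E //; lia.
by rewrite NegzE extN E //; lia.
Qed.

Lemma descent_exists w : w != 1%g -> exists i, ext w i.+1 < ext w i.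
Proof.
move=> w1; case: (boolP [forall i : 'I_n, ext w i < ext w i.+1]).
  by move/forallP/increasing_id => E; rewrite E eqxx in w1.
by rewrite negb_forall => /existsP[i]; rewrite -ext_ltgt; exists i.
Qed.

Lemma dlen_simple k w : sgval w \in (simple n ^+ k)%g -> (dlen w <= k.*2)%N.
Proof.
elim: k w => [|k IH] w.
  rewrite expg0 => /set1P E; suff -> : w = 1%g by rewrite dlen1.
  exact: val_inj.
rewrite expgS => /mulsgP[s a /simpleP[i Ei] Ha Ew].
have /IH : sgval (mulW w (sg i)) \in (simple n ^+ k)%g.
  rewrite /= Ew Ei mulgA.
  have := congr1 (@sgval _ _) (sgsg i); rewrite /mulW /= => ->.
  by rewrite mul1g.
case: (boolP (ext w i < ext w i.+1)) => [/dlen_asc|]; first by lia.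
by rewrite -ext_ltgt => /dlen_desc; lia.
Qed.

Lemma simple_dlen w : exists k, sgval w \in (simple n ^+ k)%g /\ dlen w = k.*2.
Proof.
have [m] := ubnP (dlen w); elim: m w => // m IH w lem.
case: (eqVneq w 1%g) => [->|/descent_exists[i Hi]].
  by exists 0%N; rewrite dlen1 expg0 set11.
have E := dlen_desc Hi; have [|k [Hk Ek]] := IH (mulW w (sg i)); first by lia.
exists k.+1; split; last by rewrite E Ek doubleS.
rewrite -[w](mulW_sgK w i) expgS; apply: mem_mulg => //.
exact: sg_simple.
Qed.

(** A product of k generators has [dlen] at most 2k, and removing descents one at a time writes [w]
    as a product attaining this bound. *)
Lemma dlenE w : dlen w = (cox_length w).*2.
Proof.
rewrite /cox_length; case: ex_minnP => m Hm min.
have [k [Hk Ek]] := simple_dlen w.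
by have := min _ Hk; have := dlen_simple Hm; rewrite Ek; lia.
Qed.

Lemma len1 : cox_length (1%g : W n) = 0%N.
Proof. by have := dlenE 1%g; rewrite dlen1; lia. Qed.

Lemma len_sgr_asc w i :
  ext w i < ext w i.+1 -> cox_length (mulW w (sg i)) = (cox_length w).+1.
Proof. by move/dlen_asc; rewrite !dlenE; lia. Qed.

Lemma len_sgr_desc w i :
  ext w i.+1 < ext w i -> cox_length w = (cox_length (mulW w (sg i))).+1.
Proof. by move/dlen_desc; rewrite !dlenE; lia. Qed.

Lemma len_sg i : cox_length (sg i) = 1%N.
Proof.
by rewrite -[sg i](mul1W (sg i)) len_sgr_asc ?len1 // !ext1; lia.
Qed.

Lemma simpleV k (a : {perm pm n}) : a \in (simple n ^+ k)%g -> (a^-1 \in simple n ^+ k)%g.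
Proof.
elim: k a => [|k IH] a; first by rewrite expg0 !inE => /eqP->; rewrite invg1.
rewrite {1}expgS => /mulsgP[s b Hs Hb ->]; rewrite invMg expgSr.
apply: mem_mulg; first exact: IH.
have [i ->] := simpleP Hs.
have E := congr1 (@sgval _ _) (sgV i); rewrite /= in E.
by rewrite E; exact: sg_simple.
Qed.

Lemma lenV w : cox_length w^-1%g = cox_length w.
Proof.
suff le v : (cox_length v^-1%g <= cox_length v)%N.
  by apply/eqP; rewrite eqn_leq le -{1}[w]invgK le.
rewrite {2}/cox_length; case: ex_minnP => m Hm _.
by rewrite /cox_length; case: ex_minnP => k _; apply; exact: simpleV Hm.
Qed.

Lemma len_sgl_asc w i : ext w^-1%g i < ext w^-1%g i.+1 ->
  cox_length (mulW (sg i) w) = (cox_length w).+1.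
Proof.
by move=> H; rewrite -lenV invW_mul sgV len_sgr_asc // lenV.
Qed.

Lemma len_sgl_desc w i : ext w^-1%g i.+1 < ext w^-1%g i ->
  cox_length w = (cox_length (mulW (sg i) w)).+1.
Proof.
by move=> H; rewrite -[LHS]lenV (len_sgr_desc H) -[X in X.+1]lenV invW_mul sgV invgK.
Qed.

End Length.

(** * The rank function of the involution weak order *)

Section Rank.

Variable n : nat.
Implicit Types (i : 'I_n) (z : W n) (p : pm n).

Lemma actZ z p : toZ (act z p) = ext z (toZ p).
Proof. by rewrite ext_toZ. Qed.

Lemma act_eq z p q : (act z p == q) = (ext z (toZ p) == toZ q).
Proof. by rewrite ext_toZ (inj_eq (@toZ_inj n)). Qed.

Definition fix_set z : {set pm n} := [set p | act z p == p].
Definition neg_set z : {set pm n} := [set p | act z p == neg p].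

(* Eight times the rank of [z] in the involution weak order: the rank is
   [(ell z + d) / 2] where [d] is the dimension of the (-1)-eigenspace of [z]
   on Z^n, i.e. [n - trace z = 2 d], and [dlen = 2 ell]. *)
Definition rank8 z : int :=
  (2 * dlen z + #|neg_set z|)%N%:Z - #|fix_set z|%:Z + (2 * n)%N%:Z.

Definition moved i : {set pm n} := [set p | act (sg i) p != p].

Lemma card_moved i : #|moved i| = (if i == 0%N :> nat then 2 else 4)%N.
Proof.
case: (posnP i) => [i0|i0].
  have -> : moved i = [set pos i; neg (pos i)].
    apply/setP=> p; rewrite !inE act_eq ext_sg -!(inj_eq (@toZ_inj n)) toZ_neg.
    by rewrite i0 [toZ (pos i)]/= /toZ /= i0; have := sx0_spec (toZ p); rewrite /toZ /=; lia.
  by rewrite cards2 -(inj_eq (@toZ_inj n)) toZ_neg /toZ /=; lia.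
pose j := Ordinal (leq_ltn_trans (leq_pred i) (ltn_ord i)).
have Ej : toZ (pos j) = i by rewrite /toZ /= prednK.
have Ei : toZ (pos i) = i.+1 by [].
have -> : moved i = pos i |: (neg (pos i) |: [set pos j; neg (pos j)]).
  apply/setP=> p; rewrite !inE act_eq ext_sg -!(inj_eq (@toZ_inj n)) !toZ_neg Ei Ej.
  by have := sx_spec (toZ p) i0; lia.
by rewrite !cardsU1 cards1 !inE -!(inj_eq (@toZ_inj n)) !toZ_neg Ei Ej; lia.
Qed.

(** Commutation of an involution with [t_i], tested at a single value; oddness and involutivity of
    [z] give the rest in [comm_condP]. *)
Definition comm_cond i z : bool :=
  if i == 0%N :> nat then `|ext z 1%N| == 1 else ext z i.+1 == sx i (ext z i).

Lemma comm_cond0 i z : i = 0%N :> nat -> comm_cond i z = (`|ext z 1%N| == 1).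
Proof. by rewrite /comm_cond => ->. Qed.

Lemma comm_condS i z : (0 < i)%N -> comm_cond i z =
  [|| (ext z i == i) && (ext z i.+1 == i.+1),
      (ext z i == - i.+1%:Z) && (ext z i.+1 == - i%:Z),
      (ext z i == i.+1) && (ext z i.+1 == i)
    | (ext z i == - i%:Z) && (ext z i.+1 == - i.+1%:Z)].
Proof.
move=> i0; rewrite /comm_cond; case: posnP i0 => // i0 _.
have : ext z i != ext z i.+1 by rewrite (inj_eq (@ext_inj _ z)); lia.
by have := sx_spec (ext z i) i0; lia.
Qed.

Lemma comm_condP z i : z^-1%g = z ->
  (mulW (sg i) z == mulW z (sg i)) = comm_cond i z.
Proof.
move=> zV; have zK := invol_ext zV; have zN := extN z.
apply/eqP/idP => [E|].
  have H x : sx i (ext z x) = ext z (sx i x) by rewrite -ext_sgl -ext_sgr E.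
  case: (posnP i) => [i0|i0].
    have := H 1%N; rewrite comm_cond0 // i0.
    have -> : sx 0 1%N = - 1%N%:Z by [].
    have : ext z 1%N != 0 by rewrite ext_eq0.
    by rewrite zN; have := sx0_spec (ext z 1%N); lia.
  by rewrite /comm_cond H sx_i; case: posnP i0.
case: (posnP i) => [i0|i0]; [rewrite comm_cond0 // | rewrite comm_condS //];
  move=> zi; apply: eq_ext => x; rewrite ext_sgl ext_sgr.
  have zN1 : ext z (- 1) = - ext z 1 by rewrite zN.
  rewrite -[1%N%:Z]/(1 : int) in zi.
  have H1 : ext z x = 1 -> x = ext z 1 by move=> E; rewrite -(zK x) E.
  have H2 : ext z x = - 1 -> x = - ext z 1 by move=> E; rewrite -(zK x) E zN1.
  rewrite i0; have := sx0_spec (ext z x).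
  by have [[-> ->]|[[-> ->]|[Hx1 [Hx2 ->]]]] := sx0_spec x; rewrite ?zN1; lia.
have zNi := zN i; have zNi1 := zN i.+1.
have H1 : ext z x = i -> x = ext z i by move=> E; rewrite -(zK x) E.
have H2 : ext z x = i.+1 -> x = ext z i.+1 by move=> E; rewrite -(zK x) E.
have H3 : ext z x = - i%:Z -> x = ext z (- i%:Z) by move=> E; rewrite -(zK x) E.
have H4 : ext z x = - i.+1%:Z -> x = ext z (- i.+1%:Z) by move=> E; rewrite -(zK x) E.
have := sx_spec (ext z x) i0.
have [[Ex ->]|[[Ex ->]|[[Ex ->]|[[Ex ->]|[Ex1 [Ex2 ->]]]]]] := sx_spec x i0; rewrite ?Ex; lia.
Qed.

Lemma fix_setE z p : (p \in fix_set z) = (ext z (toZ p) == toZ p).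
Proof. by rewrite inE act_eq. Qed.

Lemma neg_setE z p : (p \in neg_set z) = (ext z (toZ p) == - toZ p).
Proof. by rewrite inE act_eq toZ_neg. Qed.

(** The length contributes 4. The other 4 comes from the points moved by [t_i]: for i = 0 the two
    fixed points ±1 become negated; for i > 0 either four fixed points are lost, or z i = -(i+1) and
    four negated points are gained. *)
Lemma rank8_comm z i : z^-1%g = z -> ext z i < ext z i.+1 -> comm_cond i z ->
  rank8 (mulW z (sg i)) = rank8 z + 8.
Proof.
move=> zV asc com; rewrite /rank8 (dlen_asc asc).
set z' := mulW z (sg i).
have := card_moved i; set S := moved i => cS.
have z'E x : ext z' x = ext z (sx i x) by rewrite ext_sgr.
have inS p : p \in S = (sx i (toZ p) != toZ p) by rewrite inE act_eq ext_sg.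
have outS p : p \notin S -> ext z' (toZ p) = ext z (toZ p).
  by rewrite inS negbK z'E => /eqP ->.
have fD : fix_set z' :\: S = fix_set z :\: S.
  apply/setP=> p; rewrite in_setD [RHS]in_setD; case: (boolP (p \in S)) => //= pS.
  by rewrite !fix_setE outS.
have nD : neg_set z' :\: S = neg_set z :\: S.
  apply/setP=> p; rewrite in_setD [RHS]in_setD; case: (boolP (p \in S)) => //= pS.
  by rewrite !neg_setE outS.
have zN := extN z.
rewrite -(cardsID S (neg_set z)) -(cardsID S (neg_set z')).
rewrite -(cardsID S (fix_set z)) -(cardsID S (fix_set z')) fD nD.
have sub (A : {set pm n}) (b : bool) :
    (forall p, p \in S -> p \in A = b) -> #|A :&: S| = (b * #|S|)%N.
  move=> H; case: b H => H.
    by rewrite mul1n (setIidPr _) //; apply/subsetP=> p pS; rewrite H.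
  rewrite mul0n; apply/eqP; rewrite cards_eq0; apply/eqP/setP=> p; rewrite !inE.
  by apply/negP=> /andP[pA pS]; move: (H p); rewrite inE pA pS => /(_ isT).
case: (posnP i) com cS => [i0|i0] com cS.
  have z1 : ext z 1%N = 1%N by move: com asc; rewrite comm_cond0 // i0 ext0; lia.
  have S1 p : p \in S -> toZ p = 1 \/ toZ p = -1.
    by rewrite inS i0; have := sx0_spec (toZ p); lia.
  have zN1 := zN 1%N.
  rewrite (sub (neg_set z) false); last first.
    by move=> p /S1 [] E; rewrite neg_setE E ?zN1 z1.
  rewrite (sub (neg_set z') true); last first.
    by move=> p /S1 [] E; rewrite neg_setE z'E E i0 /sx /= ?zN1 z1.
  rewrite (sub (fix_set z) true); last first.
    by move=> p /S1 [] E; rewrite fix_setE E ?zN1 z1.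
  rewrite (sub (fix_set z') false); last first.
    by move=> p /S1 [] E; rewrite fix_setE z'E E i0 /sx /= ?zN1 z1.
  by rewrite cS; lia.
have S4 p : p \in S -> [\/ toZ p = i, toZ p = i.+1, toZ p = - i%:Z | toZ p = - i.+1%:Z].
  rewrite inS; have [[E1 E2]|[[E1 E2]|[[E1 E2]|[[E1 E2]|[E1 [E2 E3]]]]]] := sx_spec (toZ p) i0.
  - by constructor 1.
  - by constructor 2.
  - by constructor 3.
  - by constructor 4.
  - by rewrite E3 eqxx.
have zNi := zN i; have zNi1 := zN i.+1.
have si : sx i i = i.+1 by rewrite sx_i; case: posnP i0 => // ->.
have siS : sx i i.+1 = i by rewrite sx_iS; case: posnP i0 => // ->.
have siN : sx i (- i%:Z) = - i.+1%:Z by rewrite sxN si.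
have siSN : sx i (- i.+1%:Z) = - i%:Z by rewrite sxN siS.
rewrite comm_condS // in com.
have Hf p : p \in S -> p \in fix_set z' = false.
  by move=> /S4[] E; rewrite fix_setE z'E E ?(si, siS, siN, siSN); lia.
have Hn p : p \in S -> p \in neg_set z = false.
  by move=> /S4[] E; rewrite neg_setE E; lia.
rewrite (sub _ _ Hf) (sub _ _ Hn).
have [[zi ziS]|[zi ziS]] : (ext z i = i /\ ext z i.+1 = i.+1)
    \/ (ext z i = - i.+1%:Z /\ ext z i.+1 = - i%:Z) by lia.
  rewrite (sub (neg_set z') false); last first.
    by move=> p /S4[] E; rewrite neg_setE z'E E ?(si, siS, siN, siSN); lia.
  rewrite (sub (fix_set z) true); last first.
    by move=> p /S4[] E; rewrite fix_setE E; lia.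
  by rewrite cS; lia.
rewrite (sub (neg_set z') true); last first.
  by move=> p /S4[] E; rewrite neg_setE z'E E ?(si, siS, siN, siSN); lia.
rewrite (sub (fix_set z) false); last first.
  by move=> p /S4[] E; rewrite fix_setE E; lia.
by rewrite cS; lia.
Qed.

(** Without commutation [t_i] is still a left ascent of z t_i, so conjugation adds 2 to the length,
    that is 8 here. It carries the fixed and the negated points bijectively to those of the
    conjugate, so their numbers do not change. *)
Lemma rank8_conj z i : z^-1%g = z -> ext z i < ext z i.+1 -> ~~ comm_cond i z ->
  ext (mulW z (sg i))^-1%g i < ext (mulW z (sg i))^-1%g i.+1
  /\ rank8 (mulW (sg i) (mulW z (sg i))) = rank8 z + 8.
Proof.
move=> zV asc nc.
have asc' : ext (mulW z (sg i))^-1%g i < ext (mulW z (sg i))^-1%g i.+1.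
  move: nc asc; rewrite invW_mul zV sgV !ext_sgl.
  case: (posnP i) => [i0|i0]; [rewrite comm_cond0 // i0 | rewrite comm_condS //].
    by rewrite ext0; have := sx0_spec (ext z 1%N); have := sx0_spec 0; lia.
  by have := sx_spec (ext z i) i0; have := sx_spec (ext z i.+1) i0; lia.
split=> //.
have -> : rank8 (mulW (sg i) (mulW z (sg i)))
    = (2 * dlen (mulW (sg i) (mulW z (sg i))) + #|neg_set z|)%N%:Z
       - #|fix_set z|%:Z + (2 * n)%N%:Z.
  rewrite /rank8; congr ((_ + _)%N%:Z - Posz _ + _).
    rewrite -(card_preimset (neg_set z) (@perm_inj _ (sgval (sg i)))).
    congr #|pred_of_set _|; apply/setP=> p; rewrite [RHS]inE !neg_setE.
    rewrite ext_sgl ext_sgr -[fun_of_perm _ p]/(act (sg i) p) actZ ext_sg.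
    by rewrite -(inj_eq (can_inj (sxK i))) sxK sxN.
  rewrite -(card_preimset (fix_set z) (@perm_inj _ (sgval (sg i)))).
  congr #|pred_of_set _|; apply/setP=> p; rewrite [RHS]inE !fix_setE.
  rewrite ext_sgl ext_sgr -[fun_of_perm _ p]/(act (sg i) p) actZ ext_sg.
  by rewrite -(inj_eq (can_inj (sxK i))) sxK.
have := dlenE (mulW (sg i) (mulW z (sg i))); rewrite (len_sgl_asc asc').
by have := dlenE (mulW z (sg i)); rewrite (dlen_asc asc) /rank8; lia.
Qed.

End Rank.

(** * Atoms *)

Section Demazure.

Variables (n : nat) (op : W n -> W n -> W n).
Hypothesis op_dem : is_demazure op.
Implicit Types (i j : 'I_n) (u v w z : W n).

Lemma opA u v w : op u (op v w) = op (op u v) w.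
Proof. exact: (demazure_assoc op_dem). Qed.

Lemma op_sgsg i : op (sg i) (sg i) = sg i.
Proof. exact/(demazure_simple op_dem)/sg_simple. Qed.

Lemma opu1 u : op u 1%g = u.
Proof. by rewrite (demazure_mul op_dem) ?mulW1 // len1 addn0. Qed.

Lemma op_sgr_asc u i : ext u i < ext u i.+1 -> op u (sg i) = mulW u (sg i).
Proof. by move=> H; apply: (demazure_mul op_dem); rewrite len_sgr_asc // len_sg addn1. Qed.

Lemma op_sgl_asc u i : ext u^-1%g i < ext u^-1%g i.+1 -> op (sg i) u = mulW (sg i) u.
Proof. by move=> H; apply: (demazure_mul op_dem); rewrite len_sgl_asc // len_sg add1n. Qed.

(** Write u = u' s with s an ascent of u'; then u o s = u' o s o s = u' o s = u. *)
Lemma op_sgr_desc u i : ext u i.+1 < ext u i -> op u (sg i) = u.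
Proof.
rewrite -sgr_asc => /op_sgr_asc; rewrite mulW_sgK => E.
by rewrite -{1}E -opA op_sgsg E.
Qed.

Lemma sgl_asc w i : (ext (mulW (sg i) w)^-1%g i < ext (mulW (sg i) w)^-1%g i.+1)
  = (ext w^-1%g i.+1 < ext w^-1%g i).
Proof. by rewrite invW_mul sgV sgr_asc. Qed.

Lemma op_sgl_desc u i : ext u^-1%g i.+1 < ext u^-1%g i -> op (sg i) u = u.
Proof.
rewrite -sgl_asc => /op_sgl_asc; rewrite sg_mulWK => E.
by rewrite -{1}E opA op_sgsg E.
Qed.

Definition dconj i z := op (sg i) (op z (sg i)).

Lemma dconj_desc z i : z^-1%g = z -> ext z i.+1 < ext z i -> dconj i z = z.
Proof. by move=> zV H; rewrite /dconj op_sgr_desc // op_sgl_desc // zV. Qed.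

Lemma dconj_asc z i : z^-1%g = z -> ext z i < ext z i.+1 ->
  dconj i z = if comm_cond i z then mulW z (sg i) else mulW (sg i) (mulW z (sg i)).
Proof.
move=> zV asc; rewrite /dconj op_sgr_asc //.
case: ifP => [com|/negbT ncom]; last by rewrite op_sgl_asc //; case: (rank8_conj zV asc ncom).
(* Here s o (z s) = s o (s z) = s o s o z = s o z = s z. *)
move: (com); rewrite -comm_condP // => /eqP E.
by rewrite -E -op_sgl_asc ?zV // opA op_sgsg.
Qed.

Lemma dconjV z i : z^-1%g = z -> (dconj i z)^-1%g = dconj i z.
Proof.
move=> zV; case: (boolP (ext z i < ext z i.+1)) => [asc|]; last first.
  by rewrite -ext_ltgt => H; rewrite dconj_desc.
rewrite dconj_asc //; case: ifP => com; last by rewrite !invW_mul sgV zV mulWA.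
by rewrite invW_mul sgV zV; apply/eqP; rewrite comm_condP.
Qed.

Lemma rank8_dconj z i : z^-1%g = z ->
  rank8 (dconj i z) = if ext z i < ext z i.+1 then rank8 z + 8 else rank8 z.
Proof.
move=> zV; case: ifP => [asc|/negbT]; last first.
  by rewrite -ext_ltgt => H; rewrite dconj_desc.
rewrite dconj_asc //; case: ifP => [/(rank8_comm zV asc)//|/negbT nc].
by case: (rank8_conj zV asc nc).
Qed.

Lemma rank8_1 : rank8 (1%g : W n) = 0.
Proof.
rewrite /rank8 dlen1.
have -> : neg_set (1%g : W n) = set0.
  by apply/setP=> p; rewrite neg_setE ext1 in_set0; have := toZ_range p; lia.
have -> : fix_set (1%g : W n) = setT.
  by apply/setP=> p; rewrite fix_setE ext1 in_setT eqxx.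
by rewrite cards0 cardsT card_prod card_bool card_ord; lia.
Qed.

(** For u = w^-1 this is w^-1 o w, the product in the definition of atoms. *)
Definition dsquare u := op u u^-1%g.

Lemma dsquare_sg i u : ext u^-1%g i < ext u^-1%g i.+1 ->
  dsquare (mulW (sg i) u) = dconj i (dsquare u).
Proof.
move=> H; rewrite /dsquare invW_mul sgV -(op_sgl_asc H) -(op_sgr_asc H).
by rewrite /dconj !opA.
Qed.

Lemma dsquare1 : dsquare 1%g = 1%g.
Proof. by rewrite /dsquare invg1 opu1. Qed.

Lemma left_desc_ind (P : W n -> Prop) : P 1%g ->
  (forall i u, ext u^-1%g i < ext u^-1%g i.+1 -> P u -> P (mulW (sg i) u)) ->
  forall u, P u.
Proof.
move=> P1 PS u; have [m] := ubnP (cox_length u); elim: m u => // m IH u lem.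
case: (eqVneq u^-1%g 1%g) => [E|/descent_exists[i Hi]].
  by rewrite -[u]invgK E invg1.
have := len_sgl_desc Hi; rewrite -sgl_asc in Hi => E.
by rewrite -(sg_mulWK u i); apply: PS => //; apply: IH; lia.
Qed.

Lemma dsquareV u : (dsquare u)^-1%g = dsquare u.
Proof.
elim/left_desc_ind: u => [|i u H IH]; first by rewrite dsquare1 invg1.
by rewrite dsquare_sg // dconjV.
Qed.

(** Adding one letter on the left lengthens [u] by one and raises [rank8] of the square by 8 or by
    0. *)
Lemma rank8_dsquare u : rank8 (dsquare u) <= (8 * cox_length u)%N.
Proof.
elim/left_desc_ind: u => [|i u H IH]; first by rewrite dsquare1 rank8_1.
rewrite dsquare_sg // rank8_dconj ?dsquareV // len_sgl_asc //.
by case: ifP => _; lia.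
Qed.

(** Equality in [rank8_dsquare] replaces minimality of the length; unlike minimality it passes
    directly through the induction on [u], and [inv_atomsP] identifies the two notions. *)
Definition is_inv_atom u z := dsquare u = z /\ rank8 z = (8 * cox_length u)%N.

Lemma is_inv_atom1 z : is_inv_atom 1%g z <-> z = 1%g.
Proof.
by split=> [[<- _]|->]; rewrite /is_inv_atom dsquare1 // rank8_1 len1.
Qed.

Lemma is_inv_atom_sg i u z : ext u^-1%g i < ext u^-1%g i.+1 ->
  is_inv_atom (mulW (sg i) u) z <->
  exists z1, [/\ z1^-1%g = z1, is_inv_atom u z1, ext z1 i < ext z1 i.+1 & z = dconj i z1].
Proof.
move=> H; split=> [[<-]|[z1 [zV [E rE] asc ->]]].
  rewrite dsquare_sg // rank8_dconj ?dsquareV // len_sgl_asc //.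
  have := rank8_dsquare u; case: ifP => asc le E; last by lia.
  by exists (dsquare u); split; rewrite ?dsquareV //; split=> //; lia.
split; first by rewrite dsquare_sg // E.
by rewrite rank8_dconj // asc len_sgl_asc //; lia.
Qed.

(* If [s u < u] then [s] is a descent of [dsquare u], since the Demazure square
   then absorbs [s]. *)
Lemma dsquare_desc i u : ext u^-1%g i.+1 < ext u^-1%g i ->
  ext (dsquare u) i.+1 < ext (dsquare u) i.
Proof.
move=> H; rewrite ext_ltgt; apply/negP => asc.
have E : op (sg i) (dsquare u) = dsquare u by rewrite /dsquare opA op_sgl_desc.
have : op (sg i) (dsquare u) = mulW (sg i) (dsquare u) by rewrite op_sgl_asc ?dsquareV.
rewrite E => F; have := len_sgl_asc (w := dsquare u) (i := i).
by rewrite dsquareV -F => /(_ asc); lia.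
Qed.

Lemma comm_cond_sg z i : z^-1%g = z -> (mulW z (sg i))^-1%g = mulW z (sg i) ->
  comm_cond i z -> comm_cond i (mulW z (sg i)).
Proof.
move=> zV zsV; rewrite -!comm_condP // => /eqP E.
by rewrite mulWA E.
Qed.

(** A step down in the involution weak order. Whether [t_i] commutes is the same for [z] and for the
    element below it, so the case distinction can be read off from [z]. *)
Lemma dconj_desc_inv z i : z^-1%g = z -> ext z i.+1 < ext z i ->
  exists z1, [/\ z1^-1%g = z1, ext z1 i < ext z1 i.+1, dconj i z1 = z
    & z1 = if comm_cond i z then mulW z (sg i) else mulW (sg i) (mulW z (sg i))].
Proof.
move=> zV desc.
exists (if comm_cond i z then mulW z (sg i) else mulW (sg i) (mulW z (sg i))).
case: (boolP (comm_cond i z)) => [com|ncom].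
  have zsV : (mulW z (sg i))^-1%g = mulW z (sg i).
    by rewrite invW_mul sgV zV; apply/eqP; rewrite comm_condP.
  split; rewrite ?sgr_asc //.
  by rewrite dconj_asc ?sgr_asc // (comm_cond_sg zV zsV com) mulW_sgK.
set z1 := mulW _ _.
have z1V : z1^-1%g = z1 by rewrite /z1 !invW_mul sgV zV mulWA.
have asc1 : ext z1 i < ext z1 i.+1.
  move: ncom; rewrite !ext_sgl !ext_sgr sx_i sx_iS.
  case: (posnP i) => [i0|i0]; [rewrite comm_cond0 // | rewrite comm_condS //].
    have -> : ext z (-1) = - ext z 1%N by exact: extN.
    rewrite i0 !ext0 in desc *.
    by have := sx0_spec 0; have := sx0_spec (- ext z 1%N); lia.
  by have := sx_spec (ext z i) i0; have := sx_spec (ext z i.+1) i0; lia.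
split=> //; rewrite dconj_asc // ifF; first by rewrite /z1 -mulWA mulW_sgK sg_mulWK.
apply/negbTE; rewrite -comm_condP // sg_mulWK -mulWA mulW_sgK.
by rewrite eq_sym comm_condP.
Qed.

Lemma len_dconj z i : z^-1%g = z -> ext z i < ext z i.+1 ->
  (cox_length z < cox_length (dconj i z))%N.
Proof.
move=> zV asc; rewrite dconj_asc //; case: ifP => [_|/negbT nc].
  by rewrite len_sgr_asc.
by have [asc' _] := rank8_conj zV asc nc; rewrite len_sgl_asc // len_sgr_asc //; lia.
Qed.

(** A descent of [z] gives a smaller involution z1; an inverse atom of z1, multiplied on the left by
    the generator, is one of [z]. *)
Lemma dsquare_surj z : z^-1%g = z -> exists u, is_inv_atom u z.
Proof.
have [m] := ubnP (cox_length z); elim: m z => // m IH z lem zV.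
case: (eqVneq z 1%g) => [->|/descent_exists[i Hi]].
  by exists 1%g; apply/is_inv_atom1.
have [z1 [z1V asc1 Ez _]] := dconj_desc_inv zV Hi.
have lt1 : (cox_length z1 < m)%N by have := len_dconj z1V asc1; rewrite Ez; lia.
have [u [Eu Ru]] := IH _ lt1 z1V.
exists (mulW (sg i) u); apply/is_inv_atom_sg; last by exists z1.
(* Were the generator already a left descent of [u], it would be a descent of the square z1. *)
apply: contraLR asc1; rewrite -!ext_ltgt => /dsquare_desc.
by rewrite Eu.
Qed.

(** Since the rank bound is attained by some element with square [z], the minimal length is exactly
    an eighth of [rank8 z]. *)
Lemma inv_atomsP u z : z^-1%g = z -> u \in inv_atoms op z <-> is_inv_atom u z.
Proof.
move=> zV; split=> [/imsetP[w]|[Eu Ru]].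
  rewrite inE => /andP[/eqP Ew /forallP min] ->.
  have Ewd : dsquare w^-1%g = z by rewrite /dsquare invgK.
  split=> //; have [v [Ev Rv]] := dsquare_surj zV.
  have := min v^-1%g; rewrite invgK -[op v _]/(dsquare v) Ev eqxx /= lenV.
  by have := rank8_dsquare w^-1%g; rewrite Ewd lenV; lia.
apply/imsetP; exists u^-1%g; last by rewrite invgK.
rewrite inE invgK -[op u _]/(dsquare u) Eu eqxx /=.
apply/forallP=> v; apply/implyP=> /eqP Ev; rewrite lenV.
have := rank8_dsquare v^-1%g; rewrite /dsquare invgK Ev lenV Ru; lia.
Qed.

(** * Braid relations and consecutive patterns in words of inverse atoms *)

Section Braid.

Variables (i j : 'I_n).
Hypothesis ij : j = i.+1 :> nat.
Hypothesis i0 : (0 < i)%N.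

Lemma sx_i012 : [/\ sx i i = i.+1, sx i i.+1 = i & sx i i.+2 = i.+2].
Proof.
clear ij.
have := sx_spec i i0; have := sx_spec i.+1 i0; have := sx_spec i.+2 i0.
by split; lia.
Qed.

Lemma sx_j012 : [/\ sx i.+1 i = i, sx i.+1 i.+1 = i.+2 & sx i.+1 i.+2 = i.+1].
Proof.
clear ij.
have j0 : (0 < i.+1)%N by [].
have := sx_spec i j0; have := sx_spec i.+1 j0; have := sx_spec i.+2 j0.
by split; lia.
Qed.

Lemma sx_braid x : sx i (sx j (sx i x)) = sx j (sx i (sx j x)).
Proof.
rewrite ij; have j0 : (0 < i.+1)%N by [].
have [a0 a1 a2] := sx_i012; have [b0 b1 b2] := sx_j012.
have i00 : sx i 0 = 0 by have := sx_spec 0 i0; lia.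
have j00 : sx i.+1 0 = 0 by have := sx_spec 0 j0; lia.
have aE := (i00, j00, a0, a1, a2, b0, b1, b2).
(* By oddness only the absolute value of [x] matters; the sign 0 produces the case x = 0, settled by
   [i00] and [j00]. *)
have [->|[->|[->|[Ei Ej]]]] : x = sgz x * i \/ x = sgz x * i.+1 \/ x = sgz x * i.+2
    \/ sx i x = x /\ sx i.+1 x = x.
  by have := sx_spec x i0; have := sx_spec x j0; lia.
all: rewrite ?Ei ?Ej ?Ei //.
all: case: (sgzP x) => _; rewrite ?mul0r ?mul1r ?mulN1r ?sxN ?aE //.
Qed.

Lemma sg_braid : mulW (mulW (sg i) (sg j)) (sg i) = mulW (mulW (sg j) (sg i)) (sg j).
Proof. by apply: eq_ext => x; rewrite !ext_sgr !ext_sg sx_braid. Qed.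

Lemma op_sgsg_sg (a b : 'I_n) : (0 < a)%N -> (0 < b)%N -> (b = a.+1 :> nat \/ a = b.+1 :> nat) ->
  op (op (sg a) (sg b)) (sg a) = mulW (mulW (sg a) (sg b)) (sg a).
Proof.
move=> a0 b0 ab.
have E : op (sg a) (sg b) = mulW (sg a) (sg b).
  apply: op_sgr_asc; rewrite !ext_sg.
  by have := sx_spec b a0; have := sx_spec b.+1 a0; lia.
rewrite E op_sgr_asc // !ext_sgr !ext_sg.
have := sx_spec a b0; have := sx_spec a.+1 b0.
have := sx_spec (sx b a) a0; have := sx_spec (sx b a.+1) a0; lia.
Qed.

Lemma op_braid : op (op (sg i) (sg j)) (sg i) = op (op (sg j) (sg i)) (sg j).
Proof. by rewrite !op_sgsg_sg ?ij ?sg_braid; auto. Qed.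

Lemma dsquare_sgr v (k : 'I_n) : ext v k < ext v k.+1 ->
  dsquare (mulW v (sg k)) = op (op v (sg k)) v^-1%g.
Proof.
move=> asc; rewrite /dsquare invW_mul sgV -op_sgr_asc // -op_sgl_asc ?invgK //.
by rewrite opA -(opA v) op_sgsg.
Qed.

Lemma dsquare_sgr2 v (a b : 'I_n) : ext v a < ext v a.+1 ->
  ext (mulW v (sg a)) b < ext (mulW v (sg a)) b.+1 ->
  dsquare (mulW (mulW v (sg a)) (sg b)) = op (op v (op (op (sg a) (sg b)) (sg a))) v^-1%g.
Proof.
move=> va vab; rewrite dsquare_sgr // invW_mul sgV -op_sgr_asc // -op_sgl_asc ?invgK //.
by rewrite !opA.
Qed.

Variable v : W n.
Hypothesis vi : ext v i < ext v j.
Hypothesis vj : ext v j < ext v j.+1.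

Let wi := mulW v (sg i).
Let wj := mulW v (sg j).
Let wij := mulW wi (sg j).
Let wji := mulW wj (sg i).

Lemma braid_asc : [/\ ext v i < ext v i.+1, ext wi j < ext wi j.+1,
  ext wj i < ext wj i.+1 & ext wij i < ext wij i.+1].
Proof.
have [a0 a1 a2] := sx_i012; have [b0 b1 b2] := sx_j012.
have := vi; have := vj.
by rewrite /wij /wj /wi !ext_sgr !ij !(a0, a1, a2, b0, b1, b2); split; lia.
Qed.

Lemma braid_len : cox_length wij = (cox_length v).+2
  /\ cox_length wji = (cox_length v).+2.
Proof.
have [h1 h2 h3 h4] := braid_asc.
by rewrite !len_sgr_asc.
Qed.

(** With s = t_i and t = t_{i+1}, the squares of v s t and v t s are v o (s o t o s) o v^-1 and v o
    (t o s o t) o v^-1. *)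
Lemma dsquare_braid : dsquare wij = dsquare wji.
Proof.
have [h1 h2 h3 h4] := braid_asc.
by rewrite !dsquare_sgr2 // op_braid.
Qed.

(** Idempotence and the braid relation reduce the middle factor s o t o s o s o t o s to s o t o s,
    which is also the middle factor for v s t. The third letter is thus wasted. *)
Lemma dsquare_braid3 : dsquare (mulW wij (sg i)) = dsquare wij.
Proof.
have [h1 h2 h3 h4] := braid_asc.
have E1 : wij = op (op v (sg i)) (sg j) by rewrite (op_sgr_asc h1) (op_sgr_asc h2).
have E2 : wij^-1%g = op (sg j) (op (sg i) v^-1%g).
  rewrite [op (sg i) _]op_sgl_asc ?invgK // op_sgl_asc.
    by rewrite /wij /wi !invW_mul !sgV.
  by rewrite invW_mul invgK sgV.
rewrite (dsquare_sgr h4) /dsquare E2 E1.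
transitivity (op (op v (op (op (op (op (sg i) (sg j)) (sg i)) (sg j)) (sg i))) v^-1%g).
  by rewrite !opA.
rewrite op_braid -[op (op (op (sg j) (sg i)) (sg j)) (sg j)]opA op_sgsg -op_braid.
rewrite -[op (op (op (sg i) (sg j)) (sg i)) (sg i)]opA op_sgsg.
rewrite -[in RHS]opA (opA (sg j)) op_sgsg.
by rewrite !opA.
Qed.

End Braid.

Section Patterns.

Variables (z : W n) (w : W n) (i j : 'I_n).
Hypothesis ij : j = i.+1 :> nat.
Hypothesis i0 : (0 < i)%N.

(** Sorting the three letters shows w = v s t s, whose square is already that of the shorter v s t;
    this contradicts the rank bound. *)
Lemma atom_no_cba : is_inv_atom w z -> ~~ (ext w i.+2 < ext w i.+1 < ext w i).
Proof.
move=> [Ew Rw]; apply/negP => /andP[lt1 lt2].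
have [a0 a1 a2] := sx_i012 i0; have [b0 b1 b2] := sx_j012 i0.
pose v := mulW (mulW (mulW w (sg i)) (sg j)) (sg i).
have vi : ext v i < ext v j by rewrite !ext_sgr !ij !(a0, a1, a2, b0, b1, b2).
have vj : ext v j < ext v j.+1 by rewrite !ext_sgr !ij !(a0, a1, a2, b0, b1, b2).
have E : w = mulW (mulW (mulW v (sg i)) (sg j)) (sg i) by rewrite !mulW_sgK.
have := dsquare_braid3 ij i0 vi vj; rewrite -E Ew => E'.
have := rank8_dsquare (mulW (mulW v (sg i)) (sg j)); rewrite -E'.
have [_ _ _ h4] := braid_asc ij i0 vi vj.
by have := len_sgr_asc h4; rewrite -E Rw; lia.
Qed.

Let same_outside (w' : W n) :=
  forall k : nat, k != i -> k != i.+1 -> k != i.+2 -> ext w' k = ext w k.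

(** If [v] has a b c in these positions, then v s t has b c a and v t s has c a b; both have the
    same length and the same square. *)
Lemma atom_bca_cab : is_inv_atom w z -> ext w i.+2 < ext w i < ext w i.+1 ->
  exists w', [/\ is_inv_atom w' z, same_outside w',
    ext w' i = ext w i.+1, ext w' i.+1 = ext w i.+2 & ext w' i.+2 = ext w i].
Proof.
move=> [Ew Rw] /andP[lt1 lt2].
have [a0 a1 a2] := sx_i012 i0; have [b0 b1 b2] := sx_j012 i0.
pose v := mulW (mulW w (sg j)) (sg i).
have vi : ext v i < ext v j by rewrite !ext_sgr !ij !(a0, a1, a2, b0, b1, b2).
have vj : ext v j < ext v j.+1 by rewrite !ext_sgr !ij !(a0, a1, a2, b0, b1, b2).
have E : w = mulW (mulW v (sg i)) (sg j) by rewrite !mulW_sgK.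
exists (mulW (mulW v (sg j)) (sg i)); split.
- have [l1 l2] := braid_len ij i0 vi vj; split.
    by rewrite -(dsquare_braid ij i0 vi vj) -E.
  by rewrite l2 -l1 -E.
- move=> k ki ki1 ki2; rewrite /v !ext_sgr.
  have skj : sx j k = k by rewrite ij; have := sx_spec k (ltn0Sn i); lia.
  have ski : sx i k = k by have := sx_spec k i0; lia.
  by rewrite !(skj, ski).
- by rewrite !ext_sgr !ij !(a0, a1, a2, b0, b1, b2).
- by rewrite !ext_sgr !ij !(a0, a1, a2, b0, b1, b2).
- by rewrite !ext_sgr !ij !(a0, a1, a2, b0, b1, b2).
Qed.

Lemma atom_cab_bca : is_inv_atom w z -> ext w i.+1 < ext w i.+2 < ext w i ->
  exists w', [/\ is_inv_atom w' z, same_outside w',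
    ext w' i = ext w i.+2, ext w' i.+1 = ext w i & ext w' i.+2 = ext w i.+1].
Proof.
move=> [Ew Rw] /andP[lt1 lt2].
have [a0 a1 a2] := sx_i012 i0; have [b0 b1 b2] := sx_j012 i0.
pose v := mulW (mulW w (sg i)) (sg j).
have vi : ext v i < ext v j by rewrite !ext_sgr !ij !(a0, a1, a2, b0, b1, b2).
have vj : ext v j < ext v j.+1 by rewrite !ext_sgr !ij !(a0, a1, a2, b0, b1, b2).
have E : w = mulW (mulW v (sg j)) (sg i) by rewrite !mulW_sgK.
exists (mulW (mulW v (sg i)) (sg j)); split.
- have [l1 l2] := braid_len ij i0 vi vj; split.
    by rewrite (dsquare_braid ij i0 vi vj) -E.
  by rewrite l1 -l2 -E.
- move=> k ki ki1 ki2; rewrite /v !ext_sgr.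
  have skj : sx j k = k by rewrite ij; have := sx_spec k (ltn0Sn i); lia.
  have ski : sx i k = k by have := sx_spec k i0; lia.
  by rewrite !(skj, ski).
- by rewrite !ext_sgr !ij !(a0, a1, a2, b0, b1, b2).
- by rewrite !ext_sgr !ij !(a0, a1, a2, b0, b1, b2).
- by rewrite !ext_sgr !ij !(a0, a1, a2, b0, b1, b2).
Qed.

End Patterns.

End Demazure.

(** * Block decompositions of words *)

(* A relation [C] stands for a set of pairs [(a, b)], [a <= b], that is a
   candidate for [CycB z M].  The pairs with [- b < a] are those of [Pair z] and
   [Fix z]; a pair with [b < - a] encodes the matched pairs {b, -a}, {-b, a} if
   [0 < b] and {a, -a} if [a = b].  The second clause of [valid] says that these
   do not cross. *)
Definition valid (C : rel int) : Prop :=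
  (forall a b, C a b -> b < 0 -> a = b)
  /\ (forall a b a' b', C a b -> 0 < b < - a -> C a' b' ->
        ~ (a' = b' /\ b < - a' < - a) /\ ~ (0 < b' /\ b < b' < - a /\ - a < - a')).

Definition matches (C : rel int) (z : int -> int) : Prop :=
  forall a b, C a b ->
    (- b < a -> z a = b) /\ (b < - a -> z a = - a /\ z b = - b).

(* With [p = ext u^-1], where [p x] is the position of the letter [x] in the word
   of [u] and is negative if that word contains [-x], this says that the word is a
   concatenation of blocks [b a], or [a] if [a = b], one for each pair [(a, b)]
   of [C], in which nested blocks come in any order and all others in the
   natural one.  Both 0_B and 1_B have this form. *)
Record form (n : nat) (C : rel int) (p : int -> int) : Prop := Form {
  form_le : forall a b, C a b -> a <= b;
  form_pos : forall a b, C a b -> 0 < p a <= n /\ 0 < p b <= n;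
  form_adj : forall a b, C a b -> a = b \/ p a = p b + 1;
  form_cover : forall x, 0 < p x <= n -> exists a b, C a b /\ (x = a \/ x = b);
  form_uniq : forall a b a' b', C a b -> C a' b' ->
    (a = a' \/ a = b' \/ b = a' \/ b = b') -> a = a' /\ b = b';
  form_sep : forall a b a' b', C a b -> C a' b' -> p a < p a' -> a < a' \/ b < b' }.

Lemma form_ext n C p p' : p =1 p' -> form n C p -> form n C p'.
Proof.
move=> E [f1 f2 f3 f4 f5 f6]; split=> //.
- by move=> a b; rewrite -!E; exact: f2.
- by move=> a b; rewrite -!E; exact: f3.
- by move=> x; rewrite -!E; exact: f4.
- by move=> a b a' b'; rewrite -!E; exact: f6.
Qed.

(** As [t_i] is an involution, this preimage of [C] is also its image. *)
Definition relabel (i : nat) (C : rel int) : rel int := fun a b => C (sx i a) (sx i b).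

Lemma relabelK i C : relabel i (relabel i C) =2 C.
Proof. by move=> a b; rewrite /relabel !sxK. Qed.

Lemma sx_mono (i : nat) (x y : int) : (0 < i)%N -> x < y ->
  [\/ sx i x < sx i y, x = i /\ y = i.+1 | x = - i.+1%:Z /\ y = - i%:Z].
Proof.
move=> i0 xy.
have : sx i x < sx i y \/ (x = i /\ y = i.+1) \/ (x = - i.+1%:Z /\ y = - i%:Z).
  by have := sx_spec x i0; have := sx_spec y i0; lia.
by case=> [|[|]]; [constructor 1 | constructor 2 | constructor 3].
Qed.

Section Relabel.

Variables (i : nat) (C : rel int) (z : int -> int).
Hypothesis i0 : (0 < i)%N.
Hypothesis zN : {morph z : x / - x}.
Hypothesis C_le : forall a b, C a b -> a <= b.
Hypothesis C_nspec : forall a b, C a b ->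
  ~ (a = - i%:Z /\ b = i.+1) /\ ~ (a = - i.+1%:Z /\ b = i).
Hypothesis z_nboth : ~ (z i = - i%:Z /\ z i.+1 = - i.+1%:Z).

Lemma sx_gt0 x : (0 < sx i x) = (0 < x).
Proof. by have := sx_spec x i0; lia. Qed.

Lemma relabel_type a b : C a b ->
  (- sx i b < sx i a) = (- b < a) /\ (sx i b < - sx i a) = (b < - a).
Proof.
move=> Cab; have := C_le Cab; have := C_nspec Cab => ns le.
have H1 : - b < a -> - sx i b < sx i a.
  by move/(sx_mono i0); rewrite sxN => -[] //; lia.
have H2 : b < - a -> sx i b < - sx i a.
  by move/(sx_mono i0); rewrite sxN => -[] //; lia.
have H3 : - b = a -> - sx i b = sx i a by move=> <-; rewrite sxN.
lia.
Qed.

Lemma neg_mono x y : z x = - x -> z y = - y -> sx i x < sx i y -> x < y.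
Proof.
move=> zx zy /(sx_mono i0); rewrite !sxK => -[] //.
  case=> E1 E2; case: z_nboth.
  have Ex : x = i.+1 by have := sx_spec x i0; lia.
  have Ey : y = i by have := sx_spec y i0; lia.
  by rewrite Ex in zx; rewrite Ey in zy.
case=> E1 E2; case: z_nboth.
have Ex : x = - i%:Z by have := sx_spec x i0; lia.
have Ey : y = - i.+1%:Z by have := sx_spec y i0; lia.
by move: zx zy; rewrite Ex Ey !zN; lia.
Qed.

(** The type of a pair is the sign of a + b, which [t_i] could alter only for the two pairs excluded
    by [C_nspec]. The noncrossing condition compares letters negated by [z], and their order is kept
    because i and i+1 are not both negated. *)
Lemma relabel_valid_matches : valid C -> matches C z ->
  valid (relabel i C) /\ matches (relabel i C) (fun x => sx i (z (sx i x))).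
Proof.
move=> [V1 V2] M.
have M' a b : C a b -> b < - a -> z a = - a /\ z b = - b by move=> /M[].
have zV x : z x = - x -> z (- x) = - - x by rewrite zN => ->.
split; last first.
  move=> a b Cab; have [T1 T2] := relabel_type Cab; have [N1 N2] := M _ _ Cab.
  rewrite !sxK in T1 T2; split.
    by rewrite T1 => /N1 ->; rewrite sxK.
  by rewrite T2 => /N2 [-> ->]; rewrite !sxN !sxK.
split=> [a b Cab b_lt0|a b a' b' Cab ab Cab'].
  apply: (can_inj (sxK i)); apply: V1 Cab _.
  by have := sx_gt0 (- b); rewrite sxN; lia.
have [_ T2] := relabel_type Cab; rewrite !sxK in T2.
have [_ T2'] := relabel_type Cab'; rewrite !sxK in T2'.
have /(M' _ _ Cab)[zA zB] : sx i b < - sx i a by rewrite -T2; case/andP: ab.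
have AB : 0 < sx i b < - sx i a by rewrite -T2 sx_gt0.
have [W1 W2] := V2 _ _ _ _ Cab AB Cab'.
split; last first.
  move=> [b'0 [/andP[L1 L2] L3]].
  have /(M' _ _ Cab')[zA' zB'] : sx i b' < - sx i a' by rewrite -T2'; lia.
  have LL1 : sx i b < sx i b' by apply: neg_mono; rewrite ?sxK.
  have LL2 : sx i b' < - sx i a.
    by apply: neg_mono; rewrite ?zV // ?sxN !sxK.
  have LL3 : - sx i a < - sx i a'.
    by apply: neg_mono; rewrite ?zV // ?sxN !sxK.
  by apply: W2; rewrite LL1 LL2 LL3 sx_gt0.
move=> [E /andP[L1 L2]].
have /(M' _ _ Cab')[zA' zB'] : sx i b' < - sx i a' by rewrite -T2'; lia.
have LL1 : sx i b < - sx i a' by apply: neg_mono; rewrite ?zV // ?sxN !sxK.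
have LL2 : - sx i a' < - sx i a by apply: neg_mono; rewrite ?zV // ?sxN !sxK.
by apply: W1; rewrite LL1 LL2 E.
Qed.

End Relabel.

(** * Letters, blocks and the values they impose on z *)

Section Step.

Variables (n : nat) (C : rel int) (p : int -> int).
Hypothesis pN : {morph p : x / - x}.
Hypothesis C_form : form n C p.

Lemma odd_at0 : p 0 = 0.
Proof. have E : p 0 = - p 0 by rewrite -pN oppr0.
lia. Qed.

Lemma block_neq0 a b : C a b -> a <> 0 /\ b <> 0.
Proof.
by move=> Cab; have [ap bp] := form_pos C_form Cab;
   split=> E; move: ap bp; rewrite E odd_at0.
Qed.

Lemma block_abs a b : C a b -> a = b \/ `|a| <> `|b|.
Proof.
move=> Cab; have [ap bp] := form_pos C_form Cab.
case: (a =P b) => [|ab]; [by left | right => abs].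
have E : a = - b by lia.
by move: ap bp; rewrite E pN; lia.
Qed.

Hypothesis p_range : forall x, (0 < `|p x| <= n) = (0 < `|x| <= n).

Lemma letter_block (k : nat) : (0 < k <= n)%N -> exists a b, C a b /\
  (a = k \/ b = k \/ a = - k%:Z \/ b = - k%:Z).
Proof.
move=> kn; have := p_range k; case: (ltP 0 (p k)) => pk pr.
  have [|a [b [Cab E]]] := form_cover C_form (_ : 0 < p k <= n); first by lia.
  by exists a, b; split=> //; lia.
have pNk := pN k.
have [|a [b [Cab E]]] := form_cover C_form (_ : 0 < p (- k%:Z) <= n); first by lia.
by exists a, b; split=> //; lia.
Qed.

Section Types.

Variable z : int -> int.
Hypothesis zN : {morph z : x / - x}.
Hypothesis zK : involutive z.
Hypothesis C_valid : valid C.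
Hypothesis C_z : matches C z.

(** One of k and -k occurs in the word, and its role in its block determines z k. In the first three
    cases the letter is k, in the last three it is -k. *)
Lemma letter_type (k : nat) : (0 < k <= n)%N -> exists a b, C a b /\
  ((a = k /\ k%:Z <= b /\ z k = b)
   \/ (b = k /\ `|a| < k /\ z k = a)
   \/ (b = k /\ a < - k%:Z /\ z k = - k%:Z)
   \/ (a = - k%:Z /\ b = - k%:Z /\ z k = - k%:Z)
   \/ (a = - k%:Z /\ k%:Z < b /\ z k = - b)
   \/ (a = - k%:Z /\ 0 < b < k /\ z k = - k%:Z)).
Proof.
move=> kn; have [a [b [Cab E]]] := letter_block kn.
exists a, b; split=> //.
have le := form_le C_form Cab; have := block_abs Cab.
have := C_valid.1 _ _ Cab; have [M1 M2] := C_z Cab.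
have zNk := zN k; have [_ bn0] := block_neq0 Cab.
case: E => [|[|[|]]] E; subst.
- by left; split=> //; split=> //; apply: M1; lia.
- move=> _ [ab|ab]; first by left; split=> //; split; [lia | rewrite -[in LHS]ab; apply: M1; lia].
  right; case: (ltP (- k%:Z) a) => ak.
    by left; split=> //; split; [lia | rewrite -(M1 ak) zK].
  by right; left; split=> //; split; [lia | apply: (M2 _).2; lia].
- case: (ltP b 0) => [b0 /(_ isT) E _|b0 _ ab].
    by do 3 right; left; have := M2; lia.
  do 4 right; case: (ltP k%:Z b) => kb.
    by left; have := M1; lia.
  by right; have := M2; lia.
- move=> V _; have {}V : a = - k%:Z by apply: V; lia.
  by do 3 right; left; have := M2; rewrite V; lia.
Qed.

End Types.

Section PositiveStep.

Variable i : nat.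
Hypothesis i0 : (0 < i)%N.
Hypothesis i_lt_n : (i < n)%N.
Hypothesis desc : p i.+1 < p i.

(** If -i and i+1 were both letters, then p i < 0 < p (i+1), against the descent. *)
Lemma no_asc_block a b : C a b -> ~ (a = - i%:Z /\ b = i.+1).
Proof.
move=> Cab [E1 E2]; have := form_pos C_form Cab.
by rewrite E1 E2 pN; lia.
Qed.

Section Unsplit.

Hypothesis no_pos : ~~ C i i.+1.
Hypothesis no_neg : ~~ C (- i.+1%:Z) (- i%:Z).

Lemma block_nsame a b : C a b -> ~ (a = i /\ b = i.+1) /\ ~ (a = - i.+1%:Z /\ b = - i%:Z).
Proof.
move=> Cab; split=> -[E1 E2]; [apply: (negP no_pos) | apply: (negP no_neg)];
  by rewrite -E1 -E2.
Qed.

Lemma relabel_le a b : C a b -> sx i a <= sx i b.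
Proof.
move=> Cab; have := form_le C_form Cab; have := block_nsame Cab.
case: (a =P b) => [-> //|ab] ns le.
have /(sx_mono i0) [] : a < b by lia.
- by lia.
- by case: ns.
- by case: ns.
Qed.

Lemma relabel_form : form n (relabel i C) (p \o sx i).
Proof.
case: (C_form) => f1 f2 f3 f4 f5 f6; split; rewrite /relabel /=.
- by move=> a b /relabel_le; rewrite !sxK.
- by move=> a b /f2.
- by move=> a b /f3 [|->]; [move/(can_inj (sxK i)); left | right].
- move=> x /f4 [a [b [Cab E]]]; exists (sx i a), (sx i b); rewrite !sxK; split=> //.
  by case: E => <-; rewrite sxK; [left | right].
- move=> a b a' b' Cab Cab' E; have [] := f5 _ _ _ _ Cab Cab'.
    by case: E => [|[|[|]]] ->; auto.
  by move=> /(can_inj (sxK i)) -> /(can_inj (sxK i)) ->.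
move=> a b a' b' Cab Cab' lt.
have := f6 _ _ _ _ Cab Cab' lt.
have := f3 _ _ Cab; have := f3 _ _ Cab'; move: lt.
have := sxK i a; have := sxK i b; have := sxK i a'; have := sxK i b'.
move: (sx i a) (sx i b) (sx i a') (sx i b') Cab Cab' => A B A' B' Cab Cab' <- <- <- <- lt H1 H2.
have HA : p B <= p A by case: H2 => [->|]; lia.
have HA' : p A' <= p B' + 1 by case: H1 => [->|]; lia.
(* The order of two minima or two maxima can be reversed only for i, i+1 or their negatives, and
   then the positions contradict the descent. *)
case=> /(sx_mono i0)[|[E1 E2]|[E1 E2]]; [by left | | | by right | |]; exfalso.
- by move: lt; rewrite E1 E2; lia.
- by move: lt; rewrite E1 E2 !pN; lia.
- by move: HA HA'; rewrite E1 E2; lia.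
- by move: HA HA'; rewrite E1 E2 !pN; lia.
Qed.

Section Swap.

Variable z : int -> int.
Hypothesis zN : {morph z : x / - x}.
Hypothesis zK : involutive z.
Hypothesis no_swap : ~~ C (- i.+1%:Z) i.

Lemma block_nspec a b : C a b ->
  ~ (a = - i%:Z /\ b = i.+1) /\ ~ (a = - i.+1%:Z /\ b = i).
Proof.
move=> Cab; split; first exact: no_asc_block.
by case=> E1 E2; move: no_swap; rewrite -E1 -E2 Cab.
Qed.

(** Together the three conclusions say that [t_i] is a descent of [z] that does not commute with
    [z], so the step down is a conjugation. *)
Lemma desc_matches : valid C -> matches C z ->
  [/\ z i.+1 < z i, ~ (z i = - i%:Z /\ z i.+1 = - i.+1%:Z) & z i <> i.+1].
Proof.
move=> V M.
have [|a [b [Cab T]]] := letter_type zN zK V M (k := i); first by lia.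
have [|a' [b' [Cab' T']]] := letter_type zN zK V M (k := i.+1); first by lia.
have N := block_nsame Cab; have N' := block_nsame Cab'.
have S := block_nspec Cab; have S' := block_nspec Cab'.
have F := form_sep C_form Cab Cab'; have F' := form_sep C_form Cab' Cab.
have A := form_adj C_form Cab; have A' := form_adj C_form Cab'.
have P := form_pos C_form Cab; have P' := form_pos C_form Cab'.
have X h := V.2 _ _ _ _ Cab h Cab'; have X' h := V.2 _ _ _ _ Cab' h Cab.
suff : z i.+1 < z i /\ ~ (z i = - i%:Z /\ z i.+1 = - i.+1%:Z) /\ z i <> i.+1.
  by case=> ? [? ?]; split.
case: T => [T|[T|[T|[T|[T|T]]]]]; case: T => E1 [E2 E3]; subst;
case: T' => [T|[T|[T|[T|[T|T]]]]]; case: T => E1' [E2' E3']; subst;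
rewrite ?pN in F F' A A' P P'; rewrite ?E3 ?E3';
(* Each combination of the roles of i and i+1 is tried with the facts on positions alone, then with
   the excluded pairs alone, then with everything, noncrossing included. *)
by first [clear N N' S S' X X'; lia | clear F F' A A' P P' X X'; lia | lia].
Qed.

End Swap.

End Unsplit.
End PositiveStep.
End Step.

Lemma valid_ext (C C' : rel int) : C =2 C' -> valid C -> valid C'.
Proof.
by move=> E [V1 V2]; split=> [a b|a b a' b']; rewrite -!E; [exact: V1 | exact: V2].
Qed.

Lemma matches_ext (C C' : rel int) (z z' : int -> int) :
  C =2 C' -> z =1 z' -> matches C z -> matches C' z'.
Proof. by move=> E Ez M a b; rewrite -!E -!Ez; exact: M. Qed.

(** * The induction step: removing a left descent *)

Section Step.

Variables (n : nat) (op : W n -> W n -> W n).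
Hypothesis op_dem : is_demazure op.
Variables (i : 'I_n) (w : W n) (C : rel int).
Let p := ext w^-1%g.
Hypothesis C_form : form n C p.
Hypothesis desc : p i.+1 < p i.

Let pN : {morph p : x / - x} := extN w^-1%g.
Let p_range : forall x, (0 < `|p x| <= n) = (0 < `|x| <= n) := ext_range w^-1%g.

(** The second component has the same shape as the recursion [is_inv_atom_sg], with the validity and
    matching of the blocks in place of [is_inv_atom]; the induction then only compares the two. *)
Definition step_spec (C1 : rel int) : Prop :=
  form n C1 (p \o sx i)
  /\ forall z : W n, z^-1%g = z -> (valid C /\ matches C (ext z)) <->
    exists z1, [/\ z1^-1%g = z1, valid C1 /\ matches C1 (ext z1),
      ext z1 i < ext z1 i.+1 & z = dconj op i z1].

Section Positive.

Hypothesis i0 : (0 < i)%N.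

Lemma sx_conj_ext z x : ext (mulW (sg i) (mulW z (sg i))) x = sx i (ext z (sx i x)).
Proof. by rewrite ext_sgl ext_sgr. Qed.

Lemma dconj_comm z1 : z1^-1%g = z1 -> ext z1 i < ext z1 i.+1 -> comm_cond i z1 ->
  dconj op i z1 = mulW z1 (sg i).
Proof. by move=> z1V asc com; rewrite dconj_asc // com. Qed.

Section Unsplit.

Hypothesis no_pos : ~~ C i i.+1.
Hypothesis no_neg : ~~ C (- i.+1%:Z) (- i%:Z).

(** The generic case: letters are exchanged and [z] is conjugated by [t_i]. *)
Lemma step_relabel : ~~ C (- i.+1%:Z) i -> step_spec (relabel i C).
Proof.
move=> no_swap; have lti := ltn_ord i.
have rform := relabel_form pN C_form i0 lti desc no_pos no_neg.
split=> // z zV; have zN := extN z; have zK := invol_ext zV.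
have nspec := block_nspec pN C_form i0 lti desc no_swap.
split=> [[V M]|[z1 [z1V [V1 M1] asc ->]]].
  have [dz nboth nsw] := desc_matches pN C_form p_range i0 lti desc no_pos no_neg
    zN zK no_swap V M.
  have [z1 [z1V asc Ez Ez1]] := dconj_desc_inv op_dem zV dz.
  have ncom : comm_cond i z = false by rewrite comm_condS //; lia.
  exists z1; split=> //; rewrite Ez1 ncom.
  have [V1 M1] := relabel_valid_matches i0 zN (form_le C_form) nspec nboth V M.
  by split=> //; apply: matches_ext M1 => // x; rewrite sx_conj_ext.
have z1N := extN z1; have z1K := invol_ext z1V.
have C1N a b : relabel i C a b ->
    ~ (a = - i%:Z /\ b = i.+1) /\ ~ (a = - i.+1%:Z /\ b = i).
  have [s0 s1 _] := sx_i012 i0.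
  move=> Cab; split=> -[E1 E2]; move: Cab;
    rewrite /relabel E1 E2 !sxN ?s0 ?s1 => Cab; first by rewrite Cab in no_swap.
  by have [] := nspec _ _ Cab; case.
have nboth : ~ (ext z1 i = - i%:Z /\ ext z1 i.+1 = - i.+1%:Z) by lia.
have [V M] := relabel_valid_matches i0 z1N (form_le rform) C1N nboth V1 M1.
(* Commutation at an ascent means that z1 fixes i and i+1 or that z1 i = -(i+1). The latter needs
   the excluded block (-i, i+1). The former makes i and i+1 singletons, of [C] as well, and p (i+1)
   < p i contradicts [form_sep]. *)
have ncom : comm_cond i z1 = false.
  apply/negbTE/negP; rewrite comm_condS // => com.
  have p1N : {morph p \o sx i : x / - x} by move=> x /=; rewrite sxN pN.
  have sx_range x : (0 < `|sx i x| <= n) = (0 < `|x| <= n).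
    by rewrite -(ext_sg i) ext_range.
  have p1r x : (0 < `|(p \o sx i) x| <= n) = (0 < `|x| <= n).
    by rewrite /= p_range sx_range.
  have [|a [b [Cab T]]] := letter_type p1N rform p1r z1N z1K V1 M1 (k := i); first by lia.
  have [|a' [b' [Cab' T']]] := letter_type p1N rform p1r z1N z1K V1 M1 (k := i.+1);
    first by lia.
  have N := C1N _ _ Cab.
  have [Ea Eb] : a = i /\ b = i by lia.
  have [Ea' Eb'] : a' = i.+1 /\ b' = i.+1 by lia.
  subst; move: Cab Cab'; rewrite /relabel; have [-> -> _] := sx_i012 i0.
  by move=> Cab Cab'; have := form_sep C_form Cab Cab' desc; lia.
rewrite dconj_asc // ncom; split.
  by apply: valid_ext V; exact: relabelK.
by apply: matches_ext M; [exact: relabelK | move=> x; rewrite sx_conj_ext].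
Qed.

(** The block [i, -(i+1)] encodes the matched pair {i, i+1}, so [z] negates both letters and
    commutes with [t_i]. The step down turns it into the block [i+1, -i], a genuine pair of z1, and
    leaves all other blocks alone. *)
Lemma step_swap : C (- i.+1%:Z) i -> step_spec (relabel i C).
Proof.
move=> Csw; have lti := ltn_ord i.
have rform := relabel_form pN C_form i0 lti desc no_pos no_neg.
have [s0 s1 _] := sx_i012 i0.
have psw := form_pos C_form Csw.
have other a b : C a b -> (a = - i.+1%:Z /\ b = i) \/ (sx i a = a /\ sx i b = b).
  (* Since i and -(i+1) are letters of the word, their negatives are not, so [t_i] moves no other
     letter. *)
  have fixed x : 0 < p x -> x <> i -> x <> - i.+1%:Z -> sx i x = x.
    move=> px xi xi1; have [[E _]|[[E _]|[[E _]|[[E _]|[_ [_ ->]]]]]] := sx_spec x i0 => //.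
      by have := pN i.+1; rewrite E in px; lia.
    by have := pN i; rewrite E in px; lia.
  move=> Cab; have U := form_uniq C_form Cab Csw.
  have [/andP[pa _] /andP[pb _]] := form_pos C_form Cab.
  case: (a =P i :> int) => [E|ai]; first by left; apply: U; auto.
  case: (a =P - i.+1%:Z) => [E|ai1]; first by left; apply: U; auto.
  case: (b =P i :> int) => [E|bi]; first by left; apply: U; auto.
  case: (b =P - i.+1%:Z) => [E|bi1]; first by left; apply: U; auto.
  by right; rewrite !fixed.
have other1 a b : relabel i C a b ->
    (a = - i%:Z /\ b = i.+1) \/ C a b /\ (sx i a = a /\ sx i b = b).
  rewrite /relabel => Cab; case: (other _ _ Cab); last first; rewrite ?sxK.
    by case=> E1 E2; right; rewrite -E1 -E2 in Cab *.
  by case=> /(congr1 (sx i)) + /(congr1 (sx i)); rewrite !sxK sxN s0 s1; left.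
have V12 : valid C <-> valid (relabel i C).
  have toC1 a b : C a b -> sx i a = a -> sx i b = b -> relabel i C a b.
    by rewrite /relabel => Cab -> ->.
  split=> -[V1 V2]; split.
  - by move=> a b /other1 [[-> ->] //|[Cab _]]; exact: V1.
  - move=> a b a' b' /other1 [[-> ->]|[Cab _]]; first by lia.
    move=> ab /other1 [[-> ->]|[Cab' _]]; first by lia.
    exact: V2 Cab ab Cab'.
  - move=> a b Cab; case: (other _ _ Cab) => [[-> ->]|[Ea Eb]]; first by lia.
    exact/V1/toC1.
  move=> a b a' b' Cab; case: (other _ _ Cab) => [[-> ->]|[Ea Eb]] ab; first by lia.
  move=> Cab'; case: (other _ _ Cab') => [[-> ->]|[Ea' Eb']]; first by lia.
  by apply: V2 ab _; exact: toC1.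
split=> // z zV; have zN := extN z; have zK := invol_ext zV.
split=> [[V M]|[z1 [z1V [V1 M1] asc ->]]].
  have [E1 E2] : ext z i.+1 = - i.+1%:Z /\ ext z i = - i%:Z.
    by have := (M _ _ Csw).2; have := zN i.+1; lia.
  have dz : ext z i.+1 < ext z i by lia.
  have [z1 [z1V asc Ez Ez1]] := dconj_desc_inv op_dem zV dz.
  have com : comm_cond i z by rewrite comm_condS //; lia.
  exists z1; split=> //; rewrite Ez1 com; split; first exact/V12.
  move=> a b /other1; rewrite !ext_sgr => -[[-> ->]|[Cab [-> ->]]]; last exact: M.
  by rewrite sxN s0 s1 zN E1; split; lia.
have z1N := extN z1; have z1K := invol_ext z1V.
have Csw1 : relabel i C (- i%:Z) i.+1 by rewrite /relabel sxN s0 s1.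
have [E1 E2] : ext z1 i = - i.+1%:Z /\ ext z1 i.+1 = - i%:Z.
  have E := (M1 _ _ Csw1).1.
  have {}E : ext z1 (- i%:Z) = i.+1 by apply: E; lia.
  by split; [rewrite z1N in E; lia | rewrite -E z1K].
have com : comm_cond i z1 by rewrite comm_condS //; lia.
rewrite dconj_comm //; split; first exact/V12.
move=> a b Cab; rewrite !ext_sgr; case: (other _ _ Cab) => -[Ea Eb].
  by rewrite Ea Eb sxN s0 s1 z1N E1 E2; split; lia.
by have := M1 a b; rewrite /relabel Ea Eb; apply.
Qed.

End Unsplit.
Section Split.

Variable q : int.
Hypothesis qE : q = i \/ q = - i.+1%:Z.
Hypothesis Cq : C q (q + 1).

(* A left descent exchanging the two letters of the block [q + 1, q] splits it. *)
Definition split_block : rel int :=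
  fun a b => C a b && (a != q) || (a == b) && ((a == q) || (a == q + 1)).

Lemma sx_q : sx i q = q + 1.
Proof.
have [s0 s1 _] := sx_i012 i0.
by case: qE => ->; rewrite ?sxN ?s0 ?s1; lia.
Qed.

Lemma sx_q1 : sx i (q + 1) = q.
Proof. by rewrite -sx_q sxK. Qed.

Lemma split_adjacent : p q = p (q + 1) + 1.
Proof. by have [|//] := form_adj C_form Cq; lia. Qed.

Lemma letter_fixed x : 0 < p x -> x <> q -> x <> q + 1 -> sx i x = x.
Proof.
have [/andP[p1 _] /andP[p2 _]] := form_pos C_form Cq.
move=> px xq xq1; have [[E _]|[[E _]|[[E _]|[[E _]|[_ [_ ->]]]]]] := sx_spec x i0 => //.
- have F : x = - (q + 1) by lia.
  by move: px; rewrite F pN; lia.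
- have F : x = - q by lia.
  by move: px; rewrite F pN; lia.
- have F : x = - q by lia.
  by move: px; rewrite F pN; lia.
- have F : x = - (q + 1) by lia.
  by move: px; rewrite F pN; lia.
Qed.

Lemma other_block a b : C a b -> a <> q ->
  [/\ a <> q + 1, b <> q, b <> q + 1, sx i a = a & sx i b = b].
Proof.
move=> Cab aq; have U := form_uniq C_form Cab Cq.
have [/andP[pa _] /andP[pb _]] := form_pos C_form Cab.
have a1 : a <> q + 1 by move=> E; apply: aq; apply: (U _).1; auto.
have b0 : b <> q by move=> E; apply: aq; apply: (U _).1; auto.
have b1 : b <> q + 1 by move=> E; apply: aq; apply: (U _).1; auto.
by split=> //; apply: letter_fixed.
Qed.

Lemma split_blockP a b : split_block a b ->
  (C a b /\ a <> q) \/ (a = q /\ b = q) \/ (a = q + 1 /\ b = q + 1).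
Proof.
case/orP=> [/andP[Cab /eqP aq]|/andP[/eqP <- /orP[]/eqP ->]]; [by left|right..]; auto.
Qed.

Lemma split_form : form n split_block (p \o sx i).
Proof.
have [pq0 pq1] := form_pos C_form Cq; have pqE := split_adjacent.
have := sx_q1; have := sx_q => sq sq1.
split=> /=.
- move=> a b /split_blockP[[Cab _]|[[-> ->]|[-> ->]]] //; exact: form_le C_form _ _ Cab.
- move=> a b /split_blockP[[Cab aq]|[[-> ->]|[-> ->]]]; rewrite ?sq ?sq1 //.
  by have [_ _ _ -> ->] := other_block Cab aq; exact: form_pos C_form _ _ Cab.
- move=> a b /split_blockP[[Cab aq]|[[-> ->]|[-> ->]]]; [|by left..].
  by have [_ _ _ -> ->] := other_block Cab aq; exact: form_adj C_form _ _ Cab.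
- move=> x /(form_cover C_form)[a [b [Cab xab]]].
  case: (a =P q) => [aq|aq]; last first.
    have [_ _ _ sa sb] := other_block Cab aq; exists a, b.
    rewrite /split_block Cab; split; first by apply/orP; left; apply/eqP.
    by case: xab => /(congr1 (sx i)); rewrite sxK => ->; rewrite ?sa ?sb; auto.
  have [|_ bq] := form_uniq C_form Cab Cq; first by auto.
  rewrite aq bq in xab; rewrite /split_block.
  case: xab => /(congr1 (sx i)); rewrite sxK ?sq ?sq1 => ->.
    by exists (q + 1), (q + 1); rewrite !eqxx !orbT; auto.
  by exists q, q; rewrite !eqxx !orbT; auto.
- move=> a b a' b' /split_blockP H /split_blockP H'.
  case: H => [[Cab aq]|H].
    have [a1 b0 b1 _ _] := other_block Cab aq.
    case: H' => [[Cab' aq']|H']; first exact: form_uniq C_form _ _ _ _ Cab Cab'.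
    by lia.
  case: H' => [[Cab' aq']|H'].
    have [a1 b0 b1 _ _] := other_block Cab' aq'; lia.
  lia.
move=> a b a' b' /split_blockP H /split_blockP H'.
case: H => [[Cab aq]|H].
  have [a1 b0 b1 sa sb] := other_block Cab aq.
  case: H' => [[Cab' aq']|H'].
    have [_ _ _ sa' sb'] := other_block Cab' aq'.
    rewrite sa sa'; exact: form_sep C_form _ _ _ _ Cab Cab'.
  have := form_sep C_form Cab Cq; rewrite sa.
  by case: H' => -[-> ->]; rewrite ?sq ?sq1; lia.
case: H' => [[Cab' aq']|H'].
  have [a1 b0 b1 sa sb] := other_block Cab' aq'.
  have : p a' <> p q by move=> /(ext_inj (u := w^-1%g)).
  have := form_sep C_form Cq Cab'; rewrite sa.
  by case: H => -[-> ->]; rewrite ?sq ?sq1; lia.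
by case: H => -[-> ->]; case: H' => -[-> ->]; rewrite ?sq ?sq1; lia.
Qed.

Lemma split_block_single : split_block q q /\ split_block (q + 1) (q + 1).
Proof. by rewrite /split_block !eqxx !orbT. Qed.

Lemma split_block_other a b : C a b -> a <> q -> split_block a b.
Proof. by rewrite /split_block => -> /eqP ->. Qed.

(** For q = i, [z] exchanges i and i+1, commutes with [t_i], and the element below fixes both
    letters. For q = -(i+1) both sides of the equivalence fail. *)
Lemma step_split : step_spec split_block.
Proof.
split=> [|z zV]; first exact: split_form.
have zN := extN z; have zK := invol_ext zV.
have [Sq Sq1] := split_block_single.
case: qE => qi.
  have qi1 : q + 1 = i.+1 by lia.
  split=> [[V M]|[z1 [z1V [V1 M1] asc ->]]].
    have zi : ext z i = i.+1 by rewrite -qi -qi1; apply: (M _ _ Cq).1; lia.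
    have ziS : ext z i.+1 = i by rewrite -zi zK.
    have dz : ext z i.+1 < ext z i by lia.
    have [z1 [z1V asc Ez Ez1]] := dconj_desc_inv op_dem zV dz.
    have com : comm_cond i z by rewrite comm_condS //; lia.
    exists z1; split=> //; rewrite Ez1 com; split; [split|].
    - by move=> a b /split_blockP[[Cab _]|[[-> ->]|[-> ->]]] //; exact: V.1.
    - move=> a b a' b' /split_blockP[[Cab _]|[[-> ->]|[-> ->]]] ab; [|lia..].
      by move=> /split_blockP[[Cab' _]|[[-> ->]|[-> ->]]]; [exact: V.2 Cab ab Cab'|lia..].
    move=> a b /split_blockP[[Cab aq]|[[-> ->]|[-> ->]]]; rewrite !ext_sgr.
    - by have [_ _ _ -> ->] := other_block Cab aq; exact: M.
    - by rewrite sx_q qi1 ziS qi; split; lia.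
    - by rewrite sx_q1 qi1 qi zi; split; lia.
  have z1i : ext z1 i = i by rewrite -qi; apply: (M1 _ _ Sq).1; lia.
  have z1iS : ext z1 i.+1 = i.+1 by rewrite -qi1; apply: (M1 _ _ Sq1).1; lia.
  have com : comm_cond i z1 by rewrite comm_condS //; lia.
  rewrite dconj_comm //; split; [split|].
  - move=> a b Cab; case: (a =P q) => [aq|aq]; last exact/V1.1/split_block_other.
    have [|_ ->] := form_uniq C_form Cab Cq; [by auto|lia].
  - move=> a b a' b' Cab ab Cab'.
    case: (a =P q) => [aq|aq].
      have [|_ E] := form_uniq C_form Cab Cq; [by auto|lia].
    case: (a' =P q) => [aq'|aq'].
      have [|_ E] := form_uniq C_form Cab' Cq; [by auto|lia].
    by apply: V1.2 ab _; exact: split_block_other.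
  move=> a b Cab; rewrite !ext_sgr; case: (a =P q) => [aq|aq].
    have [|-> ->] := form_uniq C_form Cab Cq; first by auto.
    by rewrite sx_q sx_q1 qi1 qi z1i z1iS; split; lia.
  have [_ _ _ -> ->] := other_block Cab aq.
  exact/M1/split_block_other.
(* The block [-i, -(i+1)] is not valid; after splitting, z1 would negate i and i+1 and so have a
   descent at i. *)
split=> [[V _]|[z1 [z1V [V1 M1] asc _]]].
  by have := V.1 _ _ Cq; lia.
have := (M1 _ _ Sq).2; have := (M1 _ _ Sq1).2; rewrite qi.
have -> : - i.+1%:Z + 1 = - i%:Z by lia.
by rewrite !extN; lia.
Qed.

End Split.

End Positive.
Section Zero.

Hypothesis i0 : i = 0%N :> nat.

Lemma letter_neq1 x : 0 < p x -> x <> 1 /\ x <> 0.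
Proof.
have pi : p i = 0 by rewrite i0 /p ext0.
move=> px; split=> E; last by move: px; rewrite E /p ext0.
have E' : x = i.+1 by rewrite i0 E.
by move: px desc; rewrite pi E'; lia.
Qed.

Lemma block0_cases a b : C a b ->
  [\/ a = -1 /\ b = -1, a = -1 /\ 1 < b, a < -1 /\ b = -1 | 1 < `|a| /\ 1 < `|b|].
Proof.
move=> Cab; have [/andP[pa _] /andP[pb _]] := form_pos C_form Cab.
have := letter_neq1 pa; have := letter_neq1 pb; have := form_le C_form Cab.
case: (a =P -1) => [a1|a1]; case: (b =P -1) => [b1|b1] le nb na.
- by constructor 1.
- by constructor 2; lia.
- by constructor 3; lia.
- by constructor 4; lia.
Qed.

Lemma sx0_fixed x : 1 < `|x| -> sx 0 x = x.
Proof. by have := sx0_spec x; lia. Qed.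

(** A descent at 0 means that -1 is a letter and 1 is not, and replacing -1 by 1 does not move it
    past any other letter. *)
Lemma sx0_mono x y : 0 < p x -> 0 < p y -> x < y -> sx 0 x < sx 0 y.
Proof.
move=> /letter_neq1 + /letter_neq1.
by have := sx0_spec x; have := sx0_spec y; lia.
Qed.

Lemma relabel0_form : form n (relabel 0 C) (p \o sx 0).
Proof.
case: (C_form) => f1 f2 f3 f4 f5 f6; split; rewrite /relabel /=.
- move=> a b Cab; have [/andP[pa _] /andP[pb _]] := f2 _ _ Cab.
  rewrite leNgt; apply/negP=> ba; have := f1 _ _ Cab.
  case: (eqVneq (sx 0 a) (sx 0 b)) => [/(can_inj (sxK 0)) E|ne le]; first by lia.
  by have := sx0_mono pa pb (_ : _ < _); rewrite !sxK => /(_ ltac:(lia)); lia.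
- by move=> a b /f2.
- by move=> a b /f3 [|->]; [move/(can_inj (sxK 0)); left | right].
- move=> x /f4 [a [b [Cab E]]]; exists (sx 0 a), (sx 0 b); rewrite !sxK; split=> //.
  by case: E => <-; rewrite sxK; [left | right].
- move=> a b a' b' Cab Cab' E; have [] := f5 _ _ _ _ Cab Cab'.
    by case: E => [|[|[|]]] ->; auto.
  by move=> /(can_inj (sxK 0)) -> /(can_inj (sxK 0)) ->.
move=> a b a' b' Cab Cab' lt.
have [/andP[pa _] /andP[pb _]] := f2 _ _ Cab.
have [/andP[pa' _] /andP[pb' _]] := f2 _ _ Cab'.
case: (f6 _ _ _ _ Cab Cab' lt) => /sx0_mono; rewrite !sxK => H; [left|right]; exact: H.
Qed.

Lemma relabel0_block a b : C a b -> relabel 0 C (sx 0 a) (sx 0 b).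
Proof. by rewrite /relabel !sxK. Qed.

(** If -1 is a block by itself, [z] negates 1, commutes with [t_0], and the element below fixes 1.
    If -1 is the smaller letter of a block, the step is a conjugation. A block [-1, a] with a < -1
    is invalid above, and below it would force z1 1 = -1, against the ascent; [N1] excludes it on
    each side. *)
Lemma step_zero : step_spec (relabel 0 C).
Proof.
split=> [|z zV]; first by rewrite i0; exact: relabel0_form.
have zN := extN z; have zK := invol_ext zV.
have s1 : sx 0 1 = -1 by []. have sN1 : sx 0 (-1) = 1 by [].
have C1cases a b : relabel 0 C a b ->
    [\/ a = 1 /\ b = 1 /\ C (-1) (-1), a = 1 /\ 1 < b /\ C (-1) b,
        a < -1 /\ b = 1 /\ C a (-1) | 1 < `|a| /\ 1 < `|b| /\ C a b].
  rewrite /relabel => Cab; have := sxK 0 a; have := sxK 0 b.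
  case: (block0_cases Cab) (Cab) => -[Ea Eb].
  - by rewrite Ea Eb sN1 => ? <- <-; constructor 1.
  - rewrite Ea sN1 (@sx0_fixed (sx 0 b)); last by lia.
    by move=> CB E <-; rewrite E in CB Eb; constructor 2.
  - rewrite Eb sN1 (@sx0_fixed (sx 0 a)); last by lia.
    by move=> CA <- E; rewrite E in CA Ea; constructor 3.
  rewrite !(sx0_fixed Ea) !(sx0_fixed Eb) => CAB E1 E2.
  by rewrite E1 E2 in CAB Ea Eb; constructor 4.
have sE : sx i = sx 0 by rewrite i0.
have iS : i.+1%:Z = GRing.one int by rewrite i0.
have zN1 (u : W n) : ext u (-1) = - ext u 1 by rewrite extN.
have comE (u : W n) : comm_cond i u = (`|ext u 1| == 1) by rewrite comm_cond0.
have zneq0 (u : W n) : ext u 1 != 0 by rewrite ext_eq0.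
split=> [[V M]|[z1 [z1V [V1 M1] asc ->]]].
  have N1 : ~ exists2 a, C a (-1) & a < -1.
    by case=> a Cab; have := V.1 _ _ Cab; lia.
  have dz : ext z i.+1 < ext z i.
    rewrite iS i0 ext0.
    have [|a [b [Cab E]]] := form_cover C_form (x := -1).
      have p1 : p 1 < 0 by move: desc; rewrite iS i0 /p ext0.
      by have := ltn_ord i; have := p_range (-1); rewrite pN; move: (p 1) p1 => q; lia.
    have [M2 M3] := M _ _ Cab; have := zN1 z.
    case: (block0_cases Cab) => -[Ea Eb]; subst.
    - by move: M2 M3; move: (ext z (-1)) (ext z 1); lia.
    - by move: M2 M3; move: (ext z (-1)) (ext z 1); lia.
    - by case: N1; exists a.
    by case: E => E; rewrite -E in Ea Eb.
  have [z1 [z1V asc Ez Ez1]] := dconj_desc_inv op_dem zV dz.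
  exists z1; split=> //.
  have z1E x : ext z1 x = if comm_cond i z then ext z (sx 0 x) else sx 0 (ext z (sx 0 x)).
    by rewrite Ez1; case: ifP => _; rewrite ?ext_sgl ext_sgr sE.
  split; [split|].
  - move=> a b /C1cases[[-> [-> _]]|[-> [b1 _]]|[a1 [-> _]]|[_ [_ Cab]]] //; first by lia.
    exact: V.1 Cab.
  - move=> a b a' b' /C1cases[[-> [-> _]]|[-> [b1 _]]|[a1 [-> Cab]]|[a1 [b1 Cab]]] ab.
    + by lia.
    + by lia.
    + by case: N1; exists a.
    move=> /C1cases[[-> [-> _]]|[-> [b1' _]]|[a1' [-> Cab']]|[a1' [b1' Cab']]].
    + by lia.
    + by lia.
    + by lia.
    exact: V.2 Cab ab Cab'.
  move=> a b /C1cases[[-> [-> Cab]]|[-> [b1 Cab]]|[a1 [-> Cab]]|[a1 [b1 Cab]]].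
  - have [_ z11] := M _ _ Cab.
    have {}z11 : ext z (-1) = 1 by move: z11; move: (ext z _); lia.
    rewrite z1E comE s1 z11; have := zN1 z; rewrite z11; move: (ext z 1) => x.
    by case: eqP => //; lia.
  - have [z11 _] := M _ _ Cab.
    have {}z11 : ext z (-1) = b by apply: z11; lia.
    rewrite z1E comE s1 z11 sx0_fixed; last by lia.
    by case: ifP; lia.
  - by case: N1; exists a.
  rewrite !z1E !(sx0_fixed a1) !(sx0_fixed b1); have [M2 M3] := M _ _ Cab.
  case: ifP => _; first by split.
  split=> [/M2 ->|/M3[-> ->]]; first exact: (sx0_fixed b1).
  by rewrite !sx0_fixed // normrN.
have N1 : ~ exists2 a, C a (-1) & a < -1.
  case=> a Cab a1; have := (M1 _ _ (relabel0_block Cab)).2.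
  rewrite sN1 sx0_fixed; last by lia.
  by move: asc; rewrite iS i0 ext0; move: (ext z1 1) (ext z1 a); lia.
have z1p : 0 < ext z1 1 by move: asc; rewrite iS i0 ext0.
rewrite dconj_asc //.
set z2 := if _ then _ else _.
have zE x : ext z2 x = if comm_cond i z1 then ext z1 (sx 0 x) else sx 0 (ext z1 (sx 0 x)).
  by rewrite /z2; case: ifP => _; rewrite ?ext_sgl ext_sgr sE.
have toC1 a b : C a b -> 1 < `|a| -> 1 < `|b| -> relabel 0 C a b.
  by rewrite /relabel => Cab a1 b1; rewrite !sx0_fixed.
split; [split|].
- move=> a b Cab; case: (block0_cases Cab) => -[a1 b1].
  + by rewrite a1 b1.
  + by lia.
  + by case: N1; exists a => //; rewrite -b1.
  exact: V1.1 (toC1 _ _ Cab a1 b1).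
- move=> a b a' b' Cab ab Cab'; case: (block0_cases Cab) => -[a1 b1]; [lia..|].
  case: (block0_cases Cab') => -[a1' b1']; [lia..|].
  exact: V1.2 (toC1 _ _ Cab a1 b1) ab (toC1 _ _ Cab' a1' b1').
move=> a b Cab; case: (block0_cases Cab) => -[a1 b1].
- have := M1 _ _ (relabel0_block Cab); rewrite a1 b1 sN1 => -[z11 _].
  have {}z11 : ext z1 1 = 1 by apply: z11; lia.
  by rewrite zE sN1 comE z11 normr1 eqxx; split.
- have := M1 _ _ (relabel0_block Cab); rewrite a1 sN1 sx0_fixed; last by lia.
  move=> [z11 _]; have {}z11 : ext z1 1 = b by apply: z11; lia.
  rewrite zE sN1 comE z11 sx0_fixed; last by lia.
  by case: ifP; split; lia.
- by case: N1; exists a => //; rewrite -b1.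
have [M2 M3] := M1 _ _ (toC1 _ _ Cab a1 b1); rewrite !zE !(sx0_fixed a1) !(sx0_fixed b1).
case: ifP => _; first by split.
split=> [/M2 ->|/M3[-> ->]]; first exact: (sx0_fixed b1).
by rewrite !sx0_fixed // normrN.
Qed.

End Zero.

Lemma step_exists : exists C1, step_spec C1.
Proof.
case: (posnP i) => [i0|i0]; first by exists (relabel 0 C); exact: step_zero.
have iE : - i.+1%:Z + 1 = - i%:Z by lia.
case: (boolP (C i i.+1)) => [Ci|no_pos].
  exists (split_block i); apply: step_split => //; first by left.
  by have -> : i%:Z + 1 = i.+1 by lia.
case: (boolP (C (- i.+1%:Z) (- i%:Z))) => [Ci|no_neg].
  by exists (split_block (- i.+1%:Z)); apply: step_split; rewrite ?iE //; right.
exists (relabel i C).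
by case: (boolP (C (- i.+1%:Z) i)) => [sw|nsw]; [exact: step_swap | exact: step_relabel].
Qed.

End Step.

(** Positions equal letters here, so a two-letter block b a would need a = b + 1 although a <= b:
    all blocks are positive singletons, and they match only the identity. *)
Lemma form_atom1 (n : nat) (C : rel int) (z : W n) : form n C (ext (1%g : W n)) ->
  z = 1%g <-> valid C /\ matches C (ext z).
Proof.
move=> [f1 f2 f3 f4 _ _].
have diag a b : C a b -> a = b /\ 0 < a.
  by move=> Cab; have := f1 _ _ Cab; have := f2 _ _ Cab; have := f3 _ _ Cab; rewrite !ext1; lia.
split=> [->|[_ M]].
  split; [split|].
  - by move=> a b /diag[].
  - by move=> a b a' b' /diag[<- a0]; lia.
  by move=> a b /diag[<- a0]; rewrite ext1; split=> //; lia.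
have E (k : nat) : (0 < k <= n)%N -> ext z k = k.
  move=> kn; have [|a [b [Cab E]]] := f4 k; first by rewrite ext1; lia.
  have [ab a0] := diag _ _ Cab; have ka : k = a :> int by lia.
  by rewrite {1}ka (M _ _ Cab).1; lia.
apply: eq_ext => x; rewrite ext1.
case: (boolP (0 < `|x| <= n)) => Hx; last by rewrite ext_out.
case: x Hx => k Hk; first by rewrite E //; lia.
by rewrite NegzE extN E //; lia.
Qed.

(* A left descent of [w] transforms the blocks by [relabel], or by [split_block]
   if its two letters form a block, and [z] by a step down in the involution weak
   order; validity is preserved exactly when that step is a genuine one. *)
Theorem form_atom (n : nat) (op : W n -> W n -> W n) (op_dem : is_demazure op)
    (w z : W n) (C : rel int) : z^-1%g = z -> form n C (ext w^-1%g) ->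
  is_inv_atom op w z <-> valid C /\ matches C (ext z).
Proof.
elim/(@left_desc_ind n): w z C => [|i u asc IH] z C zV C_form.
  rewrite is_inv_atom1 //; apply: form_atom1; apply: form_ext C_form => x.
  by rewrite invg1.
have desc : ext (mulW (sg i) u)^-1%g i.+1 < ext (mulW (sg i) u)^-1%g i.
  by rewrite ext_ltgt sgl_asc ext_ltgt negbK.
have [C1 [C1_form C1P]] := step_exists op_dem C_form desc.
have {}C1_form : form n C1 (ext u^-1%g).
  by apply: form_ext C1_form => x; rewrite /= invW_mul sgV ext_sgr sxK.
rewrite is_inv_atom_sg // C1P //; split=> -[z1 [z1V H asc1 Ez]]; exists z1; split=> //.
  exact/(IH z1 C1 z1V C1_form).
exact/(IH z1 C1 z1V C1_form).
Qed.

(** * Words without consecutive patterns *)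

Definition low_order (C : rel int) (p : int -> int) : Prop :=
  forall a b a' b', C a b -> C a' b' -> p a < p a' -> a < a'.

Definition high_order (C : rel int) (p : int -> int) : Prop :=
  forall a b a' b', C a b -> C a' b' -> p a < p a' -> b < b'.

Section Patterns.

Variables (n : nat) (g p : int -> int).
Hypotheses (gK : cancel g p) (pK : cancel p g).

Lemma position_inj : injective p. Proof. exact: can_inj pK. Qed.
Lemma letter_inj : injective g. Proof. exact: can_inj gK. Qed.

Section FormPatterns.

Variable C : rel int.
Hypothesis C_form : form n C p.

(** Two consecutive letters either form a block, or the first closes its block, being its minimum,
    and the second opens its block, being its maximum. *)
Lemma adjacent_letters x y : 0 < p x -> p y = p x + 1 -> p y <= n ->
  C y x \/ (exists b, C x b) /\ (exists a, C a y).
Proof.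
move=> px pyx py.
have [|a [b [Cab xab]]] := form_cover C_form (x := x); first by lia.
have [|a' [b' [Cab' yab]]] := form_cover C_form (x := y); first by lia.
have U := form_uniq C_form Cab Cab'.
have A := form_adj C_form Cab; have A' := form_adj C_form Cab'.
case: (a =P a') => [E|ne].
  have [_ Eb] := U (or_introl E); subst.
  left; case: xab => Ex; case: yab => Ey; subst => //; exfalso; try lia.
  by case: A => [E|]; [rewrite E in pyx|]; lia.
right; split.
  case: xab => Ex; subst; first by exists b.
  case: A => [<-|A]; first by exists b; rewrite -?A.
  have : a = y by apply: position_inj; rewrite pyx A.
  by move=> E; case: ne; apply: (U _).1; rewrite E; case: yab; auto.
case: yab => Ey; subst; last by exists a'.
case: A' => [E|A']; first by exists a'; rewrite {2}E.
have : x = b' by apply: position_inj; lia.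
by move=> E; case: ne; apply: (U _).1; rewrite -E; case: xab; auto.
Qed.

(** In a pattern b c a the letter b is the minimum of its block. If c a is a block, its minimum a <
    b comes too late; otherwise c is a minimum and the block opened by a has a minimum at most a <
    c. *)
Lemma low_no_bca (k : nat) : low_order C p -> (0 < k)%N -> (k.+2 <= n)%N ->
  ~~ (g k.+2 < g k < g k.+1).
Proof.
move=> low k0 kn; apply/negP => /andP[wx xy].
have [Cyx|[[b Cxb] _]] := adjacent_letters (x := g k) (y := g k.+1)
  ltac:(rewrite gK; lia) ltac:(rewrite !gK; lia) ltac:(rewrite gK; lia).
  by have := form_le C_form Cyx; lia.
have [Cwy|[[b' Cyb] [a Caw]]] := adjacent_letters (x := g k.+1) (y := g k.+2)
  ltac:(rewrite gK; lia) ltac:(rewrite !gK; lia) ltac:(rewrite gK; lia).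
  by have := low _ _ _ _ Cxb Cwy; rewrite !gK; lia.
have := low _ _ _ _ Cyb Caw; rewrite gK; have := form_le C_form Caw.
by have := form_adj C_form Caw; rewrite gK => -[->|]; rewrite ?gK; lia.
Qed.

Lemma high_no_cab (k : nat) : high_order C p -> (0 < k)%N -> (k.+2 <= n)%N ->
  ~~ (g k.+1 < g k.+2 < g k).
Proof.
move=> high k0 kn; apply/negP => /andP[yw wx].
have [Cwy|[_ [a Caw]]] := adjacent_letters (x := g k.+1) (y := g k.+2)
  ltac:(rewrite gK; lia) ltac:(rewrite !gK; lia) ltac:(rewrite gK; lia).
  by have := form_le C_form Cwy; lia.
have [Cyx|[[b Cxb] [a' Cay]]] := adjacent_letters (x := g k) (y := g k.+1)
  ltac:(rewrite gK; lia) ltac:(rewrite !gK; lia) ltac:(rewrite gK; lia).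
  have := high _ _ _ _ Cyx Caw; rewrite gK.
  by have := form_adj C_form Caw; rewrite gK => -[->|]; rewrite ?gK; lia.
have := high _ _ _ _ Cxb Cay; rewrite gK; have := form_le C_form Cxb.
by have := form_adj C_form Cay; rewrite gK => -[->|]; rewrite ?gK; lia.
Qed.

End FormPatterns.

Section PatternForm.

Hypothesis no_cba : forall k : nat, (0 < k)%N -> (k.+2 <= n)%N -> ~~ (g k.+2 < g k.+1 < g k).

(** The bounds exclude comparisons with the values at 0 and beyond n, so the tests below need no
    special case at either end of the word. *)
Definition descent_at (k : int) : bool := (0 < k < n) && (g (k + 1) < g k).

Definition descent_block : rel int := fun a b =>
  [&& 0 < p a <= n, 0 < p b <= n &
    (p a == p b + 1) && descent_at (p b)
    || [&& a == b, ~~ descent_at (p a - 1) & ~~ descent_at (p a)]].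

Lemma no_double_descent k : descent_at k -> ~~ descent_at (k + 1).
Proof.
case/andP=> kn gk; apply/negP => /andP[k1n gk1].
case: k kn gk k1n gk1 => // k kn gk k1n gk1.
have E1 : k%:Z + 1 = k.+1 by lia.
have E2 : k.+1%:Z + 1 = k.+2 by lia.
rewrite E1 ?E2 in gk gk1 k1n.
by have := @no_cba k; rewrite gk gk1; lia.
Qed.

Lemma descent_blockP a b : descent_block a b ->
  [/\ 0 < p a <= n, 0 < p b <= n &
   (p a = p b + 1 /\ descent_at (p b))
   \/ [/\ a = b, ~~ descent_at (p a - 1) & ~~ descent_at (p a)]].
Proof.
case/and3P => pa pb /orP[/andP[/eqP E d]|/and3P[/eqP E d1 d2]]; split=> //.
  by left.
by right.
Qed.

Lemma descent_block_low a b : descent_block a b -> ~~ descent_at (p a).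
Proof.
by case/descent_blockP=> _ _ [[-> /no_double_descent]|[]].
Qed.

Lemma descent_block_high a b : descent_block a b -> ~~ descent_at (p b - 1).
Proof.
case/descent_blockP=> _ _ [[_ d]|[-> //]].
by apply/negP => /no_double_descent; rewrite subrK d.
Qed.

Lemma descent_block_uniq a b a' b' : descent_block a b -> descent_block a' b' ->
  (a = a' \/ a = b' \/ b = a' \/ b = b') -> a = a' /\ b = b'.
Proof.
move=> Cab Cab' E.
have [l h] := (descent_block_low Cab, descent_block_high Cab).
have [l' h'] := (descent_block_low Cab', descent_block_high Cab').
case: (descent_blockP Cab) => _ _ [[pab d]|[ab d1 d2]];
  case: (descent_blockP Cab') => _ _ [[pab' d']|[ab' d1' d2']].
- case: E => [|[|[|]]] E; subst.
  + by split=> //; apply: position_inj; lia.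
  + by rewrite d' in l.
  + by rewrite d in l'.
  + by split=> //; apply: position_inj; lia.
- subst; have [E'|E'] : a = b' \/ b = b' by case: E => [|[|[|]]]; auto.
    by move: d1'; rewrite -E' pab addrK d.
  by move: d2'; rewrite -E' d.
- subst; have [E'|E'] : b = a' \/ b = b' by case: E => [|[|[|]]]; auto.
    by move: d1; rewrite E' pab' addrK d'.
  by move: d2; rewrite E' d'.
- by subst; case: E => [|[|[|]]].
Qed.

Lemma descent_form : (low_order descent_block p \/ high_order descent_block p) ->
  form n descent_block p.
Proof.
move=> order; split.
- move=> a b /descent_blockP[_ _ [[E /andP[_]]|[-> //]]].
  by rewrite -E !pK => /ltW.
- by move=> a b /descent_blockP[].
- by move=> a b /descent_blockP[_ _ [[E _]|[E _ _]]]; [right | left].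
- move=> x px; case: (boolP (descent_at (p x))) => d1.
    exists (g (p x + 1)), x; split; last by right.
    rewrite /descent_block gK px eqxx d1 /= andbT.
    by case/andP: d1; lia.
  case: (boolP (descent_at (p x - 1))) => d2.
    exists x, (g (p x - 1)); split; last by left.
    rewrite /descent_block gK px subrK eqxx d2 /= andbT.
    by case/andP: d2; lia.
  by exists x, x; split; [rewrite /descent_block px eqxx d1 d2 orbT | left].
- exact: descent_block_uniq.
by case: order => H a b a' b' Cab Cab' lt; [left | right]; exact: H Cab Cab' lt.
Qed.

(** The minimum of a block stands at a position j that is not a descent, and such a letter is
    smaller than all later ones: the first later letter below it would be smaller than its two
    predecessors, giving c b a or b c a. *)
Lemma no_bca_low :
  (forall k : nat, (0 < k)%N -> (k.+2 <= n)%N -> ~~ (g k.+2 < g k < g k.+1)) ->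
  low_order descent_block p.
Proof.
move=> no_bca.
have key (j k : nat) : (0 < j)%N -> ~~ descent_at j -> (j < k <= n)%N -> g j < g k.
  move=> j0 dj; have [m] := ubnP k; elim: m k => // m IH k km jk.
  case: (eqVneq k j.+1) => [E|kj].
    have : g k != g j by rewrite (inj_eq letter_inj); lia.
    by move: dj; rewrite /descent_at E -[j%:Z + 1]/(Posz (j + 1)%N) addn1; lia.
  have [k' Ek] : exists k', k = k'.+2 by exists k.-2; lia.
  subst; have H1 : g j < g k'.+1 by apply: IH; lia.
  have H2 : g j <= g k'.
    by case: (eqVneq k' j) => [->//|ne]; apply/ltW/IH; lia.
  have := @no_bca k' ltac:(lia) ltac:(lia); have := @no_cba k' ltac:(lia) ltac:(lia).
  have : g k'.+2 != g k' by rewrite (inj_eq letter_inj); lia.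
  have : g k'.+1 != g k' by rewrite (inj_eq letter_inj); lia.
  by lia.
move=> a b a' b' Cab Cab' lt; have d := descent_block_low Cab.
case: (descent_blockP Cab) => pa _ _; case: (descent_blockP Cab') => pa' _ _.
rewrite -[a]pK -[a']pK; case: (p a) (p a') pa pa' lt d => // j [] // k ja ka lt d.
by apply: key => //; lia.
Qed.

(** Dually, the maximum of a block exceeds all earlier letters: going backwards, the first exception
    would exceed its two successors, giving c b a or c a b. *)
Lemma no_cab_high :
  (forall k : nat, (0 < k)%N -> (k.+2 <= n)%N -> ~~ (g k.+1 < g k.+2 < g k)) ->
  high_order descent_block p.
Proof.
move=> no_cab.
have key (j d k : nat) : (j <= n)%N -> ~~ descent_at (j%:Z - 1) -> (0 < k)%N -> (k + d.+1 = j)%N ->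
    g k < g j.
  move=> jn dj; have [m] := ubnP d; elim: m d k => // m IH d k dm k0 kd.
  case: (eqVneq d 0%N) => [E|d0].
    have : g k != g j by rewrite (inj_eq letter_inj); lia.
    move: dj; rewrite /descent_at subrK; have -> : j%:Z - 1 = k by lia.
    by lia.
  have H1 : g k.+1 < g j by apply: (IH d.-1); lia.
  have H2 : g k.+2 <= g j.
    case: (eqVneq d 1%N) => [E|d1]; first by have -> : k.+2 = j by lia.
    by apply/ltW/(IH d.-2); lia.
  have := @no_cab k ltac:(lia) ltac:(lia); have := @no_cba k ltac:(lia) ltac:(lia).
  have : g k.+2 != g k by rewrite (inj_eq letter_inj); lia.
  have : g k.+2 != g k.+1 by rewrite (inj_eq letter_inj); lia.
  by lia.
move=> a b a' b' Cab Cab' lt; have d := descent_block_high Cab'.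
have U := descent_block_uniq Cab Cab'.
(* The order is given at the minima but needed at the maxima; distinct blocks occupy disjoint
   intervals, so the two agree. *)
have ltb : p b < p b'.
  have ne : p b <> p b'.
    move=> /position_inj E; have [Ea _] := U (or_intror (or_intror (or_intror E))).
    by move: lt; rewrite Ea ltxx.
  case: (descent_blockP Cab) => _ _ [[E _]|[E _ _]];
    case: (descent_blockP Cab') => _ _ [[E' _]|[E' _ _]]; subst; lia.
case: (descent_blockP Cab) => _ pb _; case: (descent_blockP Cab') => _ pb' _.
rewrite -[b]pK -[b']pK; case: (p b) (p b') pb pb' ltb d => // j [] // k jb kb ltb d.
by apply: (key _ (k - j).-1) => //; lia.
Qed.

End PatternForm.
End Patterns.

(** * Words from blocks *)

Lemma onelineE n (u : W n) : oneline u = [seq ext u k.+1 | k <- iota 0 n].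
Proof.
rewrite /oneline -val_enum_ord -map_comp; apply: eq_map => i /=.
by rewrite actZ.
Qed.

Lemma size_oneline n (u : W n) : size (oneline u) = n.
Proof. by rewrite onelineE size_map size_iota. Qed.

Lemma nth_oneline n (u : W n) k : (k < n)%N -> nth 0 (oneline u) k = ext u k.+1.
Proof. by move=> kn; rewrite onelineE (nth_map 0%N) ?size_iota // nth_iota. Qed.

Lemma mem_oneline n (u : W n) x : (x \in oneline u) = (0 < ext u^-1%g x <= n).
Proof.
rewrite onelineE; apply/mapP/idP => [[k]|px].
  by rewrite mem_iota => kn ->; rewrite extK; lia.
exists (`|ext u^-1%g x|.-1)%N; first by rewrite mem_iota; lia.
have E : (`|ext u^-1%g x|.-1.+1)%:Z = ext u^-1%g x by lia.
by rewrite E extVK.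
Qed.

Lemma word_of_blocks n (L : seq (pm n * pm n)) (x : int) :
  (x \in word_ba L) = has (fun q => (x == toZ q.1) || (x == toZ q.2)) L.
Proof.
rewrite /word_ba /first_occurrences mem_rev mem_undup mem_rev.
elim: L => //= q L IH; rewrite !inE IH.
by rewrite orbA; congr (_ || _); rewrite orbC.
Qed.

Section BlockWord.

Variables (n : nat) (C : rel int) (L : seq (pm n * pm n)).
Hypothesis LC : forall q, q \in L -> C (toZ q.1) (toZ q.2).
Hypothesis CL : forall a b, C a b -> exists2 q, q \in L & a = toZ q.1 /\ b = toZ q.2.

(* Both words are sorted by position in [u], and positions are injective. *)
Lemma word_ba_oneline (u : W n) : form n C (ext u^-1%g) ->
    pairwise (fun q q' => ext u^-1%g (toZ q.1) < ext u^-1%g (toZ q'.1)) L ->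
  word_ba L = oneline u.
Proof.
set p := ext u^-1%g => C_form sL; pose le x y := p x <= p y.
have le_trans : transitive le by move=> y x z'; exact: Order.POrderTheory.le_trans.
have le_anti : antisymmetric le.
  by move=> x y /le_anti /(@ext_inj _ _).
apply: (sorted_eq le_trans le_anti).
- rewrite /word_ba /first_occurrences rev_sorted.
  apply: (subseq_sorted _ (undup_subseq _)); first by move=> y x z' /[swap]; exact: le_trans.
  rewrite rev_sorted sorted_pairwise; last first.
    by move=> y x z'; exact: le_trans.
  elim: L LC sL => //= q L' IH LC' /andP[qL sL'].
  rewrite IH ?andbT; last by []; last first.
    by move=> q' q'L; apply: LC'; rewrite inE q'L orbT.
  have Cq : C (toZ q.1) (toZ q.2) by apply: LC'; rewrite mem_head.
  have A := form_adj C_form Cq.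
  have qa : p (toZ q.2) <= p (toZ q.1) by case: A => [->|]; lia.
  have H y : y \in flatten [seq [:: toZ q0.2; toZ q0.1] | q0 <- L'] -> p (toZ q.1) <= p y.
    case/flattenP=> s /mapP[q' q'L ->] ys.
    have lt := allP qL _ q'L.
    have Cq' : C (toZ q'.1) (toZ q'.2) by apply: LC'; rewrite inE q'L orbT.
    have A' := form_adj C_form Cq'.
    move: ys; rewrite !inE => /orP[]/eqP->; last exact: ltW.
    by case: A' => [<-|A']; [exact: ltW | rewrite -ltzD1 -A'].
  rewrite {1}/le qa /=; apply/andP; split; apply/allP => y /H; rewrite /le //.
  exact: Order.POrderTheory.le_trans.
- rewrite onelineE sorted_map; apply: sub_sorted (iota_sorted 0 n).
  by move=> x y xy; rewrite /= /le /p !extK; lia.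
apply: uniq_perm.
- by rewrite rev_uniq undup_uniq.
- by rewrite onelineE map_inj_uniq ?iota_uniq // => x y /(@ext_inj _ _); lia.
move=> x; rewrite mem_oneline word_of_blocks -/p; apply/hasP/idP => [[q qL]|px].
  by have [p1 p2] := form_pos C_form (LC qL); case/orP=> /eqP ->.
have [a [b [Cab E]]] := form_cover C_form px.
have [q qL [Ea Eb]] := CL Cab; exists q => //.
by rewrite -Ea -Eb; case: E => ->; rewrite eqxx ?orbT.
Qed.

End BlockWord.

(** * Signed permutations with a prescribed word *)

Section WordPerm.

Variables (n : nat) (r : seq int).
Hypothesis r_size : size r = n.
Hypothesis r_uniq : uniq [seq absz x | x <- r].
Hypothesis r_range : forall x, x \in r -> 0 < `|x| <= n.

(** The default [x] is never taken, since all letters of [r] lie in [±n]. *)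
Definition word_fun (x : pm n) : pm n :=
  let y := odflt x (of_int n (nth 0 r x.2)) in if x.1 then neg y else y.

Lemma toZ_word_fun x : toZ (word_fun x) = (if x.1 then - nth 0 r x.2 else nth 0 r x.2).
Proof.
have rx : 0 < `|nth 0 r x.2| <= n by apply: r_range; rewrite mem_nth // r_size.
have [y Ey] := toZ_surj rx.
by rewrite /word_fun Ey of_int_toZ /=; case: x.1 => //; rewrite toZ_neg.
Qed.

Lemma word_fun_inj : injective word_fun.
Proof.
move=> x y E; have := congr1 (@toZ n) E; rewrite !toZ_word_fun => {}E.
have xr : (x.2 < size r)%N by rewrite r_size.
have yr : (y.2 < size r)%N by rewrite r_size.
have rx : 0 < `|nth 0 r x.2| <= n by apply: r_range; rewrite mem_nth.
have E2 : x.2 = y.2.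
  apply: val_inj; apply/eqP.
  rewrite -(nth_uniq 0%N _ _ r_uniq) ?size_map // !(nth_map 0) //.
  have H (b c : bool) (A B : int) : (if b then - A else A) = (if c then - B else B) ->
      absz A = absz B by case: b c => [] []; lia.
  exact/eqP/(H _ _ _ _ E).
move: E rx; rewrite E2; case: x y E2 {xr yr} => [b i] [c j] /= -> .
by case: b c => [] [] //; lia.
Qed.

Lemma word_perm_signed : perm word_fun_inj \in signed_perms n.
Proof.
apply/signed_permsP=> x; rewrite !permE; apply: toZ_inj.
by rewrite toZ_neg !toZ_word_fun /=; case: x.1 => //=; rewrite opprK.
Qed.

Lemma word_perm : exists u : W n, oneline u = r.
Proof.
exists (Subg word_perm_signed); apply: (@eq_from_nth _ 0); first by rewrite size_oneline.
move=> k; rewrite size_oneline => kn; rewrite nth_oneline //.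
have -> : k.+1%:Z = toZ (pos (Ordinal kn)) by [].
by rewrite -actZ /act /= permE toZ_word_fun.
Qed.

End WordPerm.

Section BlockPerm.

Variables (n : nat) (C : rel int) (L : seq (pm n * pm n)) (key : pm n * pm n -> int).
Hypothesis LC : forall q, q \in L -> C (toZ q.1) (toZ q.2).
Hypothesis CL : forall a b, C a b -> exists2 q, q \in L & a = toZ q.1 /\ b = toZ q.2.
Hypothesis L_uniq : uniq L.
Hypothesis L_sorted : pairwise (fun q q' => key q < key q') L.
Hypothesis C_le : forall a b, C a b -> a <= b.
Hypothesis C_abs : forall a b, C a b -> `|a| = `|b| -> a = b.
Hypothesis C_disj : forall a b a' b', C a b -> C a' b' ->
  (`|a| = `|a'| \/ `|a| = `|b'| \/ `|b| = `|a'| \/ `|b| = `|b'|) -> a = a' /\ b = b'.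
Hypothesis C_cover : forall k : nat, (0 < k <= n)%N ->
  exists a b, C a b /\ (`|a| = k \/ `|b| = k).

(** Singleton blocks are written once from the start, so that positions are sums of block sizes;
    agreement with the deduplicated [word_ba] is left to [word_ba_oneline]. *)
Definition block_letters (q : pm n * pm n) : seq int :=
  if q.1 == q.2 then [:: toZ q.1] else [:: toZ q.2; toZ q.1].

Definition block_word (s : seq (pm n * pm n)) : seq int := flatten (map block_letters s).

Lemma mem_block_letters q x : (x \in block_letters q) = (x == toZ q.1) || (x == toZ q.2).
Proof.
by rewrite /block_letters; case: eqP => [->|_]; rewrite !inE ?orbb // orbC.
Qed.

Lemma mem_block_word s x :
  (x \in block_word s) = has (fun q => (x == toZ q.1) || (x == toZ q.2)) s.
Proof.
by elim: s => //= q s IH; rewrite mem_cat mem_block_letters IH.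
Qed.

Lemma block_word_uniq s : {subset s <= L} -> uniq s ->
  uniq [seq absz x | x <- block_word s].
Proof.
elim: s => //= q s IH sub /andP[qs s_uniq].
have qL : q \in L by apply: sub; rewrite mem_head.
rewrite map_cat cat_uniq IH // ?andbT; last by move=> x xs; apply: sub; rewrite inE xs orbT.
apply/andP; split.
  rewrite /block_letters; case: eqP => //= ne; rewrite inE andbT.
  apply/negP => /eqP E; apply: ne; apply: toZ_inj; apply: C_abs (LC qL) _.
  by rewrite -!abszE E.
apply/hasPn => _ /mapP[x + ->]; rewrite mem_block_word => /hasP[q' q's E'].
apply/negP => /mapP[y]; rewrite mem_block_letters => E xy.
have q'L : q' \in L by apply: sub; rewrite inE q's orbT.
have [] := C_disj (LC qL) (LC q'L).
  by case/orP: E' => /eqP E'; case/orP: E => /eqP E; rewrite -E -E'; lia.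
move=> /(@toZ_inj n) E1 /(@toZ_inj n) E2; move: qs.
have -> : q = q' by rewrite [q]surjective_pairing E1 E2 -surjective_pairing.
by rewrite q's.
Qed.

Lemma block_word_size : size (block_word L) = n.
Proof.
rewrite -(size_map absz) -[RHS](size_iota 1); apply: perm_size.
apply: uniq_perm; rewrite ?iota_uniq ?block_word_uniq //.
move=> k; rewrite mem_iota; apply/mapP/idP => [[x + ->]|kn].
  rewrite mem_block_word => /hasP[q _ /orP[]/eqP ->].
    by have := toZ_range q.1; move: (toZ q.1) => t; lia.
  by have := toZ_range q.2; move: (toZ q.2) => t; lia.
have [|a [b [Cab E]]] := C_cover (k := k); first by lia.
have [q qL [Ea Eb]] := CL Cab.
case: E => E; [exists (toZ q.1) | exists (toZ q.2)];
  rewrite ?mem_block_word -?Ea -?Eb; try lia.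
  by apply/hasP; exists q => //; rewrite Ea eqxx.
by apply/hasP; exists q => //; rewrite Eb eqxx orbT.
Qed.

(** The separation condition is a hypothesis of the second part because it is to be derived from the
    first: positions follow the key, and the key is compared with the letters only later. *)
Lemma block_perm : exists u : W n,
  (forall q q', q \in L -> q' \in L ->
     ext u^-1%g (toZ q.1) < ext u^-1%g (toZ q'.1) -> key q < key q')
  /\ ((forall a b a' b', C a b -> C a' b' -> ext u^-1%g a < ext u^-1%g a' -> a < a' \/ b < b') ->
      form n C (ext u^-1%g)).
Proof.
have [u Eu] : exists u : W n, oneline u = block_word L.
  apply: word_perm; first exact: block_word_size.
    exact: block_word_uniq.
  move=> x; rewrite mem_block_word => /hasP[q _ /orP[]/eqP ->]; exact: toZ_range.
exists u; set p := ext u^-1%g.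
have pE k : (k < n)%N -> p (nth 0 (block_word L) k) = k.+1.
  by move=> kn; rewrite -Eu nth_oneline // /p extK.
have pos_split L1 q L2 : L = L1 ++ q :: L2 ->
    p (toZ q.2) = (size (block_word L1)).+1
    /\ p (toZ q.1) = (size (block_word L1) + size (block_letters q))%N.
  move=> E; have Ew : block_word L = block_word L1 ++ block_letters q ++ block_word L2.
    by rewrite E /block_word map_cat flatten_cat.
  have sz := block_word_size; rewrite Ew !size_cat in sz.
  move: pE; rewrite Ew => pE.
  have nthE (s : seq int) j : nth 0 (block_word L1 ++ s) (size (block_word L1) + j) = nth 0 s j.
    by rewrite nth_cat ltnNge leq_addr addKn.
  have := pE (size (block_word L1) + 0)%N; rewrite nthE addn0.
  have := pE (size (block_word L1) + 1)%N; rewrite nthE addn1.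
  move: sz; rewrite /block_letters; case: eqP => [->|ne] /= sz p1 p0.
    by rewrite p0; [split=> //|]; lia.
  by rewrite p0 ?p1; [split=> //| |]; lia.
(* Cut the list at q'. If q lies before it, sortedness applies; if q lies after it, its position is
   larger. *)
have order q q' : q \in L -> q' \in L -> p (toZ q.1) < p (toZ q'.1) -> key q < key q'.
  move=> qL /splitPr Es; case: Es qL L_sorted pos_split => L1 L2 qL sL ps lt.
  move: qL sL; rewrite mem_cat inE pairwise_cat => qL /and3P[/allrelP al _ _].
  case/or3P: qL => [qL|/eqP Eq|/splitPr Es].
  - by apply: al; rewrite ?mem_head.
  - by move: lt; rewrite Eq ltxx.
  case: Es ps => L3 L4 ps.
  have [_ E1] := ps _ _ _ (erefl _).
  have E : L1 ++ q' :: L3 ++ q :: L4 = (L1 ++ q' :: L3) ++ q :: L4 by rewrite -catA.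
  have [_] := ps _ _ _ E; rewrite /block_word map_cat flatten_cat /= !size_cat => E2.
  by move: lt; rewrite E1 E2 /block_word ltz_nat -addnA ltn_add2l -addnA ltnNge leq_addr.
split=> // sep; split=> //.
- move=> a b /CL[q qL [-> ->]].
  have memp x : x \in block_word L -> 0 < p x <= n by rewrite -Eu mem_oneline.
  by split; apply: memp; rewrite mem_block_word; apply/hasP; exists q; rewrite ?eqxx ?orbT.
- move=> a b /CL[q /splitPr Es [-> ->]]; case: Es pos_split => L1 L2 ps.
  have [E2 E1] := ps _ _ _ (erefl _).
  move: E1; rewrite E2 /block_letters; case: eqP => [->|_] /= E1; first by left.
  by right; rewrite E1; lia.
- move=> x; rewrite -mem_oneline Eu mem_block_word => /hasP[q qL E].
  exists (toZ q.1), (toZ q.2); split; first exact: LC.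
  by case/orP: E => /eqP; [left | right].
by move=> a b a' b' Cab Cab' E; apply: C_disj => //; case: E => [|[|[|]]] ->; auto.
Qed.

End BlockPerm.

(** * Noncrossing matchings *)

(* [CycB z M] in terms of integers, [R x y] meaning [{x, y} \in M]. *)
Definition cyc (n : nat) (z : int -> int) (R : int -> int -> Prop) (a b : int) : Prop :=
  (`|a| < b /\ z a = b) \/ (0 < b < - a /\ R b (- a))
  \/ (a = b /\ a < 0 /\ R a (- a)) \/ (a = b /\ 0 < a <= n /\ z a = a).

Section Cyc.

Variables (n : nat) (z : int -> int) (R : int -> int -> Prop).
Hypothesis zN : {morph z : x / - x}.
Hypothesis zK : involutive z.
Hypothesis z_range : forall x, (0 < `|z x| <= n) = (0 < `|x| <= n).
Hypothesis z_out : forall x : int, ~~ (0 < `|x| <= n) -> z x = x.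
Hypothesis R_neg : forall x y : int, R x y -> [/\ x <> y, z x = - x & 0 < `|x| <= n].
Hypothesis R_sym : forall x y, R x y -> R y x.
Hypothesis R_ex : forall x : int, 0 < `|x| <= n -> z x = - x -> exists y, R x y.
Hypothesis R_fun : forall x y y', R x y -> R x y' -> y = y'.
Hypothesis R_opp : forall x y, R x y -> R (- x) (- y).
Hypothesis R_nc : forall i j k l : int, i < j -> j < k -> k < l -> R i k -> R j l -> False.

Local Notation C := (cyc n z R).

(** A block joining letters of opposite signs would cross its mirror image unless it is its own
    mirror image. *)
Lemma mate_sign x y : R x y -> 0 < x -> y < 0 -> y = - x.
Proof.
move=> Rxy x0 y0; have Rxy' := R_opp Rxy.
have Ryx := R_sym Rxy; have Ryx' := R_sym Rxy'.
case: (ltgtP (- y) x) => [lt|lt|]; last by lia.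
- by have := R_nc (i := - x) (j := y) (k := - y) (l := x); elim; rewrite ?opprK //; lia.
- by have := R_nc (i := y) (j := - x) (k := x) (l := - y); elim; rewrite ?opprK //; lia.
Qed.

Lemma cyc_le a b : C a b -> a <= b.
Proof. by case=> [|[|[|]]]; lia. Qed.

Lemma cyc_abs a b : C a b -> `|a| = `|b| -> a = b.
Proof. by case=> [|[|[|]]]; lia. Qed.

Lemma cyc_range a b : C a b -> 0 < `|a| <= n /\ 0 < `|b| <= n.
Proof.
case=> [[lt E]|[[lt Rba]|[[<- [_ /R_neg[_ _ H]]]|[<- [H _]]]]].
- case: (boolP (0 < `|a| <= n)) => [Ha|/z_out Ha]; last by lia.
  by split=> //; rewrite -E z_range.
- have [_ _ H1] := R_neg Rba; have [_ _ H2] := R_neg (R_sym Rba).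
  by split=> //; rewrite -normrN.
- by split.
by split; lia.
Qed.

Lemma cyc_valid a b : C a b -> b < 0 -> a = b.
Proof. by case=> [|[|[|]]]; lia. Qed.

Lemma cyc_noncrossing a b a' b' : C a b -> 0 < b < - a -> C a' b' ->
  ~ (a' = b' /\ b < - a' < - a) /\ ~ (0 < b' /\ b < b' < - a /\ - a < - a').
Proof.
move=> Cab ab; have {Cab} Rba : R b (- a) by case: Cab => [H|[[_ //]|[H|H]]]; exfalso; lia.
case=> [H|[[h Rba']|[[h [_ Raa']]|H]]]; try by lia.
- split; first by case=> E; have [] := R_neg Rba'; lia.
  by move=> [_ [/andP[h1 h2] h3]]; exact: (R_nc h1 h2 h3 Rba Rba').
split; last by lia.
move=> [_ /andP[h1 h2]].
have h0 : a' < b by lia.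
exact: (R_nc h0 h1 h2 Raa' Rba).
Qed.

Lemma cyc_matches a b : C a b ->
  (- b < a -> z a = b) /\ (b < - a -> z a = - a /\ z b = - b).
Proof.
case=> [[lt E]|[[lt Rba]|[[<- [lt Raa]]|[<- [lt E]]]]].
- by split=> // H; lia.
- split=> H; first by lia.
  have [_ -> _] := R_neg Rba; have [_ + _] := R_neg (R_sym Rba).
  by rewrite zN; lia.
- split=> H; first by lia.
  by have [_ -> _] := R_neg Raa.
by split=> // H; lia.
Qed.

Lemma cyc_cover (k : nat) : (0 < k <= n)%N -> exists a b, C a b /\ (`|a| = k \/ `|b| = k).
Proof.
move=> kn; have kr : 0 < `|k%:Z| <= n by lia.
have zkr : 0 < `|z k| <= n by rewrite z_range.
case: (z k =P k) => [E|ne].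
  by exists k, k; split; [right; right; right; lia | lia].
case: (z k =P - k%:Z) => [E|neN].
  have [y Rky] := R_ex kr E; have [ky _ _] := R_neg Rky.
  have [_ _ yr] := R_neg (R_sym Rky).
  case: (ltP y 0) => y0.
    have {}y0 : y = - k%:Z by apply: mate_sign Rky _ y0; lia.
    rewrite y0 in Rky.
    exists (- k%:Z), (- k%:Z); split; last by lia.
    right; right; left; split=> //; split; first by lia.
    by rewrite opprK; exact: R_sym.
  case: (ltP y k) => yk.
    exists (- k%:Z), y; split; last by lia.
    by right; left; rewrite opprK; split; [lia | exact: R_sym].
  exists (- y), k; split; last by lia.
  by right; left; rewrite opprK; split; [lia |].
case: (ltP `|z k| k) => lt.
  by exists (z k), k; split; [left; rewrite zK | right; lia].
case: (ltP 0 (z k)) => z0.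
  by exists k, (z k); split; [left; split=> //; lia | left; lia].
exists (- k%:Z), (- z k); split; last by lia.
by left; rewrite zN; split=> //; lia.
Qed.

Lemma cyc_det (k : nat) a b : C a b -> `|a| = k \/ `|b| = k ->
  (`|z k| < k /\ a = z k /\ b = k)
  \/ (k%:Z < `|z k| /\ ((0 < z k /\ a = k /\ b = z k) \/ (z k < 0 /\ a = - k%:Z /\ b = - z k)))
  \/ (z k = k /\ a = k /\ b = k)
  \/ (z k = - k%:Z /\ R k (- k%:Z) /\ a = - k%:Z /\ b = - k%:Z)
  \/ (exists y, [/\ z k = - k%:Z, R k y, 0 < y
       & (y < k%:Z /\ a = - k%:Z /\ b = y) \/ (k%:Z < y /\ a = - y /\ b = k)]).
Proof.
move=> Cab Ek; have [ar br] := cyc_range Cab; have zNk := zN k.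
case: Cab => [[lt E]|[[lt Rba]|[[ab [a0 Raa]]|[ab [a0 E]]]]].
- case: (b =P k) => [bk|bk].
    by left; rewrite -bk -E zK; lia.
  right; left; have [ak|ak] : a = k \/ a = - k%:Z by lia.
    by rewrite -ak E; lia.
  have Ez : z k = - b by rewrite -E ak zN opprK.
  by rewrite Ez; lia.
- right; right; right; right; have [_ zb _] := R_neg Rba.
  have [_ za _] := R_neg (R_sym Rba).
  have [Ea|Eb] : - a = k \/ b = k by lia.
    by exists b; rewrite -Ea; split=> //; [exact: R_sym | lia | left; lia].
  by exists (- a); rewrite -Eb; split=> //; [lia | right; lia].
- right; right; right; left; have Ea : a = - k%:Z by lia.
  move: (R_opp Raa); rewrite opprK Ea opprK => RkN.
  by have [_ zk _] := R_neg RkN; split=> //; split=> //; lia.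
right; right; left; have Ea : a = k by lia.
by move: E; rewrite Ea; lia.
Qed.

Lemma cyc_disj a b a' b' : C a b -> C a' b' ->
  (`|a| = `|a'| \/ `|a| = `|b'| \/ `|b| = `|a'| \/ `|b| = `|b'|) -> a = a' /\ b = b'.
Proof.
move=> Cab Cab' E.
have [k [Ek Ek']] : exists k : nat, (`|a| = k \/ `|b| = k) /\ (`|a'| = k \/ `|b'| = k).
  by case: E => [|[|[|]]] E; [exists (absz a)|exists (absz a)|exists (absz b)|exists (absz b)]; lia.
have [ar br] := cyc_range Cab.
have := cyc_det Cab Ek; have := cyc_det Cab' Ek'.
case=> [H|[H|[H|[[z1 [R1 H]]|[y [z1 R1 y0 H]]]]]];
  case=> [H'|[H'|[H'|[[z1' [R1' H']]|[y' [z1' R1' y0' H']]]]]]; try by lia.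
- by have := R_fun R1 R1'; lia.
- by have := R_fun R1 R1'; lia.
by have E1 := R_fun R1 R1'; subst; lia.
Qed.

End Cyc.

(** * The matching read off from valid blocks *)

Section Mate.

Variables (n : nat) (C : rel int) (p z : int -> int).
Hypothesis pN : {morph p : x / - x}.
Hypothesis C_form : form n C p.
Hypothesis p_range : forall x, (0 < `|p x| <= n) = (0 < `|x| <= n).
Hypothesis zN : {morph z : x / - x}.
Hypothesis zK : involutive z.
Hypothesis z_out : forall x : int, ~~ (0 < `|x| <= n) -> z x = x.
Hypothesis C_valid : valid C.
Hypothesis C_z : matches C z.

(* The matching encoded by a valid [C], as a relation on integers. *)
Definition mate : rel int := fun x y =>
  [|| (x == - y) && C (- `|x|) (- `|x|),
      [&& (0 < x) == (0 < y), `|x| < `|y| & C (- `|y|) `|x|]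
    | [&& (0 < x) == (0 < y), `|y| < `|x| & C (- `|x|) `|y|]].

Lemma mateP x y : reflect
  ((x = - y /\ C (- `|x|) (- `|x|))
   \/ ((0 < x) = (0 < y) /\ `|x| < `|y| /\ C (- `|y|) `|x|)
   \/ ((0 < x) = (0 < y) /\ `|y| < `|x| /\ C (- `|x|) `|y|)) (mate x y).
Proof.
apply: (iffP or3P) => [[/andP[/eqP]|/and3P[/eqP]|/and3P[/eqP]]|[[-> H]|[[-> [h H]]|[-> [h H]]]]].
- by left.
- by right; left.
- by right; right.
- by constructor 1; rewrite eqxx.
- by constructor 2; rewrite eqxx h.
- by constructor 3; rewrite eqxx h.
Qed.

Lemma block_range a b : C a b -> 0 < `|a| <= n /\ 0 < `|b| <= n.
Proof.
by move=> Cab; have [pa pb] := form_pos C_form Cab; rewrite -(p_range a) -(p_range b); lia.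
Qed.

Lemma mate_sym x y : mate x y -> mate y x.
Proof.
case/mateP=> [[E H]|[[E H]|[E H]]]; apply/mateP.
- by left; split; [lia | move: H; rewrite E normrN].
- by right; right; rewrite E.
- by right; left; rewrite E.
Qed.

Lemma mate_neg x y : mate x y -> [/\ x <> y, z x = - x & 0 < `|x| <= n].
Proof.
have zabs t : z `|t| = - `|t| -> z t = - t.
  by case: (ger0P t) => _; rewrite ?zN // => /oppr_inj.
case/mateP=> [[E H]|[[E [lt H]]|[E [lt H]]]]; have [r1 r2] := block_range H;
  have [_ M] := C_z H.
- have [+ _] := M ltac:(lia); rewrite zN => /oppr_inj/zabs zx.
  by split=> //; lia.
- have [_ /zabs zx] := M ltac:(lia).
  by split=> //; lia.
- have [+ _] := M ltac:(lia); rewrite zN => /oppr_inj/zabs zx.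
  by split=> //; lia.
Qed.

Lemma mate_opp x y : mate x y -> mate (- x) (- y).
Proof.
move=> H; have [ne _ xr] := mate_neg H; have [_ _ yr] := mate_neg (mate_sym H).
case/mateP: H => [[E H]|[[E H]|[E H]]]; apply/mateP; rewrite !normrN.
- by left; split=> //; lia.
- by right; left; split=> //; lia.
- by right; right; split=> //; lia.
Qed.

Lemma mate_ex_nat (k : nat) : (0 < k <= n)%N -> z k = - k%:Z -> exists y, mate k y.
Proof.
move=> kn zk; have [a [b [Cab T]]] := letter_type pN C_form p_range zN zK C_valid C_z kn.
case: T => [T|[T|[[E1 [E2 _]]|[[E1 [E2 _]]|[T|[E1 [E2 _]]]]]]]; try lia.
- exists (- a); apply/mateP; right; left; split; first by lia.
  split; first by lia.
  have -> : - `|- a| = a by lia.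
  by have -> : `|k%:Z| = b by lia.
- exists (- k%:Z); apply/mateP; left; split; first by lia.
  have -> : - `|k%:Z| = - k%:Z by lia.
  by move: Cab; rewrite E1 E2.
- exists b; apply/mateP; right; right; split; first by lia.
  split; first by lia.
  have -> : - `|k%:Z| = a by lia.
  by have -> : `|b| = b by lia.
Qed.

Lemma mate_ex (x : int) : 0 < `|x| <= n -> z x = - x -> exists y, mate x y.
Proof.
case: (ger0P x) => x0 xr zx.
  have E : x = absz x by lia.
  by rewrite E; apply: mate_ex_nat; [lia | rewrite -E].
have E : x = - (absz x)%:Z by lia.
have zk : z (absz x) = - (absz x)%:Z by apply: oppr_inj; rewrite -zN -E.
have [|y H] := mate_ex_nat _ zk; first by lia.
by exists (- y); rewrite E; exact: mate_opp.
Qed.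

(** Two mates give two blocks that share a letter, hence coincide, or that contain opposite letters,
    which cannot both have positive positions. *)
Lemma mate_fun x y y' : mate x y -> mate x y' -> y = y'.
Proof.
move=> H H'; have [_ _ xr] := mate_neg H.
have [_ _ yr] := mate_neg (mate_sym H); have [_ _ yr'] := mate_neg (mate_sym H').
have pos1 a b (Cab : C a b) : 0 < p a by have := form_pos C_form Cab; lia.
have pos2 a b (Cab : C a b) : 0 < p b by have := form_pos C_form Cab; lia.
have no t : 0 < p t -> 0 < p (- t) -> False by rewrite pN; lia.
case/mateP: H => [[E H]|[[E [lt H]]|[E [lt H]]]];
  case/mateP: H' => [[E' H']|[[E' [lt' H']]|[E' [lt' H']]]];
  have U := form_uniq C_form H H'.
- by lia.
- by case: (no _ (pos2 _ _ H') (pos1 _ _ H)).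
- by have [_] := U (or_introl erefl); lia.
- by case: (no _ (pos2 _ _ H) (pos1 _ _ H')).
- by have [] := U (or_intror (or_intror (or_intror erefl))); lia.
- by case: (no _ (pos2 _ _ H) (pos1 _ _ H')).
- by have [_] := U (or_introl erefl); lia.
- by case: (no _ (pos2 _ _ H') (pos1 _ _ H)).
- by have [_] := U (or_introl erefl); lia.
Qed.

Lemma mate_nc (i j k l : int) : i < j -> j < k -> k < l -> mate i k -> mate j l -> False.
Proof.
move=> ij jk kl H H'.
have [_ _ ir] := mate_neg H; have [_ _ kr] := mate_neg (mate_sym H).
have [_ _ jr] := mate_neg H'; have [_ _ lr] := mate_neg (mate_sym H').
case/mateP: H => [[E H]|[[E [lt H]]|[E [lt H]]]];
  case/mateP: H' => [[E' H']|[[E' [lt' H']]|[E' [lt' H']]]];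
  have X h := C_valid.2 _ _ _ _ H h H'; have X' h := C_valid.2 _ _ _ _ H' h H; lia.
Qed.

(** The round trip from blocks to matching and back. Pairs with a + b > 0 are recovered from [z]
    through [letter_type], the others from the matching itself. *)
Lemma cyc_mate a b : cyc n z mate a b <-> C a b.
Proof.
split=> [|Cab].
- case=> [[lt E]|[[lt H]|[[<- [lt H]]|[<- [lt E]]]]].
  + have [br|/z_out zb] := boolP (0 < `|b| <= n); last first.
      by have := zK a; rewrite E zb; lia.
    have [k Ek] : exists k : nat, b = k by exists (absz b); lia.
    have [|a0 [b0 [Cab T]]] := letter_type pN C_form p_range zN zK C_valid C_z (k := k);
      first by lia.
    have za : z k = a by rewrite -Ek -E zK.
    have [Ea Eb] : a = a0 /\ k%:Z = b0 by lia.
    by rewrite Ek Ea Eb.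
  + case/mateP: H => [[E H]|[[E [lt' H]]|[E [lt' H]]]]; [lia| |lia].
    have -> : a = - `|- a| by lia.
    by have -> : b = `|b| by lia.
  + case/mateP: H => [[E H]|[[E [lt' H]]|[E [lt' H]]]]; [|lia|lia].
    by have -> : a = - `|a| by lia.
  have [k Ek] : exists k : nat, a = k by exists (absz a); lia.
  subst a.
  have [|a0 [b0 [Cab T]]] := letter_type pN C_form p_range zN zK C_valid C_z (k := k);
      first by lia.
  have [E1 E2] : a0 = k /\ b0 = k by lia.
  by rewrite E1 E2 in Cab.
have le := form_le C_form Cab; have [ar br] := block_range Cab.
have [M1 M2] := C_z Cab; have V := C_valid.1 _ _ Cab.
have ab := block_abs pN C_form Cab.
case: (ltgtP (- b) a) => [lt|lt|E]; last by lia.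
- case: (a =P b) => [E|ne]; last by left; split; [lia | exact: M1].
  by right; right; right; split=> //; split; [lia | rewrite M1].
case: (ltP b 0) => b0.
  right; right; left; split; first exact: V.
  split; first by lia.
  apply/mateP; left; rewrite opprK; split=> //.
  have E : - `|a| = a by lia.
  by rewrite E {2}(V b0).
right; left; split; first by lia.
apply/mateP; right; left; split; first by lia.
split; first by lia.
have -> : - `|- a| = a by lia.
by have -> : `|b| = b by lia.
Qed.

End Mate.

(** * Symmetric noncrossing matchings as relations on integers *)

Section Matching.

Variables (n : nat) (z : W n).
Implicit Types (M : {set {set pm n}}) (i j k : pm n).

Definition matched M (x y : int) : Prop :=
  exists i j, [/\ toZ i = x, toZ j = y & [set i; j] \in M].

Lemma matchedE M i j : matched M (toZ i) (toZ j) <-> [set i; j] \in M.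
Proof.
split=> [[i' [j' [/toZ_inj-> /toZ_inj-> //]]]|H].
by exists i, j.
Qed.

Lemma mem_Neg i : (i \in Neg z) = (0 < toZ i) && (ext z (toZ i) == - toZ i).
Proof. by rewrite inE act_eq toZ_neg. Qed.

Lemma mem_dom i :
  (i \in Neg z :|: [set neg i | i in Neg z]) = (ext z (toZ i) == - toZ i).
Proof.
rewrite inE mem_Neg; have := toZ_range i.
case: (ltP 0 (toZ i)) => [i0|i0] ir /=.
  apply/orb_idr => /imsetP[j]; rewrite mem_Neg => /andP[j0 _] Ei.
  by move: i0; rewrite Ei toZ_neg; lia.
apply/imsetP/eqP => [[j]|zi].
  by rewrite mem_Neg => /andP[_ /eqP zj] ->; rewrite toZ_neg extN zj.
exists (neg i); last by rewrite negK.
rewrite mem_Neg toZ_neg extN zi eqxx andbT.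
by move: ir i0; move: (toZ i) => t; lia.
Qed.

Section FromNCSP.

Variable M : {set {set pm n}}.
Hypothesis M_ncsp : NCSP z M.

Lemma matched_sym x y : matched M x y -> matched M y x.
Proof. by case=> i [j [<- <- H]]; exists j, i; rewrite setUC. Qed.

Lemma matched_neg (x y : int) : matched M x y -> [/\ x <> y, ext z x = - x & 0 < `|x| <= n].
Proof.
case: M_ncsp => /and3P[/eqP cov _ _] card2 _ _ [i [j [<- <- H]]]; split.
- by move/toZ_inj => ij; have := card2 _ H; rewrite ij setUid cards1.
- apply/eqP; rewrite -mem_dom -cov; apply/bigcupP.
  by exists [set i; j] => //; rewrite !inE eqxx.
exact: toZ_range.
Qed.

Lemma matched_ex (x : int) : 0 < `|x| <= n -> ext z x = - x -> exists y, matched M x y.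
Proof.
case: M_ncsp => /and3P[/eqP cov _ _] card2 _ _ /toZ_surj[i ->] /eqP.
rewrite -mem_dom -cov => /bigcupP[B BM iB].
have /eqP/cards2P[j [k [jk EB]]] := card2 _ BM.
move: iB; rewrite EB !inE => /orP[]/eqP ->.
  by exists (toZ k); apply/matchedE; rewrite -EB.
by exists (toZ j); apply/matchedE; rewrite setUC -EB.
Qed.

Lemma matched_fun x y y' : matched M x y -> matched M x y' -> y = y'.
Proof.
move=> H H'; have [xy _ _] := matched_neg H.
case: M_ncsp => /and3P[_ /trivIsetP triv _] _ _ _.
case: H xy H' => i [j [<- <- H]] ij [i' [j' [/(@toZ_inj n) Ei <- H']]].
rewrite Ei in H'; case: (eqVneq [set i; j] [set i; j']) => [E|ne].
  have : j \in [set i; j'] by rewrite -E !inE eqxx orbT.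
  by rewrite !inE => /orP[]/eqP E'; [case: ij; rewrite E' | rewrite E'].
have := triv _ _ H H' ne; rewrite -setI_eq0 => /eqP/setP/(_ i).
by rewrite !inE eqxx.
Qed.

Lemma matched_opp x y : matched M x y -> matched M (- x) (- y).
Proof.
case: M_ncsp => _ _ sym _ [i [j [<- <- H]]].
by rewrite -!toZ_neg; apply/matchedE; exact: sym.
Qed.

Lemma matched_nc (i j k l : int) : i < j -> j < k -> k < l ->
  matched M i k -> matched M j l -> False.
Proof.
case: M_ncsp => _ _ _ nc ij jk kl [i' [k' [Ei Ek H]]] [j' [l' [Ej El H']]].
by case: nc; exists i', j', k', l'; rewrite Ei Ej Ek El ij jk.
Qed.

Lemma mem_CycB q : q \in CycB z M <-> cyc n (ext z) (matched M) (toZ q.1) (toZ q.2).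
Proof.
rewrite /CycB /PairM /Pair !inE; split.
- case/orP=> [/orP[/orP[]|]|].
  + move=> /and3P[q2 lt]; rewrite act_eq => /eqP E.
    by left; split=> //; move: lt; rewrite actZ E.
  + case/imsetP=> -[a b]; rewrite inE /= => /andP[H lt] -> /=.
    right; left; rewrite toZ_neg opprK; split; first by move: lt; move: (toZ a) (toZ b); lia.
    exact/matchedE.
  + case/imsetP=> a; rewrite inE mem_Neg => /andP[/andP[a0 _] H] -> /=.
    right; right; left; rewrite toZ_neg opprK; split=> //; split.
      by move: a0; move: (toZ a); lia.
    by rewrite -toZ_neg; apply/matchedE; rewrite setUC.
  case/imsetP=> a; rewrite inE act_eq => /andP[a0 /eqP E] -> /=.
  right; right; right; split=> //; split=> //.
  by move: a0 (toZ_range a); move: (toZ a); lia.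
case=> [[lt E]|[[lt H]|[[E [lt H]]|[E [lt H]]]]].
- apply/orP; left; apply/orP; left; apply/orP; left.
  rewrite act_eq E eqxx actZ E lt !andbT.
  by move: lt; move: (toZ q.1) (toZ q.2); lia.
- apply/orP; left; apply/orP; left; apply/orP; right.
  apply/imsetP; exists (q.2, neg q.1); last by rewrite /= negK -surjective_pairing.
  rewrite inE /= toZ_neg lt andbT; apply/matchedE; by rewrite toZ_neg.
- have {}E : q.1 = q.2 by apply: toZ_inj.
  apply/orP; left; apply/orP; right.
  apply/imsetP; exists (neg q.1); last by rewrite /= negK {2}E -surjective_pairing.
  have [_ zq _] := matched_neg H.
  rewrite inE mem_Neg !toZ_neg extN zq eqxx andbT negK; apply/andP; split.
    by move: lt; move: (toZ q.1); lia.
  by rewrite setUC; apply/matchedE; rewrite toZ_neg.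
have {}E' : q.1 = q.2 by apply: toZ_inj.
apply/orP; right; apply/imsetP; exists q.1; last by rewrite {2}E' -surjective_pairing.
by rewrite inE act_eq H eqxx andbT; case/andP: lt.
Qed.

End FromNCSP.

Section ToNCSP.

Variable R : rel int.
Hypothesis R_neg : forall x y : int, R x y -> [/\ x <> y, ext z x = - x & 0 < `|x| <= n].
Hypothesis R_sym : forall x y, R x y -> R y x.
Hypothesis R_ex : forall x : int, 0 < `|x| <= n -> ext z x = - x -> exists y, R x y.
Hypothesis R_fun : forall x y y', R x y -> R x y' -> y = y'.
Hypothesis R_opp : forall x y, R x y -> R (- x) (- y).
Hypothesis R_nc : forall i j k l : int, i < j -> j < k -> k < l -> R i k -> R j l -> False.

Definition matching_of : {set {set pm n}} :=
  [set B | [exists i, exists j, (B == [set i; j]) && R (toZ i) (toZ j)]].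

Lemma matching_ofP B : reflect (exists i j, B = [set i; j] /\ R (toZ i) (toZ j))
  (B \in matching_of).
Proof.
rewrite inE; apply: (iffP existsP) => [[i /existsP[j /andP[/eqP E H]]]|[i [j [-> H]]]].
  by exists i, j.
by exists i; apply/existsP; exists j; rewrite eqxx.
Qed.

Lemma mem_matching_of i j : ([set i; j] \in matching_of) = R (toZ i) (toZ j).
Proof.
apply/matching_ofP/idP => [[i' [j' [E H]]]|H]; last by exists i, j.
have [ne _ _] := R_neg H.
have ne' : i' != j' by apply/eqP => E'; apply: ne; rewrite E'.
have /set2P Hi : i' \in [set i; j] by rewrite E !inE eqxx.
have /set2P Hj : j' \in [set i; j] by rewrite E !inE eqxx orbT.
case: Hi Hj ne' H => -> [] -> //; rewrite ?eqxx // => _; exact: R_sym.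
Qed.

Lemma matched_matching_of x y : matched matching_of x y <-> R x y.
Proof.
split=> [[i [j [<- <-]]]|H]; first by rewrite mem_matching_of.
have [_ _ /toZ_surj[i Ei]] := R_neg H.
have [_ _ /toZ_surj[j Ej]] := R_neg (R_sym H).
by exists i, j; rewrite mem_matching_of -Ei -Ej.
Qed.

Lemma matching_of_NCSP : NCSP z matching_of.
Proof.
split.
- apply/and3P; split.
  + apply/eqP/setP=> i; rewrite mem_dom; apply/bigcupP/eqP => [[B]|zi].
      case/matching_ofP=> j [k [-> H]] /set2P[] ->.
        by have [] := R_neg H.
      by have [] := R_neg (R_sym H).
    have [y H] := R_ex (toZ_range i) zi.
    have [_ _ /toZ_surj[j Ej]] := R_neg (R_sym H); rewrite Ej in H.
    by exists [set i; j]; rewrite ?mem_matching_of // !inE eqxx.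
  + apply/trivIsetP => A B; case/matching_ofP=> i [j [-> H]].
    case/matching_ofP=> k [l [-> H']] ne; rewrite -setI_eq0; apply/eqP/setP=> t.
    rewrite !inE; apply/negP => /andP[/orP tA /orP tB]; case/negP: ne; apply/eqP.
    have {tA} [s [Hs ->]] : exists s, R (toZ t) (toZ s) /\ [set i; j] = [set t; s].
      case: tA => /eqP->; first by exists j.
      by exists i; rewrite [RHS]setUC; split=> //; exact: R_sym.
    have {tB} [s' [Hs' ->]] : exists s, R (toZ t) (toZ s) /\ [set k; l] = [set t; s].
      case: tB => /eqP->; first by exists l.
      by exists k; rewrite [RHS]setUC; split=> //; exact: R_sym.
    by have /toZ_inj -> := R_fun Hs Hs'.
  apply/negP => /matching_ofP[i [j [/setP/(_ i)]]].
  by rewrite !inE eqxx.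
- move=> B /matching_ofP[i [j [-> H]]]; have [ne _ _] := R_neg H.
  by rewrite cards2; case: eqP => // E; case: ne; rewrite E.
- by move=> i j; rewrite !mem_matching_of !toZ_neg; exact: R_opp.
case=> i [j [k [l [/andP[ij jk] kl]]]]; rewrite !mem_matching_of.
exact: R_nc.
Qed.

End ToNCSP.

End Matching.

(** * Minimal and maximal atoms *)

Section Steps.

Variable n : nat.
Implicit Types (u w : W n) (s : seq int).

Lemma oneline_split w (k : nat) : (0 < k)%N -> (k.+2 <= n)%N ->
  oneline w = [seq ext w j.+1 | j <- iota 0 k.-1]
    ++ [:: ext w k; ext w k.+1; ext w k.+2]
    ++ [seq ext w j.+1 | j <- iota k.+2 (n - k.+2)].
Proof.
move=> k0 kn; rewrite onelineE.
have -> : iota 0 n = iota 0 (k.-1 + (3 + (n - k.+2))) by congr iota; lia.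
rewrite !iotaD !map_cat /=.
have [E1 E2] : (k.-1.+1 = k)%N /\ (0 + k.-1 + 3 = k.+2)%N by lia.
by rewrite E2 !add0n E1.
Qed.

Lemma ext_at w s t (x1 x2 x3 : int) : oneline w = s ++ [:: x1; x2; x3] ++ t ->
  [/\ ((size s).+3 <= n)%N, ext w (size s).+1 = x1,
      ext w (size s).+2 = x2 & ext w (size s).+3 = x3].
Proof.
move=> E; have sz : ((size s).+3 <= n)%N.
  by rewrite -(size_oneline w) E !size_cat /=; lia.
have nthE j : (j < 3)%N -> ext w (size s + j).+1 = nth 0 [:: x1; x2; x3] j.
  move=> j3; rewrite -nth_oneline; last by lia.
  by rewrite E nth_cat ltnNge leq_addr addKn nth_cat /= j3.
have := nthE 0%N isT; have := nthE 1%N isT; have := nthE 2%N isT.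
by rewrite !addnS !addn0.
Qed.

Lemma lt_A_last s t : lt_A s t -> exists s', step_A s' t.
Proof. by elim=> {s t} [s t H|s t t' _ _ _ //]; exists s. Qed.

Lemma lt_A_first s t : lt_A s t -> exists t', step_A s t'.
Proof. by elim=> {s t} [s t H|s t t' _ H _ _ //]; exists t. Qed.

Lemma no_bca_minimal u v :
  (forall k : nat, (0 < k)%N -> (k.+2 <= n)%N -> ~~ (ext u k.+2 < ext u k < ext u k.+1)) ->
  ~ lt_A v (oneline u).
Proof.
move=> no /lt_A_last[s' H]; move: H; move Et: (oneline u) => t H.
case: H Et => s t' a b c ab bc /ext_at[sz E1 E2 E3].
by have := no (size s).+1 isT sz; rewrite E1 E2 E3 ab bc.
Qed.

Lemma no_cab_maximal u v :
  (forall k : nat, (0 < k)%N -> (k.+2 <= n)%N -> ~~ (ext u k.+1 < ext u k.+2 < ext u k)) ->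
  ~ lt_A (oneline u) v.
Proof.
move=> no /lt_A_first[s' H]; move: H; move Et: (oneline u) => t H.
case: H Et => s t' a b c ab bc /ext_at[sz E1 E2 E3].
by have := no (size s).+1 isT sz; rewrite E1 E2 E3 ab bc.
Qed.

Lemma step_oneline w w' (k : nat) : (0 < k)%N -> (k.+2 <= n)%N ->
  ext w k.+2 < ext w k -> ext w k < ext w k.+1 ->
  (forall j : nat, j != k -> j != k.+1 -> j != k.+2 -> ext w' j = ext w j) ->
  ext w' k = ext w k.+1 -> ext w' k.+1 = ext w k.+2 -> ext w' k.+2 = ext w k ->
  lt_A (oneline w') (oneline w).
Proof.
move=> k0 kn ab bc out E1 E2 E3; apply: t_step.
rewrite !(oneline_split _ k0 kn) E1 E2 E3.
have -> : [seq ext w' j.+1 | j <- iota 0 k.-1] = [seq ext w j.+1 | j <- iota 0 k.-1].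
  by apply/eq_in_map => j; rewrite mem_iota => jk; apply: out; lia.
have -> : [seq ext w' j.+1 | j <- iota k.+2 (n - k.+2)]
        = [seq ext w j.+1 | j <- iota k.+2 (n - k.+2)].
  by apply/eq_in_map => j; rewrite mem_iota => jk; apply: out; lia.
exact: StepA.
Qed.

Section Extremal.

Variables (op : W n -> W n -> W n) (z : W n).
Hypothesis op_dem : is_demazure op.
Hypothesis zV : z^-1%g = z.

Lemma minimal_no_bca w : is_minimal (inv_atoms op z) (oneline w) -> is_inv_atom op w z ->
  forall k : nat, (0 < k)%N -> (k.+2 <= n)%N -> ~~ (ext w k.+2 < ext w k < ext w k.+1).
Proof.
move=> [_ min] w_atom k k0 kn; apply/negP => lt.
have ki : (k < n)%N by lia.
have [w' [a' out E1 E2 E3]] :=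
  @atom_bca_cab _ _ op_dem z w (Ordinal ki) (Ordinal kn) erefl k0 w_atom lt.
have /andP[ab bc] := lt.
by apply: (min w'); [apply/inv_atomsP | exact: (step_oneline k0 kn ab bc out)].
Qed.

Lemma maximal_no_cab w : is_maximal (inv_atoms op z) (oneline w) -> is_inv_atom op w z ->
  forall k : nat, (0 < k)%N -> (k.+2 <= n)%N -> ~~ (ext w k.+1 < ext w k.+2 < ext w k).
Proof.
move=> [_ max] w_atom k k0 kn; apply/negP => lt.
have ki : (k < n)%N by lia.
have [w' [a' out E1 E2 E3]] :=
  @atom_cab_bca _ _ op_dem z w (Ordinal ki) (Ordinal kn) erefl k0 w_atom lt.
rewrite /= in out E1 E2 E3; have /andP[ab bc] := lt.
apply: (max w'); first by apply/inv_atomsP.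
apply: (step_oneline k0 kn); rewrite ?E1 ?E2 ?E3 //.
by move=> j jk jk1 jk2; rewrite out.
Qed.

Lemma atom_no_double_descent w : is_inv_atom op w z ->
  forall k : nat, (0 < k)%N -> (k.+2 <= n)%N -> ~~ (ext w k.+2 < ext w k.+1 < ext w k).
Proof.
move=> w_atom k k0 kn; have ki : (k < n)%N by lia.
exact: (@atom_no_cba _ _ op_dem z w (Ordinal ki) (Ordinal kn) erefl k0 w_atom).
Qed.

End Extremal.
End Steps.

(** * The words 0_B and 1_B as one-line representations *)

Section BlockOrder.

Variables (n : nat) (z : W n) (M : {set {set pm n}}) (C : rel int).
Hypothesis CM : forall q, q \in CycB z M <-> C (toZ q.1) (toZ q.2).

Definition key_sort (key : pm n * pm n -> int) : seq (pm n * pm n) :=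
  sort (fun q q' => key q <= key q') (enum (CycB z M)).

Lemma mem_key_sort key q : (q \in key_sort key) = (q \in CycB z M).
Proof. by rewrite mem_sort mem_enum. Qed.

Lemma key_sort_uniq key : uniq (key_sort key).
Proof. by rewrite sort_uniq enum_uniq. Qed.

Lemma key_sort_pairwise key (r : rel (pm n * pm n)) :
  (forall q q', q \in CycB z M -> q' \in CycB z M -> q != q' -> key q <= key q' -> r q q') ->
  pairwise r (key_sort key).
Proof.
move=> H.
have : pairwise [rel q q' | (key q <= key q') && (q != q')] (key_sort key).
  rewrite pairwise_relI -uniq_pairwise key_sort_uniq andbT -sorted_pairwise.
    by apply: sort_sorted => q q'; exact: le_total.
  by move=> q q' q''; exact: le_trans.
apply: (sub_in_pairwise (P := mem (CycB z M))); last first.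
  by apply/allP => q; rewrite mem_key_sort.
by move=> q q' qM q'M /andP[le ne]; exact: H.
Qed.

Lemma CycB_pair_ex (a b : int) : (0 < `|a| <= n) -> (0 < `|b| <= n) -> C a b ->
  exists2 q, q \in CycB z M & a = toZ q.1 /\ b = toZ q.2.
Proof.
move=> /toZ_surj[i ->] /toZ_surj[j ->] H; exists (i, j) => //.
exact/(CM (i, j)).
Qed.

Lemma key_sort_oneline (u : W n) key : form n C (ext u^-1%g) ->
  (forall q q', q \in CycB z M -> q' \in CycB z M ->
     ext u^-1%g (toZ q.1) < ext u^-1%g (toZ q'.1) -> key q < key q') ->
  word_ba (key_sort key) = oneline u.
Proof.
move=> C_form order; apply: (word_ba_oneline (C := C)) => //.
- by move=> q; rewrite mem_key_sort => /CM.
- move=> a b Cab; have [pa pb] := form_pos C_form Cab.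
  have [||q qM E] := CycB_pair_ex _ _ Cab; last by exists q; rewrite ?mem_key_sort.
    by rewrite -(ext_range u^-1%g); lia.
  by rewrite -(ext_range u^-1%g); lia.
apply: key_sort_pairwise => q q' qM q'M ne le.
rewrite ltNge le_eqVlt; apply/negP => /orP[/eqP E|lt].
  case/eqP: ne; move/CM: qM => Cq; move/CM: q'M => Cq'.
  have [|/toZ_inj E1 /toZ_inj E2] := form_uniq C_form Cq Cq'.
    by left; apply: (@ext_inj _ u^-1%g).
  by rewrite [q]surjective_pairing E1 E2 -surjective_pairing.
by have := order _ _ q'M qM lt; rewrite ltNge le.
Qed.

Lemma zeroB_oneline (u : W n) : form n C (ext u^-1%g) -> low_order C (ext u^-1%g) ->
  zeroB z M = oneline u.
Proof.
move=> C_form low; apply: (key_sort_oneline (key := fun q => toZ q.1) C_form).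
by move=> q q' /CM Cq /CM Cq'; exact: low Cq Cq'.
Qed.

Lemma oneB_oneline (u : W n) : form n C (ext u^-1%g) -> high_order C (ext u^-1%g) ->
  oneB z M = oneline u.
Proof.
move=> C_form high; apply: (key_sort_oneline (key := fun q => toZ q.2) C_form).
by move=> q q' /CM Cq /CM Cq'; exact: high Cq Cq'.
Qed.

End BlockOrder.

Section FromMatching.

Variables (n : nat) (op : W n -> W n -> W n) (z : W n) (M : {set {set pm n}}).
Hypothesis op_dem : is_demazure op.
Hypothesis zV : z^-1%g = z.
Hypothesis M_ncsp : NCSP z M.

(** A boolean form of [cyc] for [matched M], which is a proposition; membership in the finite set
    [CycB z M] provides it. *)
Definition cyc_rel : rel int := fun a b =>
  [exists q in CycB z M, (toZ q.1 == a) && (toZ q.2 == b)].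

Let R := matched M.
Let zN := extN z.
Let zK := invol_ext zV.
Let z_range := ext_range z.
Let z_out := @ext_out n z.
Let R_neg := matched_neg M_ncsp.
Let R_sym := @matched_sym n M.
Let R_ex := matched_ex M_ncsp.
Let R_fun := matched_fun M_ncsp.
Let R_opp := matched_opp M_ncsp.
Let R_nc := matched_nc M_ncsp.

Lemma cyc_relP a b : cyc_rel a b <-> cyc n (ext z) R a b.
Proof.
split=> [/existsP[q /and3P[qM /eqP <- /eqP <-]]|H]; first exact/mem_CycB.
have [/toZ_surj[i Ei] /toZ_surj[j Ej]] := cyc_range z_range z_out R_neg R_sym H.
apply/existsP; exists (i, j); rewrite /= -Ei -Ej !eqxx !andbT.
by apply/mem_CycB => //=; rewrite -Ei -Ej.
Qed.

Lemma cyc_rel_CycB q : q \in CycB z M <-> cyc_rel (toZ q.1) (toZ q.2).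
Proof. by rewrite cyc_relP mem_CycB. Qed.

Lemma cyc_rel_ex a b : cyc_rel a b ->
  exists2 q, q \in CycB z M & a = toZ q.1 /\ b = toZ q.2.
Proof. by case/existsP=> q /and3P[qM /eqP <- /eqP <-]; exists q. Qed.

Lemma cyc_rel_disj a b a' b' : cyc_rel a b -> cyc_rel a' b' ->
  (`|a| = `|a'| \/ `|a| = `|b'| \/ `|b| = `|a'| \/ `|b| = `|b'|) -> a = a' /\ b = b'.
Proof.
move=> /cyc_relP H /cyc_relP H'.
exact: (cyc_disj zN zK z_range z_out R_neg R_sym R_fun R_opp H H').
Qed.

(** Common to both words, with the smaller letter of a block as key for 0_B and the larger one for
    1_B; either key refines the separation condition, so [form_atom] applies. *)
Lemma cyc_rel_perm (key : pm n * pm n -> int) :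
  (forall q q', q \in CycB z M -> q' \in CycB z M -> key q = key q' -> q = q') ->
  (forall q q', key q < key q' -> toZ q.1 < toZ q'.1 \/ toZ q.2 < toZ q'.2) ->
  exists u : W n, [/\ form n cyc_rel (ext u^-1%g), is_inv_atom op u z &
    forall q q', q \in CycB z M -> q' \in CycB z M ->
      ext u^-1%g (toZ q.1) < ext u^-1%g (toZ q'.1) -> key q < key q'].
Proof.
move=> key_inj key_sep.
have [] := @block_perm n cyc_rel (key_sort z M key) key.
- by move=> q; rewrite mem_key_sort => /cyc_rel_CycB.
- by move=> a b /cyc_rel_ex[q qM E]; exists q; rewrite ?mem_key_sort.
- exact: key_sort_uniq.
- apply: key_sort_pairwise => q q' qM q'M ne; rewrite le_eqVlt => /orP[/eqP E|//].
  by case/eqP: ne; exact: key_inj.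
- by move=> a b /cyc_relP H; exact: cyc_le H.
- by move=> a b /cyc_relP H; exact: cyc_abs H.
- exact: cyc_rel_disj.
- move=> k /(cyc_cover zN zK z_range R_neg R_sym R_ex R_opp R_nc)[a [b [H E]]].
  by exists a, b; split=> //; apply/cyc_relP.
move=> u [order mk_form]; exists u.
have order' q q' : q \in CycB z M -> q' \in CycB z M ->
    ext u^-1%g (toZ q.1) < ext u^-1%g (toZ q'.1) -> key q < key q'.
  by move=> qM q'M; apply: order; rewrite mem_key_sort.
have u_form : form n cyc_rel (ext u^-1%g).
  apply: mk_form => a b a' b' /cyc_rel_ex[q qM [-> ->]] /cyc_rel_ex[q' q'M [-> ->]] lt.
  exact/key_sep/order'.
split=> //; apply/(form_atom op_dem zV u_form); split; [split|].
- by move=> a b /cyc_relP H; exact: cyc_valid H.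
- move=> a b a' b' /cyc_relP H ab /cyc_relP H'.
  exact: (cyc_noncrossing R_neg R_nc H ab H').
move=> a b /cyc_relP H; exact: (cyc_matches zN R_neg R_sym H).
Qed.

Lemma zeroB_minimal : is_minimal (inv_atoms op z) (zeroB z M).
Proof.
have [||u [u_form u_atom order]] := @cyc_rel_perm (fun q => toZ q.1).
- move=> q q' /cyc_rel_CycB H /cyc_rel_CycB H' E.
  have [|/toZ_inj E1 /toZ_inj E2] := cyc_rel_disj H H'; first by rewrite E; left.
  by rewrite [q]surjective_pairing E1 E2 -surjective_pairing.
- by move=> q q' lt; left.
have low : low_order cyc_rel (ext u^-1%g).
  by move=> a b a' b' /cyc_rel_ex[q qM [-> _]] /cyc_rel_ex[q' q'M [-> _]]; exact: order.
rewrite (zeroB_oneline cyc_rel_CycB u_form low); split.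
  by exists u => //; apply/inv_atomsP.
move=> v _; apply: no_bca_minimal => k k0 kn.
exact: (low_no_bca (extK u) (extVK u) u_form low k0 kn).
Qed.

Lemma oneB_maximal : is_maximal (inv_atoms op z) (oneB z M).
Proof.
have [||u [u_form u_atom order]] := @cyc_rel_perm (fun q => toZ q.2).
- move=> q q' /cyc_rel_CycB H /cyc_rel_CycB H' E.
  have [|/toZ_inj E1 /toZ_inj E2] := cyc_rel_disj H H'; first by rewrite E; auto.
  by rewrite [q]surjective_pairing E1 E2 -surjective_pairing.
- by move=> q q' lt; right.
have high : high_order cyc_rel (ext u^-1%g).
  by move=> a b a' b' /cyc_rel_ex[q qM [-> ->]] /cyc_rel_ex[q' q'M [-> ->]]; exact: order.
rewrite (oneB_oneline cyc_rel_CycB u_form high); split.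
  by exists u => //; apply/inv_atomsP.
move=> v _; apply: no_cab_maximal => k k0 kn.
exact: (high_no_cab (extK u) (extVK u) u_form high k0 kn).
Qed.

End FromMatching.

Section ToMatching.

Variables (n : nat) (z w : W n) (C : rel int).
Hypothesis zV : z^-1%g = z.
Hypothesis C_form : form n C (ext w^-1%g).
Hypothesis C_valid : valid C.
Hypothesis C_z : matches C (ext z).

Let zN := extN z.
Let zK := invol_ext zV.
Let pN := extN w^-1%g.
Let pR := ext_range w^-1%g.

(** Every valid system of blocks matching [z] comes from a matching: [mate] has all properties
    required of one, and [cyc_mate] gives the blocks back. *)
Lemma form_matching : exists M, NCSP z M /\
  forall q, q \in CycB z M <-> C (toZ q.1) (toZ q.2).
Proof.
pose R := mate C.
have R_neg := mate_neg C_form pR zN C_z.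
have R_sym := @mate_sym C.
have R_ex := mate_ex pN C_form pR zN zK C_valid C_z.
have R_fun := mate_fun pN C_form pR zN C_z.
have R_opp := mate_opp C_form pR zN C_z.
have R_nc := mate_nc C_form pR zN C_valid C_z.
have ncsp := matching_of_NCSP R_neg R_sym R_ex R_fun R_opp R_nc.
exists (matching_of n R); split=> // q; rewrite mem_CycB //.
rewrite -(cyc_mate pN C_form pR zN zK (@ext_out n z) C_valid C_z).
have MR := matched_matching_of R_neg R_sym.
by rewrite /cyc !MR.
Qed.

End ToMatching.

Local Close Scope ring_scope.

Theorem theorem5p8 (n : nat) (n_gt0 : 0 < n)
    (op : W n -> W n -> W n) (op_demazure : is_demazure op)
    (z : W n) (z_inv : z \in involutions n) :
  (forall M : {set {set pm n}}, NCSP z M ->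
     is_minimal (inv_atoms op z) (zeroB z M)
     /\ is_maximal (inv_atoms op z) (oneB z M))
  /\ (forall u : seq int, is_minimal (inv_atoms op z) u ->
        exists M : {set {set pm n}}, NCSP z M /\ u = zeroB z M)
  /\ (forall u : seq int, is_maximal (inv_atoms op z) u ->
        exists M : {set {set pm n}}, NCSP z M /\ u = oneB z M).
Proof.
have zV : z^-1%g = z by move: z_inv; rewrite inE => /eqP.
split; [|split].
- by move=> M M_ncsp; split; [exact: zeroB_minimal | exact: oneB_maximal].
- move=> u u_min; case: (u_min) => -[w /(inv_atomsP op_demazure _ zV) w_atom Eu] _.
  subst u.
  have no_cba := atom_no_double_descent op_demazure w_atom.
  have no_bca := minimal_no_bca op_demazure zV u_min w_atom.
  have low := no_bca_low (extK w) (extVK w) no_cba no_bca.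
  have C_form := descent_form (extK w) (extVK w) no_cba (or_introl low).
  have [V Mz] := (form_atom op_demazure zV C_form).1 w_atom.
  have [M [M_ncsp CM]] := form_matching zV C_form V Mz.
  by exists M; split; rewrite // (zeroB_oneline CM C_form low).
move=> u u_max; case: (u_max) => -[w /(inv_atomsP op_demazure _ zV) w_atom Eu] _.
subst u.
have no_cba := atom_no_double_descent op_demazure w_atom.
have no_cab := maximal_no_cab op_demazure zV u_max w_atom.
have high := no_cab_high (extK w) (extVK w) no_cba no_cab.
have C_form := descent_form (extK w) (extVK w) no_cba (or_intror high).
have [V Mz] := (form_atom op_demazure zV C_form).1 w_atom.
have [M [M_ncsp CM]] := form_matching zV C_form V Mz.
by exists M; split; rewrite // (oneB_oneline CM C_form high).
Qed.
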